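(* Let $m>1$ be an integer. For real analytic functions $c_1<c_2$ on $\mathbb{R}$ such that the $c_1<c_2$-zero-set $(c_1,c_2,D_{c_1,c_2},X_{m,c_1,c_2})$ is of SAB-at-Infinity-in-Top, write $\pi:=\pi_{m+1,1}|_{X_{m,c_1,c_2}}$, $(G_0,S_{G_0},c_{G_0}):=(R_{\pi},q_{\pi}(S(\pi)),\bar{\pi})$ (which is a pre-digraph) and $\Gamma:=\mathrm{GDNF}(G_0,S_{G_0},c_{G_0})$. Then the following hold. (1) If $\Gamma$ is isomorphic to a one-point set, or to a $1$-dimensional connected cell complex with exactly one vertex and exactly one edge, whose closure taken in the cell complex is homeomorphic to $\{t\in\mathbb{R}\mid t\ge 0\}$, then the $c_1<c_2$-zero-set must be normal. (2) Consider the following three cases: (a) $\Gamma$ is isomorphic to a $1$-dimensional connected cell complex with exactly two vertices and exactly one edge, whose closure taken in the cell complex is homeomorphic to $D^1$; (b) $\Gamma$ is isomorphic to a $1$-dimensional connected cell complex with exactly three vertices and exactly two edges, whose closures taken in the cell complex are homeomorphic to $D^1$ and which are both oriented as edges departing from one vertex; (c) $\Gamma$ is isomorphic to a $1$-dimensional connected cell complex with exactly three vertices and exactly two edges, whose closures taken in the cell complex are homeomorphic to $D^1$ and which are both oriented as edges entering one vertex. In these cases, the number of connected components of $G_0-\mathrm{NF}(G_0,S_{G_0})$ belonging to each element of the set of all equivalence classes $[C]$ of connected components of $G_0-\mathrm{NF}(G_0,S_{G_0})$ can be an arbitrary positive integer.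
   Context: **Reeb spaces.** For a continuous function $c:X\to\mathbb{R}$ on a topological space, $x_1\sim_c x_2$ iff $x_1,x_2$ lie in the same connected component of a level set $c^{-1}(y)$. The Reeb space is the quotient space $R_c:=X/{\sim_c}$, $q_c:X\to R_c$ is the quotient map, and $\bar c:R_c\to\mathbb{R}$ is the unique continuous function with $c=\bar c\circ q_c$. For a smooth function $c$ on a smooth manifold, $S(c)$ is the set of its critical points. $\pi_{k,k_1}:\mathbb{R}^k\to\mathbb{R}^{k_1}$ is the projection to the first $k_1$ coordinates. $D^j$ is the closed unit disk in $\mathbb{R}^j$ and $S^{j-1}$ its boundary sphere; $D^0$ is a point, $S^{-1}=\emptyset$. **Zero-sets.** For real analytic $c_1<c_2$ on $\mathbb{R}$ and an integer $m>1$, put $D_{c_1,c_2}:=\{(x_1,x_2)\in\mathbb{R}^2\mid c_1(x_2)<x_1<c_2(x_2)\}$ and $$X_{m,c_1,c_2}:=\Big\{(x_1,x_2,(y_j)_{j=1}^{m-1})\in\overline{D_{c_1,c_2}}\times\mathbb{R}^{m-1}\ \Big|\ (x_1-c_1(x_2))(c_2(x_2)-x_1)-\sum_{j=1}^{m-1}y_j^2=0\Big\}\subset\mathbb{R}^{m+1},$$ an $m$-dimensional smooth submanifold of $\mathbb{R}^{m+1}$ without boundary. The quadruple $(c_1,c_2,D_{c_1,c_2},X_{m,c_1,c_2})$ is called the $c_1<c_2$-zero-set. It is of *SAB-at-Infinity-in-Top* if, at each of the two infinities (as $x\to-\infty$, and as $x\to+\infty$), one of the following holds (possibly a different one at each infinity):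 $c_1(x)$ and $c_2(x)$ converge to the same real number; both diverge to $-\infty$; both diverge to $+\infty$. In that case $(R_\pi,q_\pi(S(\pi)),\bar\pi)$, with $\pi=\pi_{m+1,1}|_{X_{m,c_1,c_2}}$, is a pre-digraph in the sense below. **Cell complexes and graphs.** A cell complex is a Hausdorff space $X$ decomposed as a disjoint union of cells, each the image of a homeomorphism from $D^j-S^{j-1}$ onto a subset of $X$, such that for each $j$-cell $e$ the set $\overline{e}-e$ is a union of cells of dimension smaller than $j$. Here all cell complexes have dimension $0$ or $1$; $0$-cells are vertices, $1$-cells are edges. A graph is a locally finite CW complex of dimension $0$ or $1$ in which the closure of each edge is homeomorphic to $D^1$. **Pre-digraphs.** A pre-digraph is a triplet $(G_0,S_{G_0},c_{G_0})$ of a Hausdorff space $G_0$, a subset $S_{G_0}\subset G_0$ and a continuous function $c_{G_0}:G_0\to\mathbb{R}$ such that: $G_0-S_{G_0}$ is homeomorphic to a disjoint union $\bigsqcup_{e\in E_{G_0,S_{G_0}}}e$ of copies of $D^1-S^0$ (each homeomorphic to $\mathbb{R}$), and decomposing $G_0$ into these copies (the edges) and the points of $S_{G_0}$ makes $G_0$ a $0$- or $1$-dimensional cell complex whose set of $0$-cells is $S_{G_0}$; and $c_{G_0}$ is injective on each of these copies. A point $s\in G_0$ is NF (non-finite) if $s$ has no neighborhood in $G_0$ which is homeomorphic to a graph and contains no point of $S_{G_0}-\{s\}$. $\mathrm{NF}(G_0,S_{G_0})$ is the set of all NF points. **GDNF.** Write $N:=\mathrm{NF}(G_0,S_{G_0})$.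 On the set of connected components of $G_0-N$ let $\sim$ be the equivalence relation generated by the following rule: $C_1\sim C_2$ if there are non-empty families of edges $\{e_{1,j}\}_{j\in J_1},\{e_{2,j}\}_{j\in J_2}\subset E_{G_0,S_{G_0}}$ with $\bigsqcup_{j\in J_1}e_{1,j}\subset C_1$, $\bigsqcup_{j\in J_2}e_{2,j}\subset C_2$, and a point $s\in N$ lying in the closures in $G_0$ of both unions, such that either the restrictions of $c_{G_0}$ to both closures are maximal at $s$, or the restrictions of $c_{G_0}$ to both closures are minimal at $s$. The graph diagram $\mathrm{GDNF}(G_0,S_{G_0},c_{G_0})$ is the $0$- or $1$-dimensional cell complex with oriented edges defined as follows. Its vertices are the equivalence classes $[C]$ of connected components of $G_0-N$. Its edges are the elements $s\in N$. The edge $s$ departs from the vertex $V$ iff there are $C\in V$ and a non-empty family of edges $\{e_j\}_{j\in J}\subset E_{G_0,S_{G_0}}$ contained in $C$ such that $s\in\overline{\bigsqcup_j e_j}$ and $c_{G_0}|_{\overline{\bigsqcup_j e_j}}$ is maximal at $s$; it enters the vertex $V$ iff the same holds with ''minimal'' in place of ''maximal''. (An edge may have only a departing or only an entering vertex; the corresponding other end is then open.) Two such oriented complexes are isomorphic if there are bijections of vertices and of edges preserving the relations ''departs from'' and ''enters''. **Normality.** A pre-digraph is normal if each equivalence class $[C]$ of connected components of $G_0-N$ contains exactly one connected component. The $c_1<c_2$-zero-set is normal if $(R_\pi,q_\pi(S(\pi)),\bar\pi)$ is a pre-digraph and is normal.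
   Formalization: In (1), that the triplet is a pre-digraph is assumed rather than deduced from SAB-at-Infinity-in-Top, since it can fail: for m=2, c_1=-exp(-x^2), c_2=exp(-x^2) the Reeb space is not Hausdorff; in (2) it is proved. *)

(* Defs.v *)
From Stdlib Require Import Relation_Operators.
From HB Require Import structures.
From mathcomp Require Import all_boot all_order all_algebra generic_quotient.
From mathcomp Require Import all_classical all_reals all_analysis.

Set Implicit Arguments.
Unset Strict Implicit.
Unset Printing Implicit Defensive.

Import Order.TTheory GRing.Theory Num.Theory.
Import numFieldNormedType.Exports.

Local Open Scope classical_set_scope.
Local Open Scope ring_scope.
Local Open Scope quotient_scope.

(* A set [A : set T] coerces to the type [set_type A], which carries the
   subspace topology; [homeomorphic] is used for such subspaces as well. *)
Definition homeomorphic (T U : topologicalType) : Prop :=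
  exists (f : T -> U) (g : U -> T),
    [/\ continuous f, continuous g, cancel f g & cancel g f].

Definition components (T : topologicalType) (A : set T) : set (set T) :=
  [set C | exists2 x, A x & C = connected_component A x].

Section Reeb.
Context {R : realType} {T : topologicalType} (c : T -> R).

Definition reeb_rel (x y : T) : bool :=
  `[< connected_component (c @^-1` [set c x]) x y >].

Lemma reeb_rel_level x y : reeb_rel x y -> c y = c x.
Proof. by move=> /asboolP /connected_component_sub. Qed.

Lemma reeb_rel_refl : reflexive reeb_rel.
Proof. by move=> x; apply/asboolP; exact: connected_component_refl. Qed.

Lemma reeb_rel_sym : symmetric reeb_rel.
Proof.
suff sub x y : reeb_rel x y -> reeb_rel y x.
  by move=> x y; apply/idP/idP; exact: sub.
move=> xy; have cyx := reeb_rel_level xy; move/asboolP: xy => xy.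
by apply/asboolP; rewrite cyx; exact: connected_component_sym.
Qed.

Lemma reeb_rel_trans : transitive reeb_rel.
Proof.
move=> y x z xy; have cyx := reeb_rel_level xy; move/asboolP: xy => xy.
move=> /asboolP; rewrite cyx => yz; apply/asboolP.
exact: connected_component_trans yz.
Qed.

Canonical reeb_equiv :=
  EquivRel reeb_rel reeb_rel_refl reeb_rel_sym reeb_rel_trans.

Definition reeb_space : topologicalType :=
  quotient_topology {eq_quot reeb_equiv}.

Definition reeb_proj : T -> reeb_space := \pi_({eq_quot reeb_equiv}).

Definition reeb_bar : reeb_space -> R :=
  fun z => c (@repr _ {eq_quot reeb_equiv} z).

Lemma reeb_barE x : reeb_bar (reeb_proj x) = c x.
Proof.
apply: reeb_rel_level; rewrite reeb_rel_sym.
by have /eqmodP := reprK (\pi_({eq_quot reeb_equiv}) x).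
Qed.

Lemma reeb_bar_continuous : continuous c -> continuous reeb_bar.
Proof.
move=> cc; apply: (@repr_comp_continuous T {eq_quot reeb_equiv} R c cc).
by move=> x y /eqP /eqmodP xy; apply/eqP/esym/reeb_rel_level.
Qed.

End Reeb.

Section Critical.
Context {R : realType} {n : nat}.
Notation V := 'rV[R]_n.+1.

Definition smooth_curve (g : R -> V) : Prop :=
  forall k t, derivable (derive1n k g) t 1.

(* Tangent vectors are the velocities of smooth curves running in M. *)
Definition tangent_vector (M : set V) (p v : V) : Prop :=
  exists g : R -> V,
    [/\ smooth_curve g, forall t, M (g t), g 0 = p & derive1 g 0 = v].

(* Critical points of the restriction to M of a function f that is smooth on
   the ambient space: the differential vanishes on the tangent space of M. *)
Definition critical_points (M : set V) (f : V -> R) : set M :=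
  [set p : M | forall v, tangent_vector M (set_val p) v ->
                         'D_v f (set_val p) = 0].

End Critical.

Section ZeroSets.
Context {R : realType}.

Definition real_analytic (f : R -> R) : Prop :=
  forall a, exists (r : R) (u : nat -> R), 0 < r /\
    forall x, `|x - a| < r -> series (fun k => u k * (x - a) ^+ k) @ \oo --> f x.

Definition zero_set_pair (c1 c2 : R -> R) : Prop :=
  [/\ real_analytic c1, real_analytic c2 & forall x, c1 x < c2 x].

Definition region (c1 c2 : R -> R) : set (R * R) :=
  [set x | c1 x.2 < x.1 < c2 x.2].

(* The row vector p stands for (x_1, x_2, y_1, ..., y_{m-1}): the coordinates
   of index 0 and 1 are x_1 and x_2, those of index > 1 are the y_j. *)
Definition zero_set (m : nat) (c1 c2 : R -> R) : set 'rV[R]_m.+1 :=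
  [set p | let x1 := p ord0 ord0 in
           let x2 := p ord0 (inord 1) in
           closure (region c1 c2) (x1, x2) /\
           (x1 - c1 x2) * (c2 x2 - x1)
             - \sum_(i < m.+1 | (1 < i)%N) p ord0 i ^+ 2 = 0].

Definition same_end (c1 c2 : R -> R) (F : set_system R) : Prop :=
  [\/ exists l : R, c1 @ F --> l /\ c2 @ F --> l,
      c1 @ F --> -oo /\ c2 @ F --> -oo
    | c1 @ F --> +oo /\ c2 @ F --> +oo].

Definition SAB_at_infinity_in_top (c1 c2 : R -> R) : Prop :=
  same_end c1 c2 -oo /\ same_end c1 c2 +oo.

Definition first_coord (m : nat) (p : 'rV[R]_m.+1) : R := p ord0 ord0.

Definition zero_set_proj (m : nat) (c1 c2 : R -> R) (p : @zero_set m c1 c2) : R :=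
  first_coord (set_val p).

End ZeroSets.

Section CellComplexes.
Context (R : realType).

Definition D1 : set R := `[-1, 1].
Definition openD1 : set R := `]-1, 1[.
Definition S0 : set R := [set -1; 1].

(* V is the set of points that are 0-cells, E the set of the 1-cells. *)
Definition cell_complex (T : topologicalType)
    (V : set T) (E : set (set T)) : Prop :=
  [/\ hausdorff_space T,
      \bigcup_(e in E) e = ~` V,
      trivIset E id,
      forall e, E e -> homeomorphic openD1 e
    & forall e, E e -> closure e `\` e `<=` V].

Definition characteristic_map (T : topologicalType)
    (V e : set T) (phi : R -> T) : Prop :=
  [/\ {within D1, continuous phi},
      phi @` S0 `<=` V,
      phi @` openD1 = e
    & exists psi : T -> R, {within e, continuous psi} /\
        forall t, openD1 t -> psi (phi t) = t].

(* Closure-finiteness is automatic in dimension at most 1. *)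
Definition CW_complex (T : topologicalType)
    (V : set T) (E : set (set T)) : Prop :=
  [/\ cell_complex V E,
      forall e, E e -> exists phi, characteristic_map V e phi
    & forall A : set T,
        (forall e, E e -> closed (A `&` closure e)) -> closed A].

Definition locally_finite_cells (T : topologicalType)
    (V : set T) (E : set (set T)) : Prop :=
  forall x : T, exists U, [/\ nbhs x U, finite_set (V `&` U)
    & finite_set [set e | E e /\ e `&` U !=set0]].

Definition graph (T : topologicalType) : Prop :=
  exists (V : set T) (E : set (set T)),
    [/\ CW_complex V E, locally_finite_cells V E
      & forall e, E e -> homeomorphic D1 (closure e)].

End CellComplexes.

Arguments D1 : clear implicits.
Arguments openD1 : clear implicits.
Arguments S0 : clear implicits.
Arguments cell_complex : clear implicits.
Arguments cell_complex R {T} V E.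
Arguments graph : clear implicits.

Section PreDigraphs.
Context {R : realType} {G : topologicalType} (S : set G) (c : G -> R).

(* When G - S is homeomorphic to a disjoint union of open intervals, these
   intervals are exactly its connected components. *)
Definition edges : set (set G) := components (~` S).

Definition pre_digraph : Prop :=
  [/\ continuous c,
      exists I : choiceType, homeomorphic {i : I & openD1 R} (~` S),
      cell_complex R S edges
    & forall e, edges e -> {in e &, injective c}].

(* NF: non-finite. *)
Definition NF : set G :=
  [set s | ~ exists U : set G,
     [/\ nbhs s U, U `&` (S `\ s) = set0
       & exists K : topologicalType, graph R K /\ homeomorphic U K]].

Definition extremal_at (le : G -> G -> Prop) (C : set G) (s : G) : Prop :=
  exists J : set (set G), let Z := closure (\bigcup_(e in J) e) in
    [/\ J !=set0, J `<=` edges, \bigcup_(e in J) e `<=` C, Z s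
      & forall z, Z z -> le z s].

Definition maximal_at := extremal_at (fun z s => c z <= c s).
Definition minimal_at := extremal_at (fun z s => c s <= c z).

Definition NF_components : set (set G) := components (~` NF).

Definition NF_rule (C1 C2 : set G) : Prop :=
  [/\ NF_components C1, NF_components C2
    & exists2 s, NF s &
        (maximal_at C1 s /\ maximal_at C2 s) \/
        (minimal_at C1 s /\ minimal_at C2 s)].

Definition NF_class (C : set G) : set (set G) :=
  [set C' | NF_components C' /\ clos_refl_sym_trans (set G) NF_rule C C'].

Definition NF_classes : set (set (set G)) :=
  [set V | exists2 C, NF_components C & V = NF_class C].

Definition normal : Prop := forall V, NF_classes V -> exists! C, V C.

End PreDigraphs.

Arguments NF R {G} S.

(* A cell complex of dimension at most 1 with oriented edges, recorded by its
   incidences; an edge that departs from (enters) no vertex is open at its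
   initial (final) end. *)
Record diagram := Diagram {
  vertex : Type;
  edge : Type;
  departs : edge -> vertex -> Prop;
  enters : edge -> vertex -> Prop }.

Definition is_diagram_iso (A B : diagram)
    (f : vertex A -> vertex B) (g : edge A -> edge B) : Prop :=
  [/\ bijective f, bijective g,
      forall e v, departs e v <-> departs (g e) (f v)
    & forall e v, enters e v <-> enters (g e) (f v)].

Definition diagram_isomorphic (A B : diagram) : Prop :=
  exists (f : vertex A -> vertex B) (g : edge A -> edge B), is_diagram_iso f g.

Definition GDNF (R : realType) (G : topologicalType)
    (S : set G) (c : G -> R) : diagram :=
  {| vertex := set_type (NF_classes S c);
     edge := set_type (NF R S);
     departs := fun s V =>
       exists2 C, set_val V C & maximal_at S c C (set_val s);
     enters := fun s V =>
       exists2 C, set_val V C & minimal_at S c C (set_val s) |}.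

Definition point_diagram : diagram :=
  {| vertex := unit; edge := void;
     departs := fun _ _ => False; enters := fun _ _ => False |}.

(* One vertex and one edge with exactly one end at it: the closure of the edge
   is a half-line. The boolean tells whether the edge departs from the vertex
   or enters it. *)
Definition ray_diagram (out : bool) : diagram :=
  {| vertex := unit; edge := unit;
     departs := fun _ _ => out = true; enters := fun _ _ => out = false |}.

Definition segment_diagram : diagram :=
  {| vertex := bool; edge := unit;
     departs := fun _ v => v = false; enters := fun _ v => v = true |}.

(* Two edges sharing the vertex [None], with distinct other ends. *)
Definition two_out_diagram : diagram :=
  {| vertex := option bool; edge := bool;
     departs := fun _ v => v = None; enters := fun e v => v = Some e |}.

Definition two_in_diagram : diagram :=
  {| vertex := option bool; edge := bool;
     departs := fun e v => v = Some e; enters := fun _ v => v = None |}.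

Section ZeroSetGraph.
Context {R : realType} (m : nat) (c1 c2 : R -> R).

Definition ZG : topologicalType := reeb_space (@zero_set_proj R m c1 c2).

Definition ZS : set ZG :=
  reeb_proj (@zero_set_proj R m c1 c2)
    @` critical_points (M := @zero_set R m c1 c2) (@first_coord R m).

Definition Zc : ZG -> R := reeb_bar (c := @zero_set_proj R m c1 c2).

Definition zero_set_pre_digraph : Prop := pre_digraph ZS Zc.

Definition zero_set_normal : Prop := zero_set_pre_digraph /\ normal ZS Zc.

Definition zero_set_GDNF : diagram := GDNF ZS Zc.

Definition class_of_vertex (v : vertex zero_set_GDNF) : set (set ZG) :=
  set_val v.

End ZeroSetGraph.

(* Main.v *)
Require Import Defs.
From Stdlib Require Import Relation_Operators.
From mathcomp Require Import all_boot all_order all_algebra.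
From mathcomp Require Import all_classical all_reals all_analysis.
From mathcomp Require Import ring lra.

Set Implicit Arguments.
Unset Strict Implicit.
Unset Printing Implicit Defensive.

Import Order.TTheory GRing.Theory Num.Theory.
Import numFieldNormedType.Exports.

Local Open Scope classical_set_scope.
Local Open Scope card_scope.
Local Open Scope ring_scope.

(** A point of the zero-set is a point (t, x) of the closed strip c1 x <= t <= c2 x
    together with a direction in S^(m-2), which is irrelevant on the two boundary
    curves; the projection is (t, x) |-> t. Its critical points lie over the points
    where t is a critical value of c1 or c2 reached at x, and if no slice of the
    strip is a full line the Reeb space is the planar one: the interval components
    of the slices.

    Part (1). If NF is a single point s, one which is not, say, a minimal end of
    any component of its complement, then no point of the level component L over s
    can be left upwards inside the strip: otherwise the segment leaving L upwards
    meets, at a dense set of heights because critical values are countable, edges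
    lying above s and accumulating at s. Hence L is contained in the graph of c2,
    and every point outside L can be joined to the connected graph of c1 by
    descending; the complement of s is connected.

    Part (2). We write down c2 with n1 humps of height 1 to the left and n2 humps
    to the right of a valley of negative minimum, and c1 with n0 wells, the first
    under the valley and the other ones under the leftmost hump, both functions
    tending to 0 at the two ends. The components of the strip off the level 0 are
    the n1 + n2 humps and the n0 wells. The level 0 itself is NF exactly at the two
    outer ends, where critical values accumulate at 0. The humps on either side
    hang on the corresponding end from above, the wells on the left end from below,
    and the main well on both ends. *)

(** * Real analytic functions and their critical values *)

Section PowerSeries.
Context {R : realType}.
Implicit Types (f g : R -> R) (u v : R^nat) (a h x : R).

(** Analyticity forbids gluing humps and wells from bump functions. They come instead from
    polynomials taking the value [sin (N t) ^ 2] at [cos t], composed with polynomials in a single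
    analytic sigmoid whose derivative vanishes unboundedly far on both sides; these zeros supply the
    infinitely many critical values near level 0. At any other level accumulation is excluded by
    compactness, since both boundary functions tend to 0. The diagram does not see how many pieces a
    class has: pieces hanging on one NF point from the same side are identified, so the numbers of
    humps and wells are free. Part (1) cannot use the planar picture, because a slice may be a full
    line, and for m = 2 such a slice gives two components. It uses cross-sections with a fixed
    direction in the sphere factor, and knows edges only as components of the complement of the
    critical set, open relative to it. Reflecting the level exchanges the two orientations, which
    halves both parts. *)

Definition analytic_near f a := exists (M B : R) u,
  [/\ 0 < M, 0 <= B, forall k, `|u k| <= B * M ^+ k
    & forall h, `|h| * M < 1 -> pseries u h @ \oo --> f (a + h)].

(** Convergence at distance [r / 2] bounds the terms there, which is a geometric bound on the
    coefficients with [M = (r / 2)^-1]. In this form convergence is automatic, and derivatives,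
    products and reciprocals only change the pair [(M, B)]. *)
Lemma real_analyticP f : real_analytic f <-> forall a, analytic_near f a.
Proof.
split=> [fa a|fa a].
  have [r [u [r0 fu]]] := fa a.
  have r20 : 0 < r / 2 by rewrite divr_gt0.
  have cu : cvgn (pseries u (r / 2)).
    apply/cvg_ex; exists (f (a + r / 2)).
    have := fu (a + r / 2); rewrite addrAC subrr add0r gtr0_norm //.
    by apply; rewrite ltr_pdivrMr // ltr_pMr // ltr1n.
  have [K [Kreal Kf]] := cvg_series_bounded cu.
  exists (r / 2)^-1, (`|K| + 1), u; split; rewrite ?invr_gt0 //.
  - move=> k; rewrite exprVn ler_pdivlMr ?exprn_gt0 //.
    have K1 : K < `|K| + 1 by rewrite (le_lt_trans (ler_norm K)) // ltrDl.
    have := Kf _ K1 k I.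
    by rewrite /= normrM (gtr0_norm (exprn_gt0 _ r20)).
  - move=> h hr; have := fu (a + h); rewrite addrAC subrr add0r; apply.
    move: hr; rewrite ltr_pdivrMr // mul1r => /lt_le_trans; apply.
    by rewrite ler_pdivrMr // ler_pMr // ler1n.
have [M [B [u [M0 B0 uB fu]]]] := fa a.
exists M^-1, u; split; first by rewrite invr_gt0.
move=> x xM; have := fu (x - a); rewrite subrKC; apply.
by rewrite -ltr_pdivlMr // mul1r.
Qed.

Lemma analytic_near_le f a (M B : R) u (M' : R) : 0 < M -> M <= M' -> 0 <= B ->
  (forall k, `|u k| <= B * M ^+ k) ->
  (forall h, `|h| * M < 1 -> pseries u h @ \oo --> f (a + h)) ->
  (forall k, `|u k| <= B * M' ^+ k) /\
  (forall h, `|h| * M' < 1 -> pseries u h @ \oo --> f (a + h)).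
Proof.
move=> M0 MM B0 uB fu; split=> [k|h hM].
  apply: le_trans (uB k) _; rewrite ler_wpM2l // lerXn2r // ?nnegrE ltW //.
  exact: lt_le_trans MM.
by apply: fu; apply: le_lt_trans hM; rewrite ler_wpM2l.
Qed.

Lemma is_cvg_pseries_bound u (M B : R) h : 0 < M ->
  (forall k, `|u k| <= B * M ^+ k) -> `|h| * M < 1 -> cvgn (pseries u h).
Proof.
move=> M0 uB hM; apply: normed_cvg.
apply: (@series_le_cvg _ _ (geometric B (`|h| * M))) => [n|n|n|].
- exact: normr_ge0.
- rewrite /= mulr_ge0 ?exprn_ge0 ?mulr_ge0 ?(ltW M0) //.
  by apply: le_trans (normr_ge0 _) _; have := uB 0%N; rewrite expr0 mulr1; exact.
- rewrite /= normrM normrX exprMn (mulrC (_ ^+ n) (M ^+ n)) mulrA.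
  by rewrite ler_wpM2r ?exprn_ge0 //; apply: uB.
- by apply: is_cvg_geometric_series; rewrite normrM normr_id gtr0_norm.
Qed.

Lemma pseries_diffs_bound u (M B : R) : 0 < M -> 0 <= B ->
  (forall k, `|u k| <= B * M ^+ k) ->
  forall k, `|pseries_diffs u k| <= (B * M) * (2 * M) ^+ k.
Proof.
move=> M0 B0 uB k; rewrite /pseries_diffs normrM normr_nat.
apply: (@le_trans _ _ ((2 ^+ k) * (B * M ^+ k.+1))).
  apply: ler_pM => //; rewrite -natrX ler_nat.
  exact: ltn_expl.
by rewrite exprMn exprS; lra.
Qed.

Lemma analytic_near_is_derive f a : analytic_near f a ->
  exists f' : R -> R, analytic_near f' a /\
    \forall x \near a, is_derive (x : R) (1 : R) f (f' x).
Proof.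
move=> [M [B [u [M0 B0 uB fu]]]].
have uB' := pseries_diffs_bound M0 B0 uB.
have M20 : 0 < 2 * M by rewrite mulr_gt0.
have BM0 : 0 <= B * M by rewrite mulr_ge0 // ltW.
have uB'' := pseries_diffs_bound M20 BM0 uB'.
have M40 : 0 < 2 * (2 * M) by rewrite mulr_gt0.
(* Termwise differentiation needs convergence at [K] of the series and of its first two derived
   series, whose geometric ratios are [M], [2 M] and [4 M]. *)
pose K := (8 * M)^-1.
have K0 : 0 < K by rewrite invr_gt0 mulr_gt0.
have KM (M' : R) : 0 < M' -> M' <= 4 * M -> `|K| * M' < 1.
  by move=> M'0 M'M; rewrite gtr0_norm // mulrC ltr_pdivrMr ?mulr_gt0 //; lra.
exists (fun x => limn (pseries (pseries_diffs u) (x - a))); split.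
  exists (2 * M), (B * M), (pseries_diffs u); split => // h hM.
  by rewrite addrAC subrr add0r; apply: is_cvg_pseries_bound uB' hM.
have KM1 : K * M < 1 by have := KM M; rewrite gtr0_norm //; apply; lra.
near=> x.
have xa : `|x - a| < K.
  by rewrite distrC; near: x; exact: nbhsx_ballx.
have D : is_derive (x - a) 1 (fun x => limn (pseries u x))
     (limn (pseries (pseries_diffs u) (x - a))).
  apply: (@pseries_snd_diffs _ _ K).
  - by apply: is_cvg_pseries_bound uB _ => //; apply: KM; lra.
  - by apply: is_cvg_pseries_bound uB' _ => //; apply: KM; lra.
  - by apply: is_cvg_pseries_bound uB'' _ => //; apply: KM; lra.
  - by rewrite (gtr0_norm K0).
have D2 : is_derive x (1 : R) (fun z => z - a) (1 : R).
  by apply: is_derive_eq; rewrite subr0.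
have := @is_derive1_comp _ (fun x => limn (pseries u x)) (fun z => z - a) x _ _ D D2.
rewrite mulr1; apply: near_eq_is_derive.
near=> z => /=.
have za : `|z - a| < K.
  rewrite -(subrK x z) -addrA (le_lt_trans (ler_normD _ _)) //.
  rewrite -ltrBrDr distrC; near: z; apply: nbhsx_ballx; rewrite subr_gt0 //.
have : pseries u (z - a) @ \oo --> f z.
  have := fu (z - a); rewrite subrKC; apply.
  by apply: lt_trans KM1; rewrite ltr_pM2r.
by move/(cvg_lim (@Rhausdorff _)).
Unshelve. all: by end_near. Qed.

Lemma analytic_near_eq f g a : (\forall x \near a, f x = g x) ->
  analytic_near f a -> analytic_near g a.
Proof.
move=> /nbhs_ballP[e /= e0 fg] [M [B [u [M0 B0 uB fu]]]].
have MM : M <= M + e^-1 by rewrite lerDl invr_ge0 ltW.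
have [uB' fu'] := analytic_near_le M0 MM B0 uB fu.
have M'0 : 0 < M + e^-1 by rewrite addr_gt0 ?invr_gt0.
exists (M + e^-1), B, u; split => // h hM.
rewrite -fg; first exact: fu'.
rewrite /ball /= opprD addrA subrr add0r normrN.
rewrite -(mulr1 e) -ltr_pdivrMl //; apply: le_lt_trans hM.
by rewrite mulrC ler_wpM2l // lerDr ltW.
Qed.

Lemma real_analytic_derivable f x : real_analytic f -> derivable f x 1.
Proof.
move=> /real_analyticP /(_ x) /analytic_near_is_derive[f' [_]].
by move=> /nbhs_singleton [].
Qed.

Lemma real_analytic_derive1 f : real_analytic f -> real_analytic (derive1 f).
Proof.
move=> /real_analyticP fa; apply/real_analyticP => a.
have [f' [f'a ff']] := analytic_near_is_derive (fa a).
apply: analytic_near_eq f'a; near=> x.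
have [_ <-] : is_derive x 1 f (f' x) by near: x.
by rewrite derive1E.
Unshelve. all: by end_near. Qed.

Lemma real_analytic_smooth f : real_analytic f ->
  forall k x, derivable (derive1n k f) x 1.
Proof.
move=> fa k x; apply: real_analytic_derivable.
elim: k => [//|k IH].
by rewrite derive1nS; exact: real_analytic_derive1.
Qed.

Lemma real_analytic_continuous f : real_analytic f -> continuous f.
Proof.
by move=> fa x; apply/differentiable_continuous/derivable1_diffP/real_analytic_derivable.
Qed.

Lemma analytic_near_common f g a : analytic_near f a -> analytic_near g a ->
  exists (M B : R) u v, [/\ 0 < M, 0 <= B, forall k, `|u k| <= B * M ^+ k,
    forall k, `|v k| <= B * M ^+ k &
    forall h, `|h| * M < 1 ->
     pseries u h @ \oo --> f (a + h) /\ pseries v h @ \oo --> g (a + h)].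
Proof.
move=> [M [B [u [M0 B0 uB fu]]]] [N [C [v [N0 C0 vC gv]]]].
have MP : M <= M + N by rewrite lerDl ltW.
have NP : N <= M + N by rewrite lerDr ltW.
have [uB' fu'] := analytic_near_le M0 MP B0 uB fu.
have [vC' gv'] := analytic_near_le N0 NP C0 vC gv.
have P0 : 0 < M + N by rewrite addr_gt0.
exists (M + N), (B + C), u, v; split; rewrite ?addr_ge0 //.
- by move=> k; apply: le_trans (uB' k) _; rewrite ler_wpM2r ?exprn_ge0 ?(ltW P0) // lerDl.
- by move=> k; apply: le_trans (vC' k) _; rewrite ler_wpM2r ?exprn_ge0 ?(ltW P0) // lerDr.
- by move=> h hM; split; [exact: fu'|exact: gv'].
Qed.

Lemma analytic_nearD f g a : analytic_near f a -> analytic_near g a ->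
  analytic_near (f \+ g) a.
Proof.
move=> fa ga; have [M [B [u [v [M0 B0 uB vB uv]]]]] := analytic_near_common fa ga.
exists M, (B + B), (u + v); split; rewrite ?addr_ge0 //.
  by move=> k; rewrite (le_trans (ler_normD _ _)) // mulrDl lerD.
move=> h hM; have [hu hv] := uv h hM.
have -> : pseries (u + v) h = pseries u h + pseries v h.
  rewrite /pseries -seriesD; congr series.
  by apply/funext => k /=; rewrite -mulrDl.
exact: cvgD.
Qed.

Let conv u v k := \sum_(i < k.+1) u i * v (k - i)%N.

Let cauchy_triangle (b c : R^nat) n :
  \sum_(k < n) \sum_(i < k.+1) b i * c (k - i)%N =
  \sum_(i < n) \sum_(j < n - i) b i * c j.
Proof.
elim: n => [|n IH]; first by rewrite !big_ord0.
rewrite big_ord_recr /= IH [RHS]big_ord_recr /= subSnn big_ord1.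
rewrite (big_ord_recr n) /= subnn addrA -big_split /=; congr (_ + _).
apply: eq_bigr => i _.
by rewrite subSn ?(ltnW (ltn_ord i)) // big_ord_recr.
Qed.

(** The product of the two partial sums exceeds the partial sum of the Cauchy product by the terms
    with [i, j < n <= i + j]. There are at most [n * n <= 4 ^ n] of them, each at most
    [B * B * q ^ n] in absolute value, so the difference is dominated by a geometric sequence of
    ratio [4 q < 1]. The factor 8 in the hypothesis leaves room for this. *)
Lemma cvg_cauchy_product u v (M B h F G : R) : 0 < M -> 0 <= B ->
  (forall k, `|u k| <= B * M ^+ k) -> (forall k, `|v k| <= B * M ^+ k) ->
  `|h| * (8 * M) < 1 ->
  pseries u h @ \oo --> F -> pseries v h @ \oo --> G ->
  pseries (conv u v) h @ \oo --> F * G.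
Proof.
move=> M0 B0 uB vB hM hu hv.
have q0 : 0 <= `|h| * M by rewrite mulr_ge0 // ltW.
set q := `|h| * M in q0 *.
have q8 : 4 * q < 1 by move: hM; rewrite mulrCA -/q; lra.
have q1 : q <= 1 by lra.
have aB (w : R^nat) : (forall k, `|w k| <= B * M ^+ k) ->
    forall k, `|w k * h ^+ k| <= B * q ^+ k.
  move=> wB k; rewrite normrM normrX exprMn (mulrC (_ ^+ k) (M ^+ k)) mulrA.
  by rewrite ler_wpM2r ?exprn_ge0 //; apply: wB.
have uB' := aB _ uB; have vB' := aB _ vB.
pose b k := u k * h ^+ k; pose c k := v k * h ^+ k.
have E n : pseries u h n * pseries v h n - pseries (conv u v) h n =
    \sum_(i < n) \sum_(n - i <= j < n) b i * c j.
  rewrite /pseries !seriesEord /=.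
  have -> : \sum_(k < n) conv u v k * h ^+ k =
      \sum_(k < n) \sum_(i < k.+1) b i * c (k - i)%N.
    apply: eq_bigr => k _; rewrite /conv mulr_suml; apply: eq_bigr => i _.
    have -> : h ^+ k = h ^+ i * h ^+ (k - i).
      by rewrite -exprD subnKC // -ltnS ltn_ord.
    by rewrite /b /c; ring.
  rewrite cauchy_triangle mulr_suml -sumrB; apply: eq_bigr => i _.
  rewrite -(big_mkord xpredT (fun j => v j * h ^+ j)).
  rewrite -(big_mkord xpredT (fun j => b i * c j)).
  rewrite (@big_cat_nat _ _ _ (n - i)%N) //= ?leq_subr //.
  by rewrite mulrDr !mulr_sumr addrAC subrr add0r.
have N0 : (fun n => pseries u h n * pseries v h n - pseries (conv u v) h n)
    @ \oo --> 0.
  apply: norm_cvg0.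
  apply: (@squeeze_cvgr _ _ _ _ (fun=> 0) (geometric (B * B) (4 * q))).
  - near=> n; rewrite normr_ge0 /= E.
    have n4 : (n * n <= 4 ^ n)%N.
      by rewrite (_ : 4 = 2 * 2)%N // expnMn leq_mul // ltnW // ltn_expl.
    apply: le_trans (ler_norm_sum _ _ _) _.
    apply: (@le_trans _ _ (\sum_(i < n) n%:R * (B * B * q ^+ n))).
      apply: ler_sum => i _; apply: le_trans (ler_norm_sum _ _ _) _.
      apply: (@le_trans _ _ (\sum_(n - i <= j < n) (B * B * q ^+ n))).
        apply: ler_sum_nat => j /andP[nj jn]; rewrite normrM.
        apply: (@le_trans _ _ ((B * q ^+ i) * (B * q ^+ j))).
          by apply: ler_pM => //; [exact: uB'|exact: vB'].
        rewrite mulrACA -exprD ler_wpM2l ?mulr_ge0 //.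
        by rewrite ler_wiXn2l // -leq_subLR.
      rewrite sumr_const_nat -[leLHS]mulr_natl ler_wpM2r ?mulr_ge0 ?exprn_ge0 //.
      by rewrite ler_nat leq_subr.
    rewrite sumr_const card_ord -[leLHS]mulr_natl mulrA -natrM /= [in leRHS]exprMn.
    rewrite mulrCA; rewrite ler_wpM2l ?mulr_ge0 //. rewrite ler_wpM2r ?exprn_ge0 //.
    by rewrite -natrX ler_nat.
  - exact: cvg_cst.
  - by apply: cvg_geometric; rewrite ger0_norm // mulr_ge0.
rewrite -[F * G]subr0.
rewrite (_ : pseries (conv u v) h = fun n => pseries u h n * pseries v h n -
  (pseries u h n * pseries v h n - pseries (conv u v) h n)); last first.
  by apply/funext => n; rewrite opprB addrC subrK.
exact: cvgB (cvgM hu hv) N0.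
Unshelve. all: by end_near. Qed.

Lemma conv_bound u v (M B : R) : 0 < M -> 0 <= B ->
  (forall k, `|u k| <= B * M ^+ k) -> (forall k, `|v k| <= B * M ^+ k) ->
  forall k, `|conv u v k| <= B * B * (8 * M) ^+ k.
Proof.
move=> M0 B0 uB vB k; apply: le_trans (ler_norm_sum _ _ _) _.
apply: (@le_trans _ _ (\sum_(i < k.+1) (B * B * M ^+ k))).
  apply: ler_sum => i _; rewrite normrM.
  apply: (@le_trans _ _ ((B * M ^+ i) * (B * M ^+ (k - i)))).
    by apply: ler_pM.
  by rewrite mulrACA -exprD subnKC // -ltnS ltn_ord.
rewrite sumr_const card_ord -[leLHS]mulr_natl exprMn mulrCA ler_wpM2l ?mulr_ge0 //.
rewrite ler_wpM2r ?exprn_ge0 ?(ltW M0) //.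
apply: (@le_trans _ _ (2 ^+ k)); first by rewrite -natrX ler_nat ltn_expl.
by rewrite lerXn2r ?nnegrE ?ler_nat.
Qed.

Lemma analytic_nearM f g a : analytic_near f a -> analytic_near g a ->
  analytic_near (f \* g) a.
Proof.
move=> fa ga; have [M [B [u [v [M0 B0 uB vB uv]]]]] := analytic_near_common fa ga.
exists (8 * M), (B * B), (conv u v); split; rewrite ?mulr_gt0 ?mulr_ge0 //.
  exact: conv_bound.
move=> h hM; have [|hu hv] := uv h; last exact: (cvg_cauchy_product M0 B0 uB vB hM hu hv).
by apply: le_lt_trans hM; rewrite ler_wpM2l // ler_peMl ?ltW // ltr1n.
Qed.

End PowerSeries.

(** * Elementary functions and algebraic closure of analyticity *)

Section Closure.
Context {R : realType}.
Implicit Types (f g : R -> R) (u v : R^nat) (a h x : R).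

Let conv u v k := \sum_(i < k.+1) u i * v (k - i)%N.

Lemma pseries0 u : pseries u 0 @ \oo --> u 0%N.
Proof.
apply/cvg_ballP => e e0; near=> n.
have n0 : (0 < n)%N by near: n; exists 1%N.
rewrite /pseries seriesEord /= -(prednK n0) big_ord_recl /= expr0 mulr1.
rewrite big1 ?addr0; first exact: ballxx.
by move=> i _; rewrite /bump /= add1n expr0n /= mulr0.
Unshelve. all: by end_near. Qed.

Lemma cvg_pseries_finite u N h : (forall k, (N <= k)%N -> u k = 0) ->
  pseries u h @ \oo --> \sum_(k < N) u k * h ^+ k.
Proof.
move=> uN; apply: cvg_near_cst; near=> n.
have Nn : (N <= n)%N by near: n; exists N.
rewrite /pseries seriesEord /= -!(big_mkord xpredT (fun k => u k * h ^+ k)).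
rewrite (@big_cat_nat _ _ _ N) //= [X in _ + X]big_nat_cond [X in _ + X]big1 ?addr0 //.
by move=> i; rewrite andbT => /andP[Ni _]; rewrite uN // mul0r.
Unshelve. all: by end_near. Qed.

Lemma analytic_near_cst (c : R) a : analytic_near (fun=> c) a.
Proof.
exists 1, `|c|, (fun k => if k is 0%N then c else 0); split => //.
  by case=> [|k]; rewrite expr1n mulr1 // normr0.
move=> h _.
have := @cvg_pseries_finite (fun k => if k is 0%N then c else 0) 1 h.
by rewrite big_ord1 expr0 mulr1; apply; case.
Qed.

Lemma analytic_near_id a : analytic_near id a.
Proof.
exists 1, (`|a| + 1), (fun k => if k is 0%N then a else (k == 1%N)%:R); split => //.
  case=> [|k]; rewrite expr1n mulr1 ?lerDl // normr_nat.
  by case: eqP => _; rewrite ?lerDr // addr_ge0.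
move=> h _.
have := @cvg_pseries_finite (fun k => if k is 0%N then a else (k == 1%N)%:R) 2 h.
by rewrite big_ord_recl big_ord1 /= expr0 mulr1 mul1r; apply; case=> [|[]].
Qed.

Lemma analytic_near_shift f a : analytic_near f 0 ->
  analytic_near (fun x => f (x - a)) a.
Proof.
move=> [M [B [u [M0 B0 uB fu]]]]; exists M, B, u; split => // h /fu.
by rewrite add0r addrAC subrr add0r.
Qed.

(** The addition formula carries the expansion at 0 to any other point; sine and cosine are treated
    in the same way. *)
Lemma analytic_near_expR a : analytic_near expR a.
Proof.
have E0 : analytic_near (@expR R) 0.
  exists 1, 1, (fun k => k`!%:R^-1); split => //.
    move=> k; rewrite expr1n mulr1 ger0_norm ?invr_ge0 //.
    by rewrite invf_le1 ?ltr0n ?fact_gt0 // ler1n fact_gt0.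
  move=> h _; rewrite add0r /pseries -exp_coeffE.
  exact: is_cvg_series_exp_coeff.
apply: (@analytic_near_eq _ ((fun=> expR a) \* (fun x => expR (x - a)))).
  by near=> x; rewrite /= -expRD subrKC.
exact: (analytic_nearM (analytic_near_cst _ _) (analytic_near_shift a E0)).
Unshelve. all: by end_near. Qed.

Let analytic_near_sin0 : analytic_near (@sin R) 0.
Proof.
exists 1, 1, (fun n => (odd n)%:R * (-1) ^+ n.-1./2 * n`!%:R^-1); split => //.
  move=> k; rewrite expr1n mulr1 !normrM normr_nat normrX normrN1 expr1n mulr1.
  rewrite (@ger0_norm _ (_^-1)) ?invr_ge0 //.
  case: odd; rewrite ?mul0r // mul1r.
  by rewrite invf_le1 ?ltr0n ?fact_gt0 // ler1n fact_gt0.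
move=> h _; rewrite add0r sin.unlock /pseries.
have -> : [sequence (odd i)%:R * (-1) ^+ i.-1./2 * i`!%:R^-1 * h ^+ i]_i = sin_coeff h.
  by apply/funext => i; rewrite sin_coeffE.
exact: is_cvg_series_sin_coeff.
Qed.

Let analytic_near_cos0 : analytic_near (@cos R) 0.
Proof.
exists 1, 1, (fun n => (~~ odd n)%:R * (-1) ^+ n./2 * n`!%:R^-1); split => //.
  move=> k; rewrite expr1n mulr1 !normrM normr_nat normrX normrN1 expr1n mulr1.
  rewrite (@ger0_norm _ (_^-1)) ?invr_ge0 //.
  case: odd; rewrite ?mul0r //= mul1r.
  by rewrite invf_le1 ?ltr0n ?fact_gt0 // ler1n fact_gt0.
move=> h _; rewrite add0r cos.unlock /pseries.
have -> : [sequence (~~ odd i)%:R * (-1) ^+ i./2 * i`!%:R^-1 * h ^+ i]_i = cos_coeff h.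
  by apply/funext => i; rewrite cos_coeffE.
exact: is_cvg_series_cos_coeff.
Qed.

Lemma analytic_near_sin a : analytic_near sin a.
Proof.
apply: (@analytic_near_eq _ (((fun=> sin a) \* (fun x => cos (x - a))) \+
  ((fun=> cos a) \* (fun x => sin (x - a))))).
  by near=> x; rewrite /= -sinD subrKC.
apply: analytic_nearD; apply: analytic_nearM; try exact: analytic_near_cst.
  exact: (analytic_near_shift a analytic_near_cos0).
exact: (analytic_near_shift a analytic_near_sin0).
Unshelve. all: by end_near. Qed.

Lemma analytic_near_cos a : analytic_near cos a.
Proof.
apply: (@analytic_near_eq _ (((fun=> cos a) \* (fun x => cos (x - a))) \+
  ((fun=> - sin a) \* (fun x => sin (x - a))))).
  by near=> x; rewrite /= mulNr -cosD subrKC.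
apply: analytic_nearD; apply: analytic_nearM; try exact: analytic_near_cst.
  exact: (analytic_near_shift a analytic_near_cos0).
exact: (analytic_near_shift a analytic_near_sin0).
Unshelve. all: by end_near. Qed.

(** Coefficients of the reciprocal power series. Each one depends on all the previous ones, so the
    whole list is built in order to keep the recursion structural. *)
Fixpoint inv_coef_seq u n : seq R :=
  if n is k.+1 then
    let s := inv_coef_seq u k in
    rcons s (- (u 0%N)^-1 * \sum_(i < k.+1) u i.+1 * s`_(k - i))
  else [:: (u 0%N)^-1].

Definition inv_coef u n := (inv_coef_seq u n)`_n.

Lemma size_inv_coef_seq u n : size (inv_coef_seq u n) = n.+1.
Proof. by elim: n => //= n IH; rewrite size_rcons IH. Qed.

Lemma nth_inv_coef_seq u n k : (k <= n)%N -> (inv_coef_seq u n)`_k = inv_coef u k.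
Proof.
elim: n => [|n IH]; first by rewrite leqn0 => /eqP->.
rewrite leq_eqVlt => /predU1P[->//|kn].
by rewrite /= nth_rcons size_inv_coef_seq kn IH.
Qed.

Lemma inv_coefS u n :
  inv_coef u n.+1 = - (u 0%N)^-1 * \sum_(i < n.+1) u i.+1 * inv_coef u (n - i).
Proof.
rewrite {1}/inv_coef /= nth_rcons size_inv_coef_seq ltnn eqxx; congr (_ * _).
by apply: eq_bigr => i _; rewrite nth_inv_coef_seq // leq_subr.
Qed.

Lemma conv_inv_coef u : u 0%N != 0 ->
  conv u (inv_coef u) = fun k => (k == 0%N)%:R.
Proof.
move=> u0; apply/funext => -[|k]; rewrite /conv.
  by rewrite big_ord1 /inv_coef /= divff.
rewrite big_ord_recl /= subn0 inv_coefS mulrA mulrN divff // mulN1r addrC.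
by apply/eqP; rewrite subr_eq0; apply/eqP/eq_bigr.
Qed.

(** Write [L] for the ratio in the bound. Since [B / w * M = L - M], the recursion bounds the next
    coefficient by a multiple of [(L - M) * \sum_i L ^ (n - i) * M ^ i], which telescopes to
    [L ^ n.+1 - M ^ n.+1]. *)
Lemma inv_coef_bound u (M B : R) : 0 < M -> u 0%N != 0 ->
  (forall k, `|u k| <= B * M ^+ k) -> forall n,
  `|inv_coef u n| <= `|u 0%N|^-1 * (M * (1 + B / `|u 0%N|)) ^+ n.
Proof.
move=> M0 u0 uB n; set L := M * _; set w := `|u 0%N|.
have w0 : 0 < w by rewrite normr_gt0.
have B0 : 0 <= B by apply: le_trans (normr_ge0 _) _; have := uB 0%N; rewrite expr0 mulr1; exact.
have L0 : 0 <= L by rewrite /L mulr_ge0 ?(ltW M0) // addr_ge0 // divr_ge0.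
have [m] := ubnP n; elim: m n => // m IH [|n] nm.
  by rewrite /inv_coef /= expr0 mulr1 normfV.
rewrite inv_coefS normrM normrN normfV -/w ler_wpM2l ?invr_ge0 ?(ltW w0) //.
apply: le_trans (ler_norm_sum _ _ _) _.
apply: (@le_trans _ _ (\sum_(i < n.+1) (B / w * M) * (L ^+ (n - i) * M ^+ i))).
  apply: ler_sum => i _; rewrite normrM.
  apply: (@le_trans _ _ ((B * M ^+ i.+1) * (w^-1 * L ^+ (n - i)))).
    apply: ler_pM => //.
    by apply: IH; rewrite (leq_ltn_trans (leq_subr _ _)).
  by rewrite exprS; lra.
rewrite -mulr_sumr.
have -> : B / w * M = L - M by rewrite /L mulrDr mulr1 addrAC subrr add0r mulrC.
have := subrXX L M n.+1; rewrite /= => <-.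
by rewrite gerBl exprn_ge0 // ltW.
Qed.

(** The Cauchy product of the series of [g] with the reciprocal series is the constant 1, and it
    converges to the product of the two sums; so the second sum is the inverse of [g]. *)
Lemma analytic_nearV g a : g a != 0 -> analytic_near g a ->
  analytic_near (fun x => (g x)^-1) a.
Proof.
move=> ga0 [M [B [u [M0 B0 uB gu]]]].
have u0E : u 0%N = g a.
  have g0 : pseries u 0 @ \oo --> g a.
    by have := gu 0; rewrite addr0; apply; rewrite normr0 mul0r.
  by rewrite -(cvg_lim (@Rhausdorff _) (@pseries0 u)) (cvg_lim (@Rhausdorff _) g0).
have u0 : u 0%N != 0 by rewrite u0E.
have vB := inv_coef_bound M0 u0 uB.
set N := M * _ in vB; set C := `|u 0%N|^-1 in vB.
have MN : M <= N by rewrite /N ler_peMr ?(ltW M0) // lerDl divr_ge0.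
have N0 : 0 < N := lt_le_trans M0 MN.
have C0 : 0 <= C by rewrite invr_ge0.
have uBC k : `|u k| <= (B + C) * N ^+ k.
  apply: le_trans (uB k) _; apply: ler_pM; rewrite ?exprn_ge0 ?lerDl ?(ltW M0) //.
  by rewrite lerXn2r // nnegrE ltW.
have vBC k : `|inv_coef u k| <= (B + C) * N ^+ k.
  apply: le_trans (vB k) _; rewrite ler_wpM2r ?exprn_ge0 ?(ltW N0) // lerDr //.
have BC0 : 0 <= B + C by rewrite addr_ge0.
exists (8 * N), (B + C), (inv_coef u); split => //; first by rewrite pmulr_rgt0.
  move=> k; apply: le_trans (vBC k) _; rewrite ler_wpM2l // lerXn2r ?nnegrE ?(ltW N0) //.
    by rewrite pmulr_rge0 // ltW.
  by rewrite ler_peMl ?(ltW N0) // ler1n.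
move=> h hN.
have hN1 : `|h| * N < 1.
  by apply: le_lt_trans hN; rewrite ler_wpM2l // ler_peMl ?(ltW N0) // ler1n.
have hM1 : `|h| * M < 1 by apply: le_lt_trans hN1; rewrite ler_wpM2l.
have cv := is_cvg_pseries_bound N0 vBC hN1.
have := cvg_cauchy_product N0 BC0 uBC vBC hN (gu _ hM1) cv.
rewrite -/(conv _ _) conv_inv_coef //.
have d1 : pseries (fun k : nat => (k == 0%N)%:R) h @ \oo --> (1 : R).
  have := @cvg_pseries_finite (fun k : nat => (k == 0%N)%:R) 1 h.
  by rewrite big_ord1 expr0 mulr1; apply; case.
move=> /(cvg_lim (@Rhausdorff _)); rewrite (cvg_lim (@Rhausdorff _) d1) => E.
have gh0 : g (a + h) != 0.
  by apply/eqP => g0; move/eqP: E; rewrite g0 mul0r oner_eq0.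
have -> : (g (a + h))^-1 = limn (pseries (inv_coef u) h).
  by apply: (mulfI gh0); rewrite divff.
exact: cv.
Qed.

Lemma real_analytic_cst (c : R) : real_analytic (fun=> c).
Proof. by apply/real_analyticP => a; exact: analytic_near_cst. Qed.

Lemma real_analytic_id : real_analytic (@id R).
Proof. by apply/real_analyticP => a; exact: analytic_near_id. Qed.

Lemma real_analyticD f g : real_analytic f -> real_analytic g ->
  real_analytic (fun x => f x + g x).
Proof.
by move=> /real_analyticP fa /real_analyticP ga; apply/real_analyticP => a; exact: analytic_nearD.
Qed.

Lemma real_analyticM f g : real_analytic f -> real_analytic g ->
  real_analytic (fun x => f x * g x).
Proof.
by move=> /real_analyticP fa /real_analyticP ga; apply/real_analyticP => a; exact: analytic_nearM.
Qed.

Lemma real_analyticN f : real_analytic f -> real_analytic (fun x => - f x).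
Proof.
move=> fa; have -> : (fun x => - f x) = (fun x => (-1) * f x).
  by apply/funext => x; rewrite mulN1r.
by apply: real_analyticM => //; exact: real_analytic_cst.
Qed.

Lemma real_analyticB f g : real_analytic f -> real_analytic g ->
  real_analytic (fun x => f x - g x).
Proof. by move=> fa ga; apply: real_analyticD => //; exact: real_analyticN. Qed.

Lemma real_analyticX f n : real_analytic f -> real_analytic (fun x => f x ^+ n).
Proof.
move=> fa; elim: n => [|n IH]; first exact: real_analytic_cst.
have -> : (fun x => f x ^+ n.+1) = (fun x => f x * f x ^+ n).
  by apply/funext => x; rewrite exprS.
exact: real_analyticM.
Qed.

Lemma real_analyticV g : (forall x, g x != 0) -> real_analytic g ->
  real_analytic (fun x => (g x)^-1).
Proof.
by move=> g0 /real_analyticP ga; apply/real_analyticP => a; exact: analytic_nearV.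
Qed.

Lemma real_analytic_expR : real_analytic (@expR R).
Proof. by apply/real_analyticP => a; exact: analytic_near_expR. Qed.

Lemma real_analytic_sin : real_analytic (@sin R).
Proof. by apply/real_analyticP => a; exact: analytic_near_sin. Qed.

Lemma real_analytic_cos : real_analytic (@cos R).
Proof. by apply/real_analyticP => a; exact: analytic_near_cos. Qed.

End Closure.

(** * Isolated zeros and the set of critical values *)

Section Isolated.
Context {R : realType}.
Implicit Types (f c : R -> R) (u : R^nat) (a h x : R).

Let geometric_tail_le (q : R) k n : 0 <= q -> q <= 2^-1 -> (k <= n)%N ->
  \sum_(k <= j < n) q ^+ j <= 2 * q ^+ k.
Proof.
move=> q0 q2 kn.
suff : \sum_(k <= j < n) q ^+ j <= 2 * q ^+ k - 2 * q ^+ n.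
  by move/le_trans; apply; rewrite gerBl mulr_ge0 // exprn_ge0.
rewrite -(subnK kn); elim: (n - k)%N => [|m IH].
  by rewrite add0n big_geq // subrr.
rewrite addSn big_nat_recr ?leq_addl //=.
have := exprn_ge0 (m + k) q0; have := ler_wpM2l (exprn_ge0 (m + k) q0) q2.
by rewrite exprS; lra.
Qed.

(** Close to [a] the first nonzero term of the expansion dominates the sum of all later ones. *)
Lemma analytic_near_isolated f a : analytic_near f a ->
  (\forall x \near a, f x = 0) \/ (\forall x \near a^', f x != 0).
Proof.
move=> [M [B [u [M0 B0 uB fu]]]].
have [u0|] := pselect (forall k, u k = 0).
  left; near=> x; have xM : `|x - a| * M < 1.
    rewrite -ltr_pdivlMr // mul1r distrC; near: x; apply: nbhsx_ballx.
    by rewrite invr_gt0.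
  have := fu _ xM; rewrite subrKC (_ : pseries u _ = fun=> 0); last first.
    by apply/funext => n; rewrite /pseries /series /= big1 // => i _; rewrite u0 mul0r.
  move/(cvg_lim (@Rhausdorff _)) => <-.
  by rewrite (cvg_lim (@Rhausdorff _) (cvg_cst (0 : R))).
move=> /existsNP[k0 /eqP uk0]; right.
have ex : exists k, u k != 0 by exists k0.
case: (ex_minnP ex) => k uk kmin.
have u0 j : (j < k)%N -> u j = 0.
  by move=> jk; apply/eqP/negPn/negP => /kmin; rewrite leqNgt jk.
(* The first bound gives [q <= 1 / 2], so the tail is at most [B * (2 * q ^ k.+1)]; the second makes
   this smaller than the leading term. Using [B + 1] keeps the denominator positive when [B = 0]. *)
pose d := Num.min (2 * M)^-1 (`|u k| / (4 * (B + 1) * M ^+ k.+1)).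
have d0 : 0 < d.
  rewrite lt_min invr_gt0 mulr_gt0 // divr_gt0 ?normr_gt0 //.
  by rewrite mulr_gt0 ?exprn_gt0 // mulr_gt0 // ltr_wpDl.
near=> x.
have xa : x != a by near: x; exact: nbhs_dnbhs_neq.
have : `|x - a| < d.
  by rewrite distrC; near: x; apply/nbhs_dnbhs/nbhsx_ballx.
rewrite lt_min => /andP[xd1 xd2].
set h := x - a in xd1 xd2.
have h0 : 0 < `|h| by rewrite normr_gt0 subr_eq0.
set q := `|h| * M.
have q0 : 0 <= q by rewrite /q mulr_ge0 // ltW.
have q2 : q <= 2^-1.
  rewrite /q -ler_pdivlMr // ltW //; apply: lt_le_trans xd1 _.
  by rewrite invfM.
have hM : `|h| * M < 1 by rewrite -/q; lra.
have cf := fu _ hM; rewrite /h subrKC -/h in cf.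
suff : `|f x - u k * h ^+ k| < `|u k * h ^+ k|.
  by apply: contraTN => /eqP ->; rewrite sub0r normrN ltxx.
apply: (@le_lt_trans _ _ (B * (2 * q ^+ k.+1))).
  have cn : (fun n => `|pseries u h n - u k * h ^+ k|) @ \oo --> `|f x - u k * h ^+ k|.
    by apply: cvg_norm; apply: cvgB cf _; exact: cvg_cst.
  rewrite -(cvg_lim (@Rhausdorff _) cn); apply: limr_le; first by apply: cvgP cn.
  near=> n; rewrite /=.
  have kn : (k < n)%N by near: n; exists k.+1.
  rewrite /pseries /series /= (@big_cat_nat _ _ _ k) //= ?(ltnW kn) //.
  rewrite big_nat_cond big1 ?add0r; last first.
    by move=> i; rewrite andbT => /andP[_ ik]; rewrite u0 // mul0r.
  rewrite big_ltn // addrAC subrr add0r.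
  apply: le_trans (ler_norm_sum _ _ _) _.
  apply: (@le_trans _ _ (\sum_(k.+1 <= j < n) B * q ^+ j)).
    apply: ler_sum_nat => j _; rewrite normrM normrX exprMn (mulrC (_ ^+ j) (M ^+ j)) mulrA.
    by rewrite ler_wpM2r ?exprn_ge0.
  by rewrite -mulr_sumr ler_wpM2l // geometric_tail_le.
rewrite normrM normrX /q exprMn.
move: xd2; rewrite ltr_pdivlMr; last by rewrite mulr_gt0 ?exprn_gt0 // mulr_gt0 // ltr_wpDl.
move=> xd2; rewrite exprS.
have hk : 0 < `|h| ^+ k by rewrite exprn_gt0.
have Mk : 0 < M ^+ k.+1 by rewrite exprn_gt0.
apply: le_lt_trans (_ : `|h| * (4 * (B + 1) * M ^+ k.+1) * `|h| ^+ k < _); last first.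
  by rewrite ltr_pM2r.
have : 0 <= `|h| * M ^+ k.+1 * `|h| ^+ k by rewrite !mulr_ge0 ?ltW.
by nra.
Unshelve. all: by end_near. Qed.

(** The points near which [f] vanishes form an open set; it is also closed, since around any other
    point the zeros are isolated. Connectedness of the line leaves the two cases. *)
Lemma real_analytic_isolated f : real_analytic f ->
  (forall x, f x = 0) \/ (forall a, \forall x \near a^', f x != 0).
Proof.
move=> fa; have fan := (real_analyticP f).1 fa.
pose Z : set R := [set a : R | \forall x \near a, f x = 0].
have oZ : open Z.
  by rewrite openE => a /= /nbhs_interior; apply: filterS => b; exact.
have cZ : closed Z.
  rewrite -openC openE => a Za.
  have [//|fa0] := analytic_near_isolated (fan a).
  rewrite /interior; move: fa0; rewrite /dnbhs withinE => -[V Va VE].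
  apply: filterS Va => b Vb; have [->//|ba] := eqVneq b a.
  move=> /nbhs_singleton fb; have : (V `&` [set y | y != a]) b by [].
  by rewrite -VE /= => -[/eqP].
have [[a Za]|Z0] := pselect (Z !=set0).
  left => x.
  have cR : connected [set: R] by apply/connected_intervalP => ? ?.
  suff ZT : Z = setT.
    have Zx : Z x by rewrite ZT.
    exact: nbhs_singleton Zx.
  apply: cR; first by exists a.
    by exists Z; rewrite ?setTI.
  by exists Z; rewrite ?setTI.
right => a; have [Za|//] := analytic_near_isolated (fan a).
by exfalso; apply: Z0; exists a.
Qed.

Lemma real_analytic_critical c : real_analytic c ->
  (forall x y, c x = c y) \/
  (forall a, \forall x \near a^', derive1 c x != 0).
Proof.
move=> ca; have [c0|] := real_analytic_isolated (real_analytic_derive1 ca).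
  left => x y; apply: is_derive_0_is_cst => z.
  by apply: DeriveDef; [exact: real_analytic_derivable|rewrite -derive1E].
by right.
Qed.

(** For a nonconstant function every critical point is isolated in the critical set, and a set of
    isolated points of the line is countable. *)
Lemma countable_critical_values c : real_analytic c ->
  countable (c @` [set x | derive1 c x = 0]).
Proof.
move=> ca; have [cc|ci] := real_analytic_critical ca.
  apply: (@sub_countable _ _ _ [set c 0]); last exact: countable1.
  by apply: subset_card_le => _ [x _ <-]; rewrite (cc x 0).
apply: card_le_trans (card_image_le _ _) _.
apply: (@sub_countable _ _ _ (isolated [set x | derive1 c x = 0])).
  apply: subset_card_le => x /= x0; split; first exact/mem_set.
  have := ci x; rewrite /dnbhs withinE => -[V Vx VE].
  exists V => //; apply/seteqP; split => [y [Vy /= cy]|y ->].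
    apply: contrapT => /eqP yx.
    have : (V `&` [set y | y != x]) y by [].
    by rewrite -VE => -[/eqP].
  by split => //; exact: nbhs_singleton.
exact: countable_isolated.
Qed.

(** Outside a segment [c] stays below [|t0| / 2] in absolute value. On the segment, compactness
    reduces the claim to a neighbourhood of each point, which contains at most one critical point.
    The value [t0] itself may be critical, hence the strict lower bound on the distance. *)
Lemma critical_values_discrete c (t0 : R) : real_analytic c ->
  (exists x y, c x != c y) -> c @ -oo --> 0 -> c @ +oo --> 0 -> t0 != 0 ->
  exists2 e, 0 < e & forall x, derive1 c x = 0 -> 0 < `|c x - t0| < e -> False.
Proof.
move=> ca [x1 [y1 /eqP cxy]] cNy cy t00.
have ci : forall a, \forall x \near a^', derive1 c x != 0.
  by have [cc|//] := real_analytic_critical ca; exfalso; apply: cxy.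
have t2 : 0 < `|t0| / 2 by rewrite divr_gt0 ?normr_gt0.
have [M [_ cM]] := (cvgr0Pnorm_lt c).1 cNy _ t2.
have [N [_ cN]] := (cvgr0Pnorm_lt c).1 cy _ t2.
have /compact_near_coveringP K := @segment_compact R (M - 1) (N + 1).
have [] := K _ (0 : R)^'+ (fun e x => derive1 c x = 0 -> 0 < `|c x - t0| < e -> False).
  move=> a _.
  have [V /= Va VE] : exists2 V, nbhs a V & forall x, V x -> derive1 c x = 0 -> x = a.
    have := ci a; rewrite /dnbhs withinE => -[V Va VE]; exists V => // x Vx cx.
    apply: contrapT => /eqP xa.
    have : (V `&` [set y | y != a]) x by [].
    by rewrite -VE => -[/eqP].
  have [ca0|ca0] := eqVneq (c a) t0.
    exists (V, setT) => /=; first by split => //; exact: filterT.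
    by move=> [x e] [/= /VE Vx _] /Vx ->; rewrite ca0 subrr normr0 ltxx.
  exists (V, [set e | e < `|c a - t0|]) => /=.
    split => //; apply: nbhs_right_lt; by rewrite normr_gt0 subr_eq0.
  move=> [x e] [/= /VE Vx eca] /Vx -> /andP[_ /lt_trans] => /(_ _ eca).
  by rewrite ltxx.
move=> e0 /= e00 He.
pose e := Num.min (e0 / 2) (`|t0| / 2).
have ee : 0 < e by rewrite lt_min t2 divr_gt0.
exists e => // x cx /andP[ct].
rewrite lt_min => /andP[xe0 xt].
have ct2 : `|t0| / 2 < `|c x|.
  have : `|t0| <= `|c x| + `|c x - t0|.
    by have := ler_normB (c x) (c x - t0); rewrite subKr.
  lra.
have [xM|Mx] := ltP x M; first by have := cM x xM; rewrite ltNge (ltW ct2).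
have [Nx|xN] := ltP N x; first by have := cN x Nx; rewrite ltNge (ltW ct2).
apply: (He (e0 / 2)) cx _; rewrite /= ?ct //.
- by rewrite sub0r normrN gtr0_norm ?divr_gt0 // gtr_pMr // invf_lt1 // ltr1n.
- by rewrite divr_gt0.
- by rewrite in_itv /=; apply/andP; split; lra.
Qed.

(** A nonempty open interval has positive Lebesgue measure, so it is not covered by a countable
    set. *)
Lemma countable_avoid (A : set R) (a b : R) : countable A -> a < b ->
  exists t, [/\ a < t, t < b & ~ A t].
Proof.
move=> cA ab; apply: contrapT => H.
have AB : `]a, b[ `<=` A.
  move=> t /=; rewrite in_itv /= => /andP[a_t tb].
  by apply: contrapT => At; apply: H; exists t.
have : countable `]a, b[.
  by apply: sub_countable cA; exact: subset_card_le.
move/countable_lebesgue_measure0; rewrite lebesgue_measure_itv /= lte_fin ab.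
by move/eqP; rewrite -EFinB eqe subr_eq0 gt_eqF.
Qed.

End Isolated.

Lemma continuous_mx {R : realType} (T : topologicalType) (m n : nat)
    (M : T -> 'M[R]_(m, n)) :
  (forall i j, continuous (fun p => M p i j)) -> continuous M.
Proof.
move=> H p; apply/cvg_ballP => e e0; near=> q.
split=> //; near: q; apply: filter_forall => i; apply: filter_forall => j.
by have /cvg_ballP/(_ e e0) := H i j p.
Unshelve. all: by end_near. Qed.

(** * The zero-set over the strip and its Reeb space *)

Definition in_strip {R : realType} (c1 c2 : R -> R) (t x : R) : bool :=
  c1 x <= t <= c2 x.

Definition joined {R : realType} (c1 c2 : R -> R) (t x x' : R) : Prop :=
  forall y, Num.min x x' <= y <= Num.max x x' -> in_strip c1 c2 t y.

(** These turn out to be the critical points of the projection: they lie on a boundary curve, where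
    the sphere over [(t, x)] shrinks to a point, at a critical point of the function bounding the
    strip there. *)
Definition pole {R : realType} (c1 c2 : R -> R) (t x : R) : Prop :=
  (t = c1 x /\ derive1 c1 x = 0) \/ (t = c2 x /\ derive1 c2 x = 0).

Section ZeroSet.
Context {R : realType} (m : nat) (c1 c2 : R -> R).
Hypothesis (hm : (1 < m)%N) (c12 : zero_set_pair c1 c2).
Local Notation X := (@zero_set R m c1 c2).
Local Notation i1 := (inord 1 : 'I_m.+1).
Local Notation proj := (@zero_set_proj R m c1 c2).
Local Notation q := (reeb_proj proj).
Implicit Types (t x : R) (u : 'rV[R]_m.+1).

Let lt12 x : c1 x < c2 x. Proof. by case: c12. Qed.
Let an1 : real_analytic c1. Proof. by case: c12. Qed.
Let an2 : real_analytic c2. Proof. by case: c12. Qed.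
Let ct1 : continuous c1. Proof. exact: real_analytic_continuous. Qed.
Let ct2 : continuous c2. Proof. exact: real_analytic_continuous. Qed.

Let cc1 : continuous (fun p : R * R => c1 p.2).
Proof. by move=> p; apply: (@continuous_comp _ _ _ snd c1); [exact: cvg_snd|exact: ct1]. Qed.

Let cc2 : continuous (fun p : R * R => c2 p.2).
Proof. by move=> p; apply: (@continuous_comp _ _ _ snd c2); [exact: cvg_snd|exact: ct2]. Qed.

Lemma inord1E : nat_of_ord i1 = 1%N.
Proof. by rewrite inordK // ltnS ltnW. Qed.

Lemma closure_regionE t x : closure (region c1 c2) (t, x) <-> in_strip c1 c2 t x.
Proof.
split.
  pose K : set (R * R) := [set p | 0 <= p.1 - c1 p.2] `&` [set p | 0 <= c2 p.2 - p.1].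
  have cK : closed K.
    apply: closedI; (apply: (@preimage_closed _ _ _ [set y : R | 0 <= y]); last exact: closed_ge).
      by move=> p _; apply: (@cvgB _ _ _ _ _ fst); [exact: cvg_fst|exact: cc1].
    by move=> p _; apply: (@cvgB _ _ _ _ _ _ fst); [exact: cc2|exact: cvg_fst].
  have rK : region c1 c2 `<=` K.
    by move=> p /andP[/ltW p1 /ltW p2]; split => /=; rewrite subr_ge0.
  move=> /(closureS rK); rewrite -(closure_id K).1 // => -[/= + +].
  by rewrite !subr_ge0 /in_strip => -> ->.
move=> /andP[t1 t2] V /= Vtx.
(* Push the point, at fixed [x], towards the midpoint between the boundary curves; every position
   with [0 < e < 1] is in the open region. *)
pose s := fun e : R => ((1 - e) * t + e * ((c1 x + c2 x) / 2), x).
have cs : s @ 0^'+ --> (t, x).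
  have -> : (t, x) = s 0 by rewrite /s subr0 mul1r mul0r addr0.
  suff cs0 : s @ (0 : R) --> s 0 by exact: (cvg_at_right_filter cs0).
  apply: (@cvg_pair _ _ _ _ (nbhs ((1 - 0) * t + 0 * ((c1 x + c2 x) / 2))) (nbhs x)) => /=; last exact: cvg_cst.
  apply: cvgD; apply: cvgM; try exact: cvg_cst; last exact: cvg_id.
  by apply: cvgB; [exact: cvg_cst|exact: cvg_id].
have [e [e0 e1 Ve]] : exists e, [/\ 0 < e, e < 1 & V (s e)].
  have /filter_ex[e [[e0 e1] Ve]] : \forall e \near (0 : R)^'+, (0 < e /\ e < 1) /\ V (s e).
    near=> e; split; last by near: e; exact: cs.
    by split; near: e; [exact: nbhs_right_gt|exact: nbhs_right_lt].
  by exists e.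
exists (s e); split => //; rewrite /region /s /=.
by have c12x := lt12 x; apply/andP; split; nra.
Unshelve. all: by end_near. Qed.

Definition strip_radius t x := Num.sqrt ((t - c1 x) * (c2 x - t)).

Definition sphere_vector u := \sum_(i < m.+1 | (1 < i)%N) u ord0 i ^+ 2 = 1.

Definition strip_row t x u : 'rV[R]_m.+1 := \row_i
  (if i == ord0 then t else if i == i1 then x else strip_radius t x * u ord0 i).

Lemma strip_row0 t x u : strip_row t x u ord0 ord0 = t.
Proof. by rewrite mxE eqxx. Qed.

Lemma inord1_neq0 : (i1 == ord0) = false.
Proof. by apply/eqP => /(congr1 val) /=; rewrite inord1E. Qed.

Lemma strip_row1 t x u : strip_row t x u ord0 i1 = x.
Proof. by rewrite mxE inord1_neq0 eqxx. Qed.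

Lemma strip_row_gt1 t x u (i : 'I_m.+1) : (1 < i)%N ->
  strip_row t x u ord0 i = strip_radius t x * u ord0 i.
Proof.
move=> i_gt1; rewrite mxE; case: eqP => [i0|_]; first by rewrite i0 in i_gt1.
by case: eqP => // ii; move: i_gt1; rewrite ii inord1E.
Qed.

Lemma sqr_radius t x : in_strip c1 c2 t x ->
  strip_radius t x ^+ 2 = (t - c1 x) * (c2 x - t).
Proof. by move=> /andP[t1 t2]; rewrite sqr_sqrtr // mulr_ge0 ?subr_ge0. Qed.

Lemma strip_row_mem t x u : in_strip c1 c2 t x -> sphere_vector u ->
  X (strip_row t x u).
Proof.
move=> Dtx hu; rewrite /zero_set /= strip_row0 strip_row1; split.
  exact/closure_regionE.
rewrite (eq_bigr (fun i => strip_radius t x ^+ 2 * u ord0 i ^+ 2)); last first.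
  by move=> i i_gt1; rewrite strip_row_gt1 // exprMn.
by rewrite -mulr_sumr hu mulr1 sqr_radius // subrr.
Qed.

(** Retracts the plane onto the strip at fixed [x]. It makes [emb] a total continuous map on the
    plane, with the intended value on the strip. *)
Definition clamp t x := Num.max (c1 x) (Num.min t (c2 x)).

Lemma clamp_in t x : in_strip c1 c2 (clamp t x) x.
Proof. by rewrite /in_strip /clamp le_max lexx /= ge_max (ltW (lt12 x)) ge_min lexx orbT. Qed.

Lemma clampK t x : in_strip c1 c2 t x -> clamp t x = t.
Proof. by move=> /andP[t1 t2]; rewrite /clamp (min_idPl t2); exact/max_idPr. Qed.

Definition emb u (hu : sphere_vector u) t x : X :=
  exist _ (strip_row (clamp t x) x u) (mem_set (strip_row_mem (clamp_in t x) hu)).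

Lemma emb_val u (hu : sphere_vector u) t x : set_val (emb hu t x) = strip_row (clamp t x) x u.
Proof. by []. Qed.

Lemma emb0 u (hu : sphere_vector u) t x : in_strip c1 c2 t x ->
  set_val (emb hu t x) ord0 ord0 = t.
Proof. by move=> Dtx; rewrite emb_val strip_row0 clampK. Qed.

Lemma emb1 u (hu : sphere_vector u) t x : set_val (emb hu t x) ord0 i1 = x.
Proof. by rewrite emb_val strip_row1. Qed.

Lemma continuous_emb u (hu : sphere_vector u) :
  continuous (fun p : R * R => emb hu p.1 p.2).
Proof.
have ccl : continuous (fun p : R * R => clamp p.1 p.2).
  move=> p; apply: (@continuous_max _ _ (fun p : R * R => c1 p.2)); first exact: cc1.
  by apply: (@continuous_min _ _ (fun p : R * R => p.1)); [exact: cvg_fst|exact: cc2].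
apply: continuous_comp_initial; apply: continuous_mx => i j p.
rewrite (ord1 i); have [->|j0] := eqVneq j ord0.
  by under eq_fun do rewrite /= emb_val strip_row0; exact: ccl.
have [->|j1] := eqVneq j i1.
  by under eq_fun do rewrite /= emb_val strip_row1; exact: cvg_snd.
have jE (y : R * R) : set_val (emb hu y.1 y.2) ord0 j =
    strip_radius (clamp y.1 y.2) y.2 * u ord0 j.
  by rewrite emb_val mxE (negbTE j0) (negbTE j1).
under eq_fun do rewrite /= jE.
apply: cvgM; last exact: cvg_cst.
apply: continuous_comp; last exact: sqrt_continuous.
by apply: cvgM; apply: cvgB; [exact: ccl|exact: cc1|exact: cc2|exact: ccl].
Qed.

Lemma in_strip_zero_set (p : X) :
  in_strip c1 c2 (set_val p ord0 ord0) (set_val p ord0 i1).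
Proof. by have := set_valP p => -[/closure_regionE]. Qed.

Lemma sum_sqr_zero_set (p : X) :
  \sum_(i < m.+1 | (1 < i)%N) set_val p ord0 i ^+ 2 =
  (set_val p ord0 ord0 - c1 (set_val p ord0 i1)) * (c2 (set_val p ord0 i1) - set_val p ord0 ord0).
Proof. by have := set_valP p => -[_ /eqP]; rewrite subr_eq0 => /eqP ->. Qed.

Definition base_vector : 'rV[R]_m.+1 := delta_mx ord0 (inord 2).

Lemma base_vectorP : sphere_vector base_vector.
Proof.
have i2 : nat_of_ord (inord 2 : 'I_m.+1) = 2%N by rewrite inordK.
rewrite /sphere_vector (bigD1 (inord 2)) /= ?i2 // mxE !eqxx expr1n big1 ?addr0 //.
by move=> i /andP[_ ine]; rewrite mxE (negbTE ine) andbF expr0n.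
Qed.

Lemma radius_eq0 t x : in_strip c1 c2 t x -> strip_radius t x = 0 -> t = c1 x \/ t = c2 x.
Proof.
move=> Dtx r0; have := sqr_radius Dtx; rewrite r0 expr0n /= => /esym/eqP.
by rewrite mulf_eq0 !subr_eq0 => /orP[/eqP|/eqP/esym]; [left|right].
Qed.

Lemma zero_set_coord (p : X) (i : 'I_m.+1) :
  strip_radius (set_val p ord0 ord0) (set_val p ord0 i1) = 0 -> (1 < i)%N ->
  set_val p ord0 i = 0.
Proof.
move=> r0 i_gt1; have := sum_sqr_zero_set p.
rewrite -sqr_radius ?r0 ?expr0n; last exact: in_strip_zero_set.
move/eqP; rewrite /= psumr_eq0; last by move=> j _; exact: sqr_ge0.
by move=> /allP /(_ i (mem_index_enum _)) /implyP /(_ i_gt1); rewrite sqrf_eq0 => /eqP.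
Qed.

Lemma zero_set_strip_row (p : X) u :
  (forall i : 'I_m.+1, (1 < i)%N -> set_val p ord0 i =
     strip_radius (set_val p ord0 ord0) (set_val p ord0 i1) * u ord0 i) ->
  set_val p = strip_row (set_val p ord0 ord0) (set_val p ord0 i1) u.
Proof.
move=> pu; apply/rowP => i; rewrite mxE.
case: eqP => [->//|/eqP i0]; case: eqP => [->//|/eqP i_neq1].
apply: pu; rewrite ltnNge; apply/negP => i_le1.
have : (i == ord0) || (i == i1).
  by rewrite -!val_eqE /= inord1E; move: i_le1; case: (nat_of_ord i) => [|[]].
by rewrite (negbTE i0) (negbTE i_neq1).
Qed.

Lemma emb_surj (p : X) : exists u (hu : sphere_vector u),
  p = emb hu (set_val p ord0 ord0) (set_val p ord0 i1).
Proof.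
set t := set_val p ord0 ord0; set x := set_val p ord0 i1.
have Dtx : in_strip c1 c2 t x by exact: in_strip_zero_set.
have [r0|r0] := eqVneq (strip_radius t x) 0.
  exists base_vector, base_vectorP; apply/val_inj; rewrite /= clampK //.
  by apply: zero_set_strip_row => i i_gt1; rewrite r0 mul0r; exact: zero_set_coord.
pose u := \row_i ((strip_radius t x)^-1 * set_val p ord0 i).
have hu : sphere_vector u.
  rewrite /sphere_vector (eq_bigr (fun i => (strip_radius t x)^-1 ^+ 2 * set_val p ord0 i ^+ 2)).
    by rewrite -mulr_sumr sum_sqr_zero_set -sqr_radius // -exprMn mulVf // expr1n.
  by move=> i _; rewrite mxE exprMn.
exists u, hu; apply/val_inj; rewrite /= clampK //.
by apply: zero_set_strip_row => i i_gt1; rewrite mxE mulrA divff // mul1r.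
Qed.

Lemma emb_radius0 u u' (hu : sphere_vector u) (hu' : sphere_vector u') t x :
  in_strip c1 c2 t x -> strip_radius t x = 0 -> emb hu t x = emb hu' t x.
Proof.
move=> Dtx r0; apply/val_inj; rewrite /= clampK //.
by apply/rowP => i; rewrite !mxE r0 !mul0r.
Qed.

End ZeroSet.


Section ReebGeneral.
Context {R : realType} {T : topologicalType} (c : T -> R).
Local Notation q := (reeb_proj c).

Lemma reeb_projP x y : q x = q y <-> connected_component (c @^-1` [set c x]) x y.
Proof.
split=> [/eqmodP|xy]; first by move=> /= /asboolP.
by apply/eqmodP => /=; apply/asboolP.
Qed.

Lemma reeb_proj_continuous : continuous q.
Proof. exact: pi_continuous. Qed.

Lemma reeb_proj_surj z : exists x, z = q x.
Proof. by exists (repr z); rewrite /reeb_proj reprK. Qed.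

Lemma reeb_proj_connected (C : set T) (t : R) x y : connected C ->
  (forall z, C z -> c z = t) -> C x -> C y -> q x = q y.
Proof.
move=> cC Ct Cx Cy; apply/reeb_projP.
have sC : C `<=` c @^-1` [set c x] by move=> z Cz /=; rewrite !Ct.
exact: (connected_component_max Cx sC cC).
Qed.

Lemma open_reeb (U : set (reeb_space c)) : open (q @^-1` U) -> open U.
Proof. by []. Qed.

End ReebGeneral.

(** To the right of [x], take the least point of the compact set where the function is nonpositive;
    a negative value there would contradict minimality by the intermediate value theorem. The left
    case follows by reflection. *)
Lemma first_nonpositive {R : realType} (f : R -> R) (x x1 : R) : continuous f ->
  0 <= f x -> f x1 < 0 ->
  exists x0, f x0 = 0 /\ forall y, Num.min x x0 <= y <= Num.max x x0 -> 0 <= f y.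
Proof.
have rightcase (g : R -> R) a b : continuous g -> 0 <= g a -> g b < 0 -> a <= b ->
    exists2 c, a <= c & g c = 0 /\ forall y, a <= y <= c -> 0 <= g y.
  move=> cg ga gb ab.
  pose K := `[a, b]%classic `&` g @^-1` [set y | y <= 0].
  have cK : compact K.
    apply: (@subclosed_compact _ _ `[a, b]%classic).
    - apply: closedI; first exact: itv_closed.
      by apply: preimage_closed; [move=> ? _; exact: cg|exact: closed_le].
    - exact: segment_compact.
    - by move=> ? [].
  have K0 : K !=set0.
    by exists b; split => /=; rewrite ?in_itv /= ?ab ?lexx // ltW.
  have [|c] := @compact_EVT_min _ R id K K0 cK; first by apply: continuous_subspaceT => z; exact: cvg_id.
  rewrite inE => -[/=]; rewrite in_itv /= => /andP[ac cb] gc cmin.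
  have g0 y : a <= y -> y < c -> 0 < g y.
    move=> ay yc; rewrite ltNge; apply/negP => gy.
    have : c <= y.
      by apply: cmin; rewrite inE; split => //=; rewrite in_itv /= ay (le_trans (ltW yc)).
    by rewrite leNgt yc.
  exists c => //; suff gc0 : g c = 0.
    split=> // y /andP[ay]; rewrite le_eqVlt => /predU1P[->|yc]; first by rewrite gc0 lexx.
    exact/ltW/g0.
  apply/eqP; rewrite eq_le gc /= leNgt; apply/negP => gc0.
  have gac : Num.min (g a) (g c) <= 0 <= Num.max (g a) (g c).
    by rewrite ge_min (ltW gc0) orbT le_max ga.
  have [y] := @IVT _ g a c 0 ac (continuous_subspaceT cg) gac.
  rewrite in_itv /= => /andP[ay yc] gy0.
  have yc' : y < c by rewrite lt_neqAle yc andbT; apply/eqP => yE; move: gc0; rewrite -yE gy0 ltxx.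
  by have := g0 y ay yc'; rewrite gy0 ltxx.
move=> cf fx fx1; have [xx1|x1x] := leP x x1.
  have [c xc [fc H]] := rightcase f _ _ cf fx fx1 xx1.
  exists c; split => // y; rewrite (min_idPl xc) (max_idPr xc); exact: H.
have [||||c xc [fc H]] := rightcase (fun y => f (- y)) (- x) (- x1).
- by move=> y; apply: (@continuous_comp _ _ _ -%R f); [exact: opp_continuous|exact: cf].
- by rewrite opprK.
- by rewrite opprK.
- by rewrite lerN2 ltW.
have cx : - c <= x by rewrite lerNl.
exists (- c); split=> // y; rewrite (min_idPr cx) (max_idPl cx) => /andP[cy yx].
by have := H (- y); rewrite opprK; apply; rewrite lerN2 yx lerNl.
Qed.

(* The Reeb space of the first projection of the strip, seen through the
   quotient map Q. *)
Record planar_reeb (R : realType) (G : topologicalType) (c1 c2 : R -> R)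
    (c : G -> R) (Q : R * R -> G) (S : set G) : Prop := PlanarReeb {
  pr_c : continuous c;
  pr_c1 : continuous c1;
  pr_c2 : continuous c2;
  pr_d1 : forall x, derivable c1 x 1;
  pr_d2 : forall x, derivable c2 x 1;
  pr_lt : forall x, c1 x < c2 x;
  pr_Q : continuous Q;
  pr_cQ : forall t x, in_strip c1 c2 t x -> c (Q (t, x)) = t;
  pr_surj : forall g, exists t x, in_strip c1 c2 t x /\ g = Q (t, x);
  pr_joined : forall t x x', in_strip c1 c2 t x -> in_strip c1 c2 t x' ->
    (Q (t, x) = Q (t, x') <-> joined c1 c2 t x x');
  pr_open : forall A : set (R * R), open A ->
    (forall t x x', in_strip c1 c2 t x -> joined c1 c2 t x x' -> A (t, x) -> A (t, x')) ->
    open (Q @` (A `&` [set p | in_strip c1 c2 p.1 p.2]));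
  pr_S : forall t x, in_strip c1 c2 t x ->
    (S (Q (t, x)) <-> exists x', joined c1 c2 t x x' /\ pole c1 c2 t x') }.

(** * Reflection of the level coordinate *)

Section Flip.
Context {R : realType} {G : topologicalType}.

Lemma in_stripN (c1 c2 : R -> R) t x :
  in_strip (fun x => - c2 x) (fun x => - c1 x) t x = in_strip c1 c2 (- t) x.
Proof. by rewrite /in_strip lerNl lerNr andbC. Qed.

Lemma joinedN (c1 c2 : R -> R) t x x' :
  joined (fun x => - c2 x) (fun x => - c1 x) t x x' <-> joined c1 c2 (- t) x x'.
Proof. by split=> H y /H; rewrite in_stripN. Qed.

Lemma poleN (c1 c2 : R -> R) t x : derivable c1 x 1 -> derivable c2 x 1 ->
  pole (fun x => - c2 x) (fun x => - c1 x) t x <-> pole c1 c2 (- t) x.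
Proof.
move=> d1 d2; have := derive1N d1; have := derive1N d2.
rewrite /pole /= => -> ->; split=> -[] [tE /eqP dE]; [right|left|right|left].
- by rewrite tE opprK; split=> //; apply/eqP; rewrite -oppr_eq0.
- by rewrite tE opprK; split=> //; apply/eqP; rewrite -oppr_eq0.
- by rewrite -tE opprK; split=> //; apply/eqP; rewrite oppr_eq0.
- by rewrite -tE opprK; split=> //; apply/eqP; rewrite oppr_eq0.
Qed.

(** Negating levels swaps the boundary functions and keeps the Reeb space with its critical set.
    This produces the diagram with two entering edges from the one with two departing edges. *)
Lemma planar_reebN (c1 c2 : R -> R) (c : G -> R) (Q : R * R -> G) (S : set G) :
  planar_reeb c1 c2 c Q S ->
  planar_reeb (fun x => - c2 x) (fun x => - c1 x) (fun g => - c g)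
    (fun p => Q (- p.1, p.2)) S.
Proof.
case=> cc cc1 cc2 d1 d2 lt12 cQ QE surj jE oQ SE.
have cN : continuous (fun p : R * R => (- p.1, p.2)).
  move=> p; apply: (@cvg_pair _ _ _ _ (nbhs (- p.1)) (nbhs p.2)) => /=; last exact: cvg_snd.
  by apply: cvgN; exact: cvg_fst.
split.
- by move=> g; apply: cvgN; exact: cc.
- by move=> x; apply: cvgN; exact: cc2.
- by move=> x; apply: cvgN; exact: cc1.
- by move=> x; exact: derivableN.
- by move=> x; exact: derivableN.
- by move=> x; rewrite ltrN2.
- by move=> p; apply: (@continuous_comp _ _ _ _ Q); [exact: cN|exact: cQ].
- by move=> t x; rewrite in_stripN => /QE ->; rewrite opprK.
- move=> g; have [t [x [Dtx ->]]] := surj g; exists (- t), x.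
  by rewrite in_stripN opprK.
- by move=> t x x'; rewrite !in_stripN => h h'; rewrite /= jE // joinedN.
- move=> A oA sA.
  have -> : (fun p => Q (- p.1, p.2)) @`
      (A `&` [set p | in_strip (fun x => - c2 x) (fun x => - c1 x) p.1 p.2]) =
      Q @` (((fun p => (- p.1, p.2)) @^-1` A) `&` [set p | in_strip c1 c2 p.1 p.2]).
    apply/seteqP; split=> g [[t x] [/= At]].
      by rewrite in_stripN => D <-; exists (- t, x) => //; rewrite /= opprK.
    by move=> D <-; exists (- t, x); rewrite /= ?in_stripN opprK.
  apply: oQ; first by apply: open_comp => // p _; exact: cN.
  by move=> t x x' D J; apply: sA; rewrite ?in_stripN ?joinedN opprK.
- move=> t x; rewrite in_stripN => D; rewrite /= SE //; split=> -[x' [J P]]; exists x'.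
    by rewrite joinedN poleN.
  by move: J P; rewrite joinedN poleN.
Qed.

End Flip.

(** * Critical points of the projection of the zero-set *)

Section Critical.
Context {R : realType} (m : nat) (c1 c2 : R -> R).
Hypothesis (hm : (1 < m)%N) (c12 : zero_set_pair c1 c2).
Local Notation X := (@zero_set R m c1 c2).
Local Notation i1 := (inord 1 : 'I_m.+1).

Let lt12 x : c1 x < c2 x. Proof. by case: c12. Qed.
Let an1 : real_analytic c1. Proof. by case: c12. Qed.
Let an2 : real_analytic c2. Proof. by case: c12. Qed.

Lemma derive1n_row (g : R -> 'rV[R]_m.+1) :
  (forall i k t, derivable (derive1n k (fun s => g s ord0 i)) t 1) ->
  forall k, derive1n k g = fun t => \row_i derive1n k (fun s => g s ord0 i) t.
Proof.
move=> dg; elim=> [|k IH]; first by apply/funext => t; apply/rowP => i; rewrite mxE.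
rewrite derive1nS IH; apply/funext => t; rewrite derive1E derive_mx.
  by apply/rowP => i; rewrite !mxE derive1nS derive1E; under eq_fun do rewrite mxE.
by apply/derivable_mxP => i j; under eq_fun do rewrite mxE; exact: dg.
Qed.

Lemma smooth_curve_row (g : R -> 'rV[R]_m.+1) :
  (forall i, real_analytic (fun s => g s ord0 i)) -> smooth_curve g.
Proof.
move=> ga k t; rewrite derive1n_row; last by move=> i k' t'; exact: real_analytic_smooth.
apply/derivable_mxP => i j; under eq_fun do rewrite mxE.
exact: real_analytic_smooth.
Qed.

Lemma derive_first_coord (p v : 'rV[R]_m.+1) : 'D_v (@first_coord R m) p = v ord0 ord0.
Proof.
rewrite /derive; apply: cvg_lim; first exact: Rhausdorff.
apply: cvg_near_cst; near=> h.
have h0 : h != 0 by near: h; exact: nbhs_dnbhs_neq.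
by rewrite /= /first_coord !mxE addrK /GRing.scale /= mulrA mulVf // mul1r.
Unshelve. all: by end_near. Qed.

Lemma real_analytic_shift (f : R -> R) (a : R) : real_analytic f ->
  real_analytic (fun s => f (a + s)).
Proof.
move=> fa b; have [r [u [r0 fu]]] := fa (a + b); exists r, u; split => // x xb.
have -> : x - b = a + x - (a + b) by ring.
by apply: fu; rewrite (_ : a + x - (a + b) = x - b) //; ring.
Qed.

Lemma tangent_coord (g : R -> 'rV[R]_m.+1) (i : 'I_m.+1) : smooth_curve g ->
  is_derive (0 : R) (1 : R) (fun t => g t ord0 i) (derive1 g 0 ord0 i) /\
  (forall t, derivable (fun t => g t ord0 i) t 1).
Proof.
move=> sg; have dg t : derivable g t 1 by exact: (sg 0%N t).
have dgi t : derivable (fun t => g t ord0 i) t 1 by exact: (derivable_mxP g t 1).1.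
split=> //; apply: DeriveDef; first exact: dgi.
by rewrite derive1E derive_mx // mxE.
Qed.

(** Along the curve, [e * (g0 - f g1)] is nonnegative and vanishes at time 0, so its derivative
    there is 0. Since [f] is critical at that point, this derivative is [e] times the velocity of
    the first coordinate. The sign is [e = 1] for the lower function and [e = -1] for the upper
    one. *)
Let tangent_pole (f : R -> R) (g : R -> 'rV[R]_m.+1) (e : R) : e != 0 ->
  (forall x, derivable f x 1) -> smooth_curve g ->
  (forall t, 0 <= e * (g t ord0 ord0 - f (g t ord0 i1))) ->
  g 0 ord0 ord0 = f (g 0 ord0 i1) -> derive1 f (g 0 ord0 i1) = 0 ->
  derive1 g 0 ord0 ord0 = 0.
Proof.
move=> e0 df sg fg g0 df0.
have [D0 d0] := tangent_coord ord0 sg; have [D1 d1] := tangent_coord i1 sg.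
pose h t := g t ord0 ord0 - f (g t ord0 i1).
have Df : is_derive (g 0 ord0 i1) 1 f 0.
  by apply: DeriveDef => //; rewrite -derive1E.
have Dh : is_derive (0 : R) 1 h (derive1 g 0 ord0 ord0).
  have := @is_derive1_comp _ f (fun t => g t ord0 i1) 0 _ _ Df D1.
  rewrite mul0r => Dc; rewrite -[X in is_derive _ _ _ X]subr0.
  exact: is_deriveB.
have dh t : derivable h t 1.
  apply: derivableB; first exact: d0.
  apply/derivable1_diffP; apply: (@differentiable_comp _ _ _ _ (fun t => g t ord0 i1) f).
    exact/derivable1_diffP.
  exact/derivable1_diffP.
have Deh : is_derive (0 : R) 1 (e *: (h : R -> R)) (e *: (derive1 g 0 ord0 ord0)).
  exact: is_deriveZ.
apply: (mulfI e0); rewrite mulr0; have [_ /esym E] := Deh.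
rewrite [LHS]E.
suff [_ ->] : is_derive (0 : R) 1 (e *: (h : R -> R)) 0 by [].
apply: (@derive1_at_min _ (e *: (h : R -> R)) (-1) 1) => //.
- by move=> t _; apply: derivableZ.
- by rewrite in_itv /= ltrN10 ltr01.
- move=> t _; change (e * h 0 <= e * h t).
  by rewrite {1}/h g0 subrr mulr0; exact: fg.
Qed.

(** Off the boundary curves, rotating the sphere over a fixed [x] moves the first coordinate with
    nonzero speed. On a boundary curve, following the curve itself gives the derivative of its
    function as speed. Conversely the strip lies on one side of its boundary curve, which forces
    zero speed at a pole. *)
Lemma critical_pointsE (p : X) :
  critical_points (M := X) (@first_coord R m) p <->
  pole c1 c2 (set_val p ord0 ord0) (set_val p ord0 i1).
Proof.
have d1 x : derivable c1 x 1 by exact: real_analytic_derivable.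
have d2 x : derivable c2 x 1 by exact: real_analytic_derivable.
have [u [hu pE]] := emb_surj hm c12 p.
set t := set_val p ord0 ord0 in pE *; set x := set_val p ord0 i1 in pE *.
have Dtx : in_strip c1 c2 t x := in_strip_zero_set c12 p.
have pv : set_val p = strip_row c1 c2 t x u by rewrite {1}pE emb_val clampK.
split=> [crit|].
  have curve (g : R -> 'rV[R]_m.+1) (d : R) : (forall i, real_analytic (fun s => g s ord0 i)) ->
      (forall s, X (g s)) -> g 0 = set_val p -> is_derive (0 : R) (1 : R) (fun s => g s ord0 ord0) d -> d = 0.
    move=> ga gX g0 [_ gd].
    have sg : smooth_curve g by exact: smooth_curve_row.
    have := crit (derive1 g 0) (ex_intro _ g (And4 sg gX g0 erefl)).
    rewrite derive_first_coord; have [[_ <-] _] := tangent_coord ord0 sg.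
    by rewrite gd.
  have [r0|r0] := eqVneq (strip_radius c1 c2 t x) 0; last first.
    exfalso; move: (r0) => /eqP; apply.
    (* The circle over [x] in the plane of the first axis and the direction [u]: [a] and [b] are the
       coordinates of the point relative to the centre, and the first coordinate starts with
       velocity [- b]. *)
    pose a := t - (c1 x + c2 x) / 2; pose b := strip_radius c1 c2 t x.
    pose g s : 'rV[R]_m.+1 := \row_i (if i == ord0 then (c1 x + c2 x) / 2 + a * cos s - b * sin s
      else if i == i1 then x else (b * cos s + a * sin s) * u ord0 i).
    apply/eqP; rewrite -oppr_eq0; apply/eqP; apply: (curve g).
    - move=> i; under eq_fun do rewrite mxE.
      case: eqP => _; first apply: real_analyticB.
      + apply: real_analyticD; first exact: real_analytic_cst.
        apply: real_analyticM; [exact: real_analytic_cst|exact: real_analytic_cos].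
      + apply: real_analyticM; [exact: real_analytic_cst|exact: real_analytic_sin].
      case: eqP => _; first exact: real_analytic_cst.
      apply: real_analyticM; last exact: real_analytic_cst.
      apply: real_analyticD; apply: real_analyticM; try exact: real_analytic_cst.
        exact: real_analytic_cos.
      exact: real_analytic_sin.
    - move=> s; have cs : cos s ^+ 2 + sin s ^+ 2 = 1 by exact: cos2Dsin2.
      have b2 : b ^+ 2 = (t - c1 x) * (c2 x - t) by exact: sqr_radius.
      have i10 : (i1 == ord0) = false by exact: inord1_neq0.
      have E : (a * cos s - b * sin s) ^+ 2 + (b * cos s + a * sin s) ^+ 2 = ((c2 x - c1 x) / 2) ^+ 2.
        have -> : (a * cos s - b * sin s) ^+ 2 + (b * cos s + a * sin s) ^+ 2 =
          (a ^+ 2 + b ^+ 2) * (cos s ^+ 2 + sin s ^+ 2) by ring.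
        by rewrite cs mulr1 b2 /a; field.
      set A := a * cos s - b * sin s in E; set B := b * cos s + a * sin s in E.
      have AB : A ^+ 2 <= ((c2 x - c1 x) / 2) ^+ 2 by rewrite -E lerDl sqr_ge0.
      have c0 : 0 <= (c2 x - c1 x) / 2 by rewrite divr_ge0 // subr_ge0 ltW.
      have /ler_normlP[A1 A2] : `|A| <= (c2 x - c1 x) / 2.
        by rewrite -(ler_pXn2r (ltn0Sn 1)) ?nnegrE // real_normK ?num_real.
      rewrite /zero_set /= !mxE eqxx i10 eqxx -addrA -/A; split.
        by apply/(closure_regionE c12); rewrite /in_strip; apply/andP; split; lra.
      rewrite (eq_bigr (fun i => B ^+ 2 * u ord0 i ^+ 2)); last first.
        move=> i i_gt1; rewrite mxE; case: eqP => [i0|_]; first by rewrite i0 in i_gt1.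
        case: eqP => [ii|_]; first by move: i_gt1; rewrite ii inord1E.
        by rewrite exprMn.
      rewrite -mulr_sumr hu mulr1.
      have -> : B ^+ 2 = ((c2 x - c1 x) / 2) ^+ 2 - A ^+ 2 by rewrite -E; ring.
      by field.
    - rewrite pv; apply/rowP => i; rewrite !mxE cos0 sin0 !mulr1 !mulr0 subr0 addr0.
      by case: eqP => _ //; rewrite /a subrKC.
    - under eq_fun do rewrite mxE eqxx.
      apply: is_derive_eq; rewrite /GRing.scale /= sin0 cos0.
      by rewrite oppr0 !mulr0 mulr1 sub0r.
  (* On a boundary curve the radius vanishes identically, so the graph of [f] itself is an analytic
     curve in the zero-set. *)
  have polecurve (f : R -> R) : real_analytic f -> t = f x -> (forall s, in_strip c1 c2 (f s) s) ->
      (forall s, strip_radius c1 c2 (f s) s = 0) -> derive1 f x = 0.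
    move=> fa tf fD fr.
    pose g s : 'rV[R]_m.+1 := strip_row c1 c2 (f (x + s)) (x + s) u.
    apply: (curve g).
    - move=> i; rewrite /g; under eq_fun do rewrite mxE fr mul0r.
      case: eqP => _; first exact: real_analytic_shift.
      case: eqP => _; last exact: real_analytic_cst.
      by apply: real_analyticD; [exact: real_analytic_cst|exact: real_analytic_id].
    - by move=> s; exact: strip_row_mem.
    - by rewrite pv /g addr0 tf.
    - rewrite /g; under eq_fun do rewrite strip_row0.
      have D1 : is_derive (0 : R) (1 : R) (fun s : R => x + s) (1 : R).
        by apply: is_derive_eq; rewrite add0r mulr1.
      have D2 : is_derive (x + 0) 1 f (derive1 f x).
        by rewrite addr0; apply: DeriveDef; [exact: real_analytic_derivable|rewrite -derive1E].
      by have := @is_derive1_comp _ f (fun s => x + s) 0 _ _ D2 D1; rewrite mulr1.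
  case: (radius_eq0 Dtx r0) => tE; [left|right]; split => //; apply: polecurve => //.
  - by move=> s; rewrite /in_strip lexx ltW.
  - by move=> s; rewrite /strip_radius subrr mul0r sqrtr0.
  - by move=> s; rewrite /in_strip lexx ltW.
  - by move=> s; rewrite /strip_radius subrr mulr0 sqrtr0.
move=> P v [g [sg gX g0 <-]]; rewrite derive_first_coord.
have gD s : in_strip c1 c2 (g s ord0 ord0) (g s ord0 i1).
  by have [/(closure_regionE c12)] := gX s.
case: P => [[tE dE]|[tE dE]].
  apply: (tangent_pole (oner_neq0 R) d1 sg); rewrite ?g0 // => s.
  by have /andP[+ _] := gD s; rewrite mul1r subr_ge0.
have N1 : (-1 : R) != 0 by rewrite oppr_eq0 oner_eq0.
apply: (tangent_pole N1 d2 sg); rewrite ?g0 // => s.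
by have /andP[_ +] := gD s; rewrite mulN1r opprB subr_ge0.
Qed.

End Critical.

(** * Identification of the Reeb space with the planar one *)

Section ZeroSetReeb.
Context {R : realType} (m : nat) (c1 c2 : R -> R).
Hypothesis (hm : (1 < m)%N) (c12 : zero_set_pair c1 c2).
Local Notation X := (@zero_set R m c1 c2).
Local Notation i1 := (inord 1 : 'I_m.+1).
Local Notation proj := (@zero_set_proj R m c1 c2).
Local Notation q := (reeb_proj proj).
Local Notation emb := (emb hm c12).
Implicit Types (t x : R) (u : 'rV[R]_m.+1).

Lemma connected_itv_image (T : topologicalType) (f : R -> T) (i : interval R) :
  continuous f -> connected (f @` [set` i]).
Proof.
move=> cf; apply: connected_continuous_connected.
  by apply/connected_intervalP; exact: interval_is_interval.
exact: continuous_subspaceT.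
Qed.

Lemma continuous_emb_snd u (hu : sphere_vector u) t : continuous (fun x => emb hu t x).
Proof.
move=> x; apply: (@continuous_comp _ _ _ (fun x => (t, x)) (fun p : R * R => emb hu p.1 p.2)).
  by apply: (@cvg_pair _ _ _ _ (nbhs t) (nbhs x)) => /=; [exact: cvg_cst|exact: cvg_id].
exact: continuous_emb.
Qed.

Lemma proj_emb u (hu : sphere_vector u) t x : in_strip c1 c2 t x -> proj (emb hu t x) = t.
Proof. by move=> D; rewrite /zero_set_proj /first_coord emb0. Qed.

Lemma emb_joined u (hu : sphere_vector u) t x x' : joined c1 c2 t x x' ->
  q (emb hu t x) = q (emb hu t x').
Proof.
move=> J; pose C := emb hu t @` `[Num.min x x', Num.max x x'].
apply: (@reeb_proj_connected _ _ proj C t).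
- by apply: connected_itv_image; exact: continuous_emb_snd.
- by move=> z [y /=]; rewrite in_itv /= => /J D <-; exact: proj_emb.
- by exists x => //=; rewrite in_itv /= ge_min lexx le_max lexx.
- by exists x' => //=; rewrite in_itv /= ge_min lexx le_max lexx !orbT.
Qed.

(** The second coordinate maps a connected component of a level onto an interval, and every value it
    takes lies in the slice of the strip at that level. *)
Lemma reeb_proj_joined (p p' : X) : q p = q p' ->
  proj p' = proj p /\ joined c1 c2 (proj p) (set_val p ord0 i1) (set_val p' ord0 i1).
Proof.
move=> /reeb_projP H.
have pE z : connected_component (proj @^-1` [set proj p]) p z -> proj z = proj p.
  by move=> H'; exact: (connected_component_sub H').
split; first exact: pE.
have cx : continuous (fun z : X => set_val z ord0 i1 : R).
  move=> z; apply: (@continuous_comp _ _ _ set_val (fun M : 'rV[R]_m.+1 => M ord0 i1)).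
    exact: initial_continuous.
  exact: coord_continuous.
have cC : connected ((fun z : X => set_val z ord0 i1 : R) @`
    connected_component (proj @^-1` [set proj p]) p).
  apply: connected_continuous_connected; first exact: component_connected.
  exact: continuous_subspaceT.
have /connected_intervalP iC := cC.
have inC y : Num.min (set_val p ord0 i1) (set_val p' ord0 i1) <= y <=
    Num.max (set_val p ord0 i1) (set_val p' ord0 i1) ->
    ((fun z : X => set_val z ord0 i1 : R) @`
    connected_component (proj @^-1` [set proj p]) p) y.
  move=> yb.
  have Cp : connected_component (proj @^-1` [set proj p]) p p by exact: connected_component_refl.
  have := @iC (Num.min (set_val p ord0 i1) (set_val p' ord0 i1))
   (Num.max (set_val p ord0 i1) (set_val p' ord0 i1)); apply => //.
    by case: leP => _; [exists p|exists p'].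
  by case: leP => _; [exists p'|exists p].
move=> y /inC [z /pE zE <-]; rewrite -zE.
exact: (in_strip_zero_set c12).
Qed.

Lemma ZS_pole z : @ZS R m c1 c2 z <->
  exists p, q p = z /\ pole c1 c2 (set_val p ord0 ord0) (set_val p ord0 i1).
Proof.
split=> [[p cp <-]|[p [<- P]]].
  by exists p; split=> //; exact/(critical_pointsE hm c12).
by exists p => //; exact/(critical_pointsE hm c12).
Qed.

Hypothesis not_strip : forall t, exists x, ~~ in_strip c1 c2 t x.

Let lt12 x : c1 x < c2 x. Proof. by case: c12. Qed.
Let an1 : real_analytic c1. Proof. by case: c12. Qed.
Let an2 : real_analytic c2. Proof. by case: c12. Qed.
Let ct1 : continuous c1. Proof. exact: real_analytic_continuous. Qed.
Let ct2 : continuous c2. Proof. exact: real_analytic_continuous. Qed.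

(** Since the slice is not the whole line, sliding along it from [x] reaches a boundary curve, where
    the direction in the sphere is lost. *)
Let touch t x : in_strip c1 c2 t x ->
  exists x0, joined c1 c2 t x x0 /\ strip_radius c1 c2 t x0 = 0.
Proof.
move=> D; have [x1 nD] := not_strip t.
pose f y := Num.min (t - c1 y) (c2 y - t).
have fE y : (0 <= f y) = in_strip c1 c2 t y by rewrite /f le_min !subr_ge0.
have cf : continuous f.
  move=> y; apply: (@continuous_min _ _ (fun y => t - c1 y)).
    by apply: cvgB; [exact: cvg_cst|exact: ct1].
  by apply: cvgB; [exact: ct2|exact: cvg_cst].
have [||x0 [f0 H]] := first_nonpositive (x := x) (x1 := x1) cf; rewrite ?ltNge ?fE //.
exists x0; split => [y /H|]; first by rewrite fE.
have : f x0 == 0 by rewrite f0.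
rewrite /f /strip_radius; case: leP => _ /eqP ->; by rewrite ?mul0r ?mulr0 sqrtr0.
Qed.

Definition zero_set_chart (p : R * R) : ZG m c1 c2 :=
  q (emb (@base_vectorP R m hm) p.1 p.2).

(** Slide to a boundary curve in the direction of [p], change there to the base direction at no
    cost, and slide back. This is where connectedness of the sphere is replaced, so that [m = 2] is
    covered as well. *)
Let chartE (p : X) : q p = zero_set_chart (set_val p ord0 ord0, set_val p ord0 i1).
Proof.
have [u [hu {1}->]] := emb_surj hm c12 p; rewrite /zero_set_chart /=.
have D := in_strip_zero_set c12 p.
have [x0 [J r0]] := touch D.
rewrite (emb_joined hu J) (emb_joined (@base_vectorP R m hm) J).
congr q; apply: emb_radius0 => //; apply: J.
by rewrite ge_min lexx le_max lexx !orbT.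
Qed.

Lemma zero_set_planar_reeb :
  planar_reeb c1 c2 (@Zc R m c1 c2) zero_set_chart (@ZS R m c1 c2).
Proof.
have cproj : continuous proj.
  move=> z; apply: (@continuous_comp _ _ _ set_val (fun M : 'rV[R]_m.+1 => M ord0 ord0)).
    exact: initial_continuous.
  exact: coord_continuous.
have jE t x x' : in_strip c1 c2 t x -> in_strip c1 c2 t x' ->
    (zero_set_chart (t, x) = zero_set_chart (t, x') <-> joined c1 c2 t x x').
  move=> D D'; split=> [|J]; last exact: emb_joined.
  by move=> /reeb_proj_joined[_]; rewrite proj_emb //= !emb1.
have QE t x : in_strip c1 c2 t x -> Zc (zero_set_chart (t, x)) = t.
  by move=> D; rewrite /Zc /zero_set_chart reeb_barE proj_emb.
split => //.
- exact: reeb_bar_continuous.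
- by move=> x; exact: real_analytic_derivable.
- by move=> x; exact: real_analytic_derivable.
- move=> p; apply: (@continuous_comp _ _ _ (fun p : R * R => emb (@base_vectorP R m hm) p.1 p.2) q).
    exact: continuous_emb.
  exact: reeb_proj_continuous.
- move=> g; have [p ->] := reeb_proj_surj g.
  exists (set_val p ord0 ord0), (set_val p ord0 i1).
  by split; [exact: in_strip_zero_set|rewrite chartE].
- move=> A oA sA; apply: open_reeb.
  have -> : q @^-1` (zero_set_chart @` (A `&` [set p | in_strip c1 c2 p.1 p.2])) =
     (fun p : X => (set_val p ord0 ord0, set_val p ord0 i1)) @^-1` A.
    apply/seteqP; split=> [p [[t x] [/= At D]]|p /= Ap].
      rewrite chartE => E.
      have := congr1 (@Zc R m c1 c2) E; rewrite !QE //; last exact: in_strip_zero_set.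
      move=> tE; move: E; rewrite -tE => /jE J; apply: sA (At) => //.
      by apply: J => //; rewrite tE; exact: in_strip_zero_set.
    exists (set_val p ord0 ord0, set_val p ord0 i1); last by rewrite chartE.
    by split=> //=; exact: in_strip_zero_set.
  apply: open_comp => // p _.
  apply: (@cvg_pair _ _ _ _ (nbhs (set_val p ord0 ord0)) (nbhs (set_val p ord0 i1))) => /=.
  - exact: (@nbhs_filter X p).
  - exact: (cproj p).
  apply: (@continuous_comp _ _ _ set_val (fun M : 'rV[R]_m.+1 => M ord0 i1)).
    exact: initial_continuous.
  exact: coord_continuous.
- move=> t x D; rewrite ZS_pole; split=> [[p [pE P]]|[x' [J P]]].
    have := reeb_proj_joined (esym pE); rewrite proj_emb //= emb1 => -[tE J].
    exists (set_val p ord0 i1); split=> //.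
    by rewrite -tE.
  have D' : in_strip c1 c2 t x' by apply: J; rewrite ge_min lexx le_max lexx !orbT.
  exists (emb (@base_vectorP R m hm) t x'); split; last by rewrite emb0 // emb1.
  by rewrite -(emb_joined _ J).
Qed.

End ZeroSetReeb.

(** * Pre-digraphs cut out by sections of the level function *)

Section SetTypes.
Implicit Types T U : topologicalType.

Lemma continuous_into_set_type T U (A : set U) (f : T -> A) :
  continuous (fun x => set_val (f x)) -> continuous f.
Proof. exact: continuous_comp_initial. Qed.

Lemma set_val_continuous T (A : set T) : continuous (set_val : A -> T).
Proof. exact: initial_continuous. Qed.

Lemma homeomorphic_within T U (A : set T) (B : set U) (f : T -> U) (g : U -> T) :
  {homo f : x / A x >-> B x} -> {homo g : y / B y >-> A y} ->
  (forall x, A x -> g (f x) = x) -> (forall y, B y -> f (g y) = y) ->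
  {within A, continuous f} -> {within B, continuous g} -> homeomorphic A B.
Proof.
move=> fAB gBA fK gK cf cg.
pose F (a : A) : B := exist _ (f (set_val a)) (mem_set (fAB _ (set_valP a))).
pose G (b : B) : A := exist _ (g (set_val b)) (mem_set (gBA _ (set_valP b))).
exists F, G; split.
- by apply: continuous_into_set_type; exact: (subspace_sigL_continuousP A f).1.
- by apply: continuous_into_set_type; exact: (subspace_sigL_continuousP B g).1.
- by move=> a; apply/val_inj; rewrite /= fK //; exact: set_valP.
- by move=> b; apply/val_inj; rewrite /= gK //; exact: set_valP.
Qed.

Lemma hausdorff_set_type T (A : set T) : hausdorff_space T -> hausdorff_space A.
Proof.
move=> hT x y xy; apply/val_inj; apply: hT => V W Vx Wy.
have [|| z [Vz Wz]] := xy (set_val @^-1` V) (set_val @^-1` W).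
- exact: (@set_val_continuous _ A x).
- exact: (@set_val_continuous _ A y).
by exists (set_val z).
Qed.

Lemma connected_sub_component T (A e : set T) x : connected e -> e x -> e `<=` A ->
  forall y, e y -> connected_component A x y.
Proof. by move=> ce ex eA; exact: (connected_component_max ex eA ce). Qed.

End SetTypes.

Section OpenInterval.
Context {R : realType}.

Lemma bounded_open_interval (E : set R) (B : R) : is_interval E -> open E -> E !=set0 ->
  (forall x, E x -> `|x| <= B) ->
  exists a b, a < b /\ E = `]a, b[%classic.
Proof.
move=> iE oE E0 bE.
have hs : has_sup E.
  by split=> //; exists B => x /bE; apply: le_trans; exact: ler_norm.
have hi : has_inf E.
  split=> //; exists (- B) => x /bE; rewrite ler_norml => /andP[]//.
have open_lt x : E x -> exists2 y, E y & y < x.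
  move=> Ex; move: oE; rewrite openE => /(_ _ Ex) /nbhs_ballP[e /= e0 xe].
  exists (x - e / 2); last by rewrite ltrBlDr ltrDl divr_gt0.
  by apply: xe; rewrite /ball /= subKr gtr0_norm ?divr_gt0 // gtr_pMr // invf_lt1 // ltr1n.
have open_gt x : E x -> exists2 y, E y & x < y.
  move=> Ex; move: oE; rewrite openE => /(_ _ Ex) /nbhs_ballP[e /= e0 xe].
  exists (x + e / 2); last by rewrite ltrDl divr_gt0.
  apply: xe; rewrite /ball /= opprD addrA subrr add0r normrN.
  by rewrite gtr0_norm ?divr_gt0 // gtr_pMr // invf_lt1 // ltr1n.
have Elt x : E x -> inf E < x < sup E.
  move=> Ex; have [y Ey yx] := open_lt _ Ex; have [z Ez xz] := open_gt _ Ex.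
  apply/andP; split.
    by apply: le_lt_trans yx; apply: ge_inf => //; case: hi.
  by apply: (lt_le_trans xz); apply: ub_le_sup => //; case: hs.
exists (inf E), (sup E); split.
  by have [x /Elt /andP[]] := E0; exact: lt_trans.
apply/seteqP; split=> x; rewrite /= in_itv /=; first exact: Elt.
move=> /andP[ix xs].
have [y Ey yx] := @inf_lt _ E x E0 ix.
have [z Ez xz] := @sup_gt _ E x E0 xs.
by apply: (iE y z) => //; rewrite !ltW.
Qed.

End OpenInterval.

Section PreDigraphOfSections.
Context {R : realType} {G : topologicalType} (S : set G) (c : G -> R) (B : R).
Hypotheses (hG : hausdorff_space G) (cc : continuous c).
Hypothesis cB : forall g, `|c g| <= B.
Hypothesis sections : forall g, ~ S g -> exists (d : R) (s : R -> G),
  [/\ 0 < d, s (c g) = g, continuous s,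
      forall t, `|c g - t| < d -> c (s t) = t /\ ~ S (s t) &
      open (s @` ball (c g) d)].
Hypothesis inj : forall e, edges S e -> {in e &, injective c}.

Let edge_sub e : edges S e -> e `<=` ~` S.
Proof. by move=> [g _ ->]; exact: connected_component_sub. Qed.

Let edge_eq e g : edges S e -> e g -> e = connected_component (~` S) g.
Proof. by move=> [h _ ->] hg; exact: same_connected_component. Qed.

Let edge_mem g : ~ S g -> connected_component (~` S) g g.
Proof. exact: connected_component_refl. Qed.

Let edge_of g : ~ S g -> edges S (connected_component (~` S) g).
Proof. by exists g. Qed.

Let section_edge e g : edges S e -> e g -> exists (d : R) (s : R -> G),
  [/\ 0 < d, s (c g) = g, continuous s,
      forall t, `|c g - t| < d -> c (s t) = t /\ e (s t) &
      open (s @` ball (c g) d)].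
Proof.
move=> ee eg; have [d [s [d0 sg cs H o]]] := sections (edge_sub ee eg).
exists d, s; split => // t td; split; first by have [] := H t td.
rewrite (edge_eq ee eg).
apply: (@connected_sub_component _ _ (s @` ball (c g) d)).
- apply: connected_continuous_connected; last exact: continuous_subspaceT.
  rewrite ball_itv; apply/connected_intervalP; exact: interval_is_interval.
- by exists (c g) => //; exact: ballxx.
- by move=> _ [u /H[_ Su] <-].
- by exists t.
Qed.

Let edge_open e : edges S e -> open e.
Proof.
move=> ee; rewrite openE => g eg.
have [d [s [d0 sg cs H o]]] := section_edge ee eg.
apply: (@filterS _ _ _ (s @` ball (c g) d)).
  by move=> _ [t /H[_ est] <-].
by apply: open_nbhs_nbhs; split=> //; exists (c g) => //; exact: ballxx.
Qed.

(** Local sections make the image of the edge under [c] open, so it is a bounded open interval.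
    Injectivity gives an inverse, which agrees locally with a section and is therefore
    continuous. *)
Let edge_homeo e : edges S e -> homeomorphic (openD1 R) e.
Proof.
move=> ee; have [g eg] : e !=set0 by have [g gS ->] := ee; exists g; exact: edge_mem.
have [a [b [ab ceE]]] : exists a b, a < b /\ c @` e = `]a, b[%classic.
  apply: (@bounded_open_interval _ _ B).
  - apply/connected_intervalP; apply: connected_continuous_connected.
      by rewrite (edge_eq ee eg); exact: component_connected.
    exact: continuous_subspaceT.
  - rewrite openE => _ [h eh <-].
    have [d [s [d0 sh cs H o]]] := section_edge ee eh.
    apply/nbhs_ballP; exists d => //= t /H[ct est]; by exists (s t).
  - by exists (c g), g.
  - by move=> _ [h _ <-]; exact: cB.
have kappa t : exists h, a < t < b -> e h /\ c h = t.
  have [tab|] := boolP (a < t < b); last by exists g.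
  have : (c @` e) t by rewrite ceE /= in_itv.
  by move=> [h eh ht]; exists h.
pose k t := projT1 (cid (kappa t)).
have kP t : a < t < b -> e (k t) /\ c (k t) = t := projT2 (cid (kappa t)).
pose f t := k (a + (b - a) * ((t + 1) / 2)).
pose f' h := 2 * (c h - a) / (b - a) - 1.
have ba : 0 < b - a by rewrite subr_gt0.
have aff t : -1 < t < 1 -> a < a + (b - a) * ((t + 1) / 2) < b.
  move=> /andP[t1 t2]; apply/andP; split; first by rewrite ltrDl mulr_gt0 // divr_gt0 // -ltrBlDr sub0r.
  by rewrite -ltrBrDl gtr_pMr // ltr_pdivrMr // mul1r -ltrBrDr; lra.
have ceab h : e h -> a < c h < b.
  by move=> eh; have : (c @` e) (c h) by [exists h]; rewrite ceE /= in_itv.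
apply: (@homeomorphic_within _ _ _ _ f f').
- by move=> t; rewrite /openD1 /= in_itv /= => /aff /kP[].
- move=> h /ceab /andP[h1 h2]; rewrite /openD1 /= in_itv /= /f'.
  apply/andP; split; first by rewrite ltrBrDr addNr divr_gt0 // mulr_gt0 // subr_gt0.
  by rewrite ltrBlDr ltr_pdivrMr //; lra.
- move=> t; rewrite /openD1 /= in_itv /= => /aff /kP[_ E].
  by rewrite /f' /f E; field; rewrite gt_eqF.
- move=> h eh; have hab := ceab _ eh; rewrite /f /f'.
  have -> : a + (b - a) * ((2 * (c h - a) / (b - a) - 1 + 1) / 2) = c h.
    by field; rewrite gt_eqF.
  have [ek ck] := kP _ hab.
  by apply: (inj ee) => //; exact: mem_set.
- apply: continuous_in_subspaceT => t; rewrite inE /openD1 /= in_itv /= => tb.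
  have tab := aff _ tb; have [ek ck] := kP _ tab.
  set u := a + _ in tab ek ck.
  have [d [s [d0 sg cs H o]]] := section_edge ee ek.
  rewrite ck in sg H.
  have ct : {for t, continuous (fun t : R => a + (b - a) * ((t + 1) / 2))}.
    apply: cvgD; first exact: cvg_cst.
    apply: cvgM; first exact: cvg_cst.
    by apply: cvgM; [apply: cvgD; [exact: cvg_id|exact: cvg_cst]|exact: cvg_cst].
  have sct : s (a + (b - a) * ((z + 1) / 2)) @[z --> t] --> k u.
    by rewrite -sg; apply: (@continuous_comp _ _ _ (fun t : R => a + (b - a) * ((t + 1) / 2)) s _ ct); exact: cs.
  have nu : \forall w \near u, `|u - w| < d /\ a < w < b.
    near=> w; split; first by near: w; exact: nbhsx_ballx.
    suff : w \in `]a, b[ by rewrite in_itv.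
    by near: w; apply: near_in_itvoo; rewrite in_itv.
  have nt := ct _ nu.
  apply: cvg_trans sct; apply: near_eq_cvg.
  near=> z; rewrite /f /=.
  have [uv vab] : `|u - (a + (b - a) * ((z + 1) / 2))| < d /\
    a < a + (b - a) * ((z + 1) / 2) < b by near: z; exact: nt.
  have [cv ev] := H _ uv; have [ek' ck'] := kP _ vab.
  by apply: (inj ee); rewrite ?inE // cv ck'.
- apply: continuous_subspaceT => h.
  apply: cvgB; last exact: cvg_cst.
  apply: cvgM; last exact: cvg_cst.
  apply: cvgM; first exact: cvg_cst.
  by apply: cvgB; [exact: cc|exact: cvg_cst].
Unshelve. all: by end_near. Qed.

(** The edges index the disjoint union. Because each edge is open, the map sending a point to its
    edge is locally constant, and the homeomorphisms of the individual edges assemble. *)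
Let edges_homeo : exists I : choiceType, homeomorphic {i : I & openD1 R} (~` S).
Proof.
pose I : choiceType := {classic (set_type (edges S))}.
have ph (i : I) : exists (f : openD1 R -> set_val (i : set_type (edges S)))
   (g : set_val (i : set_type (edges S)) -> openD1 R),
   [/\ continuous f, continuous g, cancel f g & cancel g f].
  by have [f [g H]] := edge_homeo (set_valP (i : set_type (edges S))); exists f, g.
pose f i := projT1 (cid (ph i)); pose g i := projT1 (cid (projT2 (cid (ph i)))).
have fg i : [/\ continuous (f i), continuous (g i), cancel (f i) (g i) & cancel (g i) (f i)].
  exact: (projT2 (cid (projT2 (cid (ph i))))).
pose ed (h : ~` S) : I := exist _ (connected_component (~` S) (set_val h))
  (mem_set (edge_of (set_valP h))).
have edP h : set_val (ed h : set_type (edges S)) (set_val h).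
  exact: edge_mem (set_valP h).
pose F (x : {i : I & openD1 R}) : ~` S := exist _ (set_val (f _ (projT2 x)))
  (mem_set (edge_sub (set_valP (projT1 x : set_type (edges S))) (set_valP (f _ (projT2 x))))).
pose K (h : ~` S) : {i : I & openD1 R} :=
  existT _ (ed h) (g (ed h) (exist _ (set_val h) (mem_set (edP h)))).
have ed_eq (i : I) (h : ~` S) : set_val (i : set_type (edges S)) (set_val h) -> ed h = i.
  move=> ih; apply/val_inj => /=; apply/esym.
  exact: edge_eq (set_valP (i : set_type (edges S))) ih.
exists I, F, K; split.
- apply: continuous_into_set_type.
  apply: (@sigT_continuous I (fun=> openD1 R) G (fun i x => set_val (f i x))) => i x.
  apply: (@continuous_comp _ _ _ (f i) set_val); first by have [+ _ _ _] := fg i; apply.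
  exact: set_val_continuous.
- move=> h W; rewrite /nbhs /= => WK.
  have {}WK : nbhs (g (ed h) (exist _ (set_val h) (mem_set (edP h)))) (fun x => W (existT _ (ed h) x)).
    exact: WK.
  have [_ cg _ _] := fg (ed h).
  have [W' [ [ V oV VW'] Vh] VW] := cg _ _ WK; rewrite -VW' /= in Vh VW.
  have eO : open (V `&` set_val (ed h : set_type (edges S))).
    by apply: openI => //; apply: edge_open; exact: set_valP.
  exists (set_val @^-1` (V `&` set_val (ed h : set_type (edges S)))).
    split; first by exists (V `&` set_val (ed h : set_type (edges S))).
    exact (conj Vh (edP h)).
  move=> h' [Vh' eh'] /=.
  have E : ed h' = ed h by exact: ed_eq.
  rewrite /K; move: (edP h'); rewrite E => p.
  by apply: VW.
- move=> [i x]; rewrite /K.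
  have E : ed (F (existT _ i x)) = i by apply: ed_eq; exact: (set_valP (f i x)).
  move: (edP (F (existT _ i x))); rewrite E => p; congr existT.
  have [_ _ fK _] := fg i; rewrite -[RHS]fK; congr g.
  exact/val_inj.
- move=> h; apply/val_inj => /=.
  by have [_ _ _ gK] := fg (ed h); rewrite gK.
Qed.

Lemma pre_digraph_of_sections : pre_digraph S c.
Proof.
split => //.
split => //.
- apply/seteqP; split=> [g [e ee eg]|g gS]; first exact: edge_sub ee _ eg.
  by exists (connected_component (~` S) g); [exact: edge_of|exact: edge_mem].
- move=> e e' ee ee' [g [eg eg']].
  by rewrite (edge_eq ee eg) (edge_eq ee' eg').
- move=> e ee z [ez nez]; apply: contrapT => Sz.
  have oz := edge_open (edge_of Sz).
  have [y [ey zy]] := ez _ (open_nbhs_nbhs (conj oz (edge_mem Sz))).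
  by apply: nez; rewrite (edge_eq ee ey) -(same_connected_component zy); exact: edge_mem.
Qed.

End PreDigraphOfSections.

(** * Finite stars as graph neighbourhoods *)

Section Star.
Context {R : realType} {G : topologicalType} (S : set G) (c : G -> R).
Context (g0 : G) (I : finType) (f : I -> R -> G) (d : I -> R).
Hypotheses (hG : hausdorff_space G) (cc : continuous c).
Hypothesis f_cont : forall i, continuous (f i).
Hypothesis f0 : forall i, f i 0 = g0.
Hypothesis d_neq0 : forall i, d i != 0.
Hypothesis cf : forall i r, 0 <= r <= 1 -> c (f i r) = c g0 + r * d i.
Hypothesis f_disj : forall i j r r', 0 < r <= 1 -> 0 < r' <= 1 -> f i r = f j r' -> i = j.
Hypothesis f_nbhs : nbhs g0 [set g | exists i r, 0 <= r <= 1 /\ g = f i r].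
Hypothesis f_notS : forall i r, 0 < r <= 1 -> ~ S (f i r).

Let U : set G := [set g | exists i r, 0 <= r <= 1 /\ g = f i r].
Let K : topologicalType := set_type U.

Let clip (r : R) := Num.max 0 (Num.min r 1).

Let clip_in r : 0 <= clip r <= 1.
Proof. by rewrite /clip le_max lexx /= ge_max ler01 ge_min lexx orbT. Qed.

Let clipK r : 0 <= r <= 1 -> clip r = r.
Proof. by move=> /andP[r0 r1]; rewrite /clip (min_idPl r1); exact/max_idPr. Qed.

Let clip_cont : continuous clip.
Proof.
move=> r; apply: (@continuous_max R R (fun=> 0) (fun r => Num.min r 1)); first exact: cvg_cst.
by apply: (@continuous_min R R id (fun=> 1)); [exact: cvg_id|exact: cvg_cst].
Qed.

Let arc i (r : R) : K := exist _ (f i (clip r))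
  (mem_set (ex_intro _ i (ex_intro _ (clip r) (conj (clip_in r) erefl)))).

Let arc_val i r : 0 <= r <= 1 -> set_val (arc i r) = f i r.
Proof. by move=> r01; apply: (congr1 (f i)); exact: clipK. Qed.

Let arc_cont i : continuous (arc i).
Proof.
apply: continuous_into_set_type => r /=.
by apply: (@continuous_comp _ _ _ clip (f i)); [exact: clip_cont|exact: f_cont].
Qed.

Let f_inj i r r' : 0 <= r <= 1 -> 0 <= r' <= 1 -> f i r = f i r' -> r = r'.
Proof.
by move=> r1 r2 /(congr1 c); rewrite !cf // => /addrI /(mulIf (d_neq0 i)).
Qed.

Let f_neq0 i r : 0 < r <= 1 -> f i r <> g0.
Proof.
move=> r01; rewrite -(f0 i) => /f_inj E; move: (r01); rewrite E ?ltxx //.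
  by case/andP: r01 => /ltW -> ->.
by rewrite lexx ler01.
Qed.

Let V : set K := [set k | set_val k = g0 \/ exists i, set_val k = f i 1].
Let E (i : I) : set K := [set k | exists r, 0 < r < 1 /\ set_val k = f i r].
Let Es : set (set K) := [set e | exists i, e = E i].

Let lt_le (r : R) : 0 < r < 1 -> 0 < r <= 1.
Proof. by move=> /andP[-> /ltW ->]. Qed.

Let lt_le2 (r : R) : 0 < r < 1 -> 0 <= r <= 1.
Proof. by move=> /andP[/ltW -> /ltW ->]. Qed.

Let one_in : 0 < (1 : R) <= 1. Proof. by rewrite ltr01 lexx. Qed.

Let hK : hausdorff_space K. Proof. exact: hausdorff_set_type. Qed.

Let par (t : R) := (t + 1) / 2.
Let par_cont : continuous par.
Proof.
move=> t; apply: cvgM; last exact: cvg_cst.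
by apply: cvgD; [exact: cvg_id|exact: cvg_cst].
Qed.

Let F i t : K := arc i (par t).
Let F' i (k : K) : R := 2 * ((c (set_val k) - c g0) / d i) - 1.

Let F_cont i : continuous (F i).
Proof. by move=> t; apply: (@continuous_comp _ _ _ par (arc i)); [exact: par_cont|exact: arc_cont]. Qed.

Let F'_cont i : continuous (F' i).
Proof.
have cv : continuous (fun k : K => c (set_val k)).
  by move=> k; apply: (@continuous_comp _ _ _ set_val c); [exact: set_val_continuous|exact: cc].
move=> k.
apply: (@continuous_comp _ _ _ (fun k : K => c (set_val k))
  (fun y => 2 * ((y - c g0) / d i) - 1)); first exact: cv.
apply: cvgB; last exact: cvg_cst.
apply: cvgM; first exact: cvg_cst.
apply: cvgM; last exact: cvg_cst.
by apply: cvgB; [exact: cvg_id|exact: cvg_cst].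
Qed.

Let F_val i t : -1 <= t <= 1 -> set_val (F i t) = f i (par t).
Proof. by move=> /andP[t1 t2]; apply: arc_val; rewrite /par; apply/andP; split; lra. Qed.

Let F'K i (k : K) r : 0 <= r <= 1 -> set_val k = f i r -> F' i k = 2 * r - 1.
Proof. by move=> r01 kE; rewrite /F' kE cf // addrAC subrr add0r mulfK. Qed.

Let FK i t : -1 <= t <= 1 -> F' i (F i t) = t.
Proof.
move=> t11; rewrite (@F'K i _ (par t)) ?F_val //; first by rewrite /par; field.
by case/andP: t11 => t1 t2; rewrite /par; apply/andP; split; lra.
Qed.

Let F'FK i (k : K) r : 0 <= r <= 1 -> set_val k = f i r -> F i (F' i k) = k.
Proof.
move=> r01 kE; apply/val_inj; rewrite (F'K r01 kE) /F.
have -> : par (2 * r - 1) = r by rewrite /par; field.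
by rewrite [LHS]arc_val.
Qed.

Let closure_E i : closure (E i) = [set k | exists r, 0 <= r <= 1 /\ set_val k = f i r].
Proof.
apply/seteqP; split.
  have EA : E i `<=` arc i @` `[0, 1].
    move=> k [r [r01 kE]]; exists r; first by rewrite /= in_itv /= lt_le2.
    by apply/val_inj; exact: (etrans (arc_val i (lt_le2 r01)) (esym kE)).
  have cA : closed (arc i @` `[0, 1]).
    apply: compact_closed => //; apply: continuous_compact; last exact: segment_compact.
    exact: continuous_subspaceT.
  move=> k /(closureS EA); rewrite -(closure_id _).1 // => -[r].
  by rewrite /= in_itv /= => r01 <-; exists r; split => //; exact: arc_val.
move=> k [r [r01 kE]] W Wk.
have kA : k = arc i r by apply/val_inj; exact: (etrans kE (esym (arc_val i r01))).
rewrite kA in Wk; have := arc_cont Wk; rewrite /nbhs /= => Wr.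
have /nbhs_ballP[e /= e0 eW] : nbhs r (arc i @^-1` W) by exact: Wr.
pose e' := Num.min (e / 2) (1 / 2).
have e'0 : 0 < e' by rewrite lt_min !divr_gt0.
have e'1 : e' <= 1 / 2 by rewrite ge_min lexx orbT.
have e'e : e' < e.
  by apply: (@le_lt_trans _ _ (e / 2)); rewrite ?ge_min ?lexx // gtr_pMr // invf_lt1 // ltr1n.
have [s [s01 rs]] : exists s, 0 < s < 1 /\ `|r - s| < e.
  case/andP: (r01) => r0 r1.
  have [r2|r2] := ltP r (1 / 2).
    exists (r + e'); split; first by apply/andP; split; lra.
    by rewrite opprD addrA subrr add0r normrN gtr0_norm.
  exists (r - e' / 2); split; first by apply/andP; split; lra.
  by rewrite subKr gtr0_norm ?divr_gt0 //; lra.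
exists (arc i s); split; last exact: eW.
by exists s; split=> //; exact: (arc_val i (lt_le2 s01)).
Qed.

Let E_homeo i : homeomorphic (openD1 R) (E i).
Proof.
apply: (@homeomorphic_within _ _ _ _ (F i) (F' i)).
- move=> t; rewrite /openD1 /= in_itv /= => /andP[t1 t2].
  exists (par t); split; first by rewrite /par; apply/andP; split; lra.
  by rewrite F_val // !ltW.
- move=> k [r [r01 kE]]; rewrite (F'K (lt_le2 r01) kE) /openD1 /= in_itv /=.
  by case/andP: r01 => r0 r1; apply/andP; split; lra.
- by move=> t; rewrite /openD1 /= in_itv /= => /andP[/ltW t1 /ltW t2]; rewrite FK // t1.
- by move=> k [r [r01 kE]]; exact: (F'FK (lt_le2 r01) kE).
- by apply: continuous_subspaceT; exact: F_cont.
- by apply: continuous_subspaceT; exact: F'_cont.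
Qed.

Let closure_E_homeo i : homeomorphic (D1 R) (closure (E i)).
Proof.
rewrite closure_E; apply: (@homeomorphic_within _ _ _ _ (F i) (F' i)).
- move=> t; rewrite /D1 /= in_itv /= => /andP[t1 t2].
  exists (par t); split; first by rewrite /par; apply/andP; split; lra.
  by rewrite F_val // t1.
- move=> k [r [r01 kE]]; rewrite (F'K r01 kE) /D1 /= in_itv /=.
  by case/andP: r01 => r0 r1; apply/andP; split; lra.
- by move=> t; rewrite /D1 /= in_itv /= => /FK.
- by move=> k [r [r01 kE]]; exact: (F'FK r01 kE).
- by apply: continuous_subspaceT; exact: F_cont.
- by apply: continuous_subspaceT; exact: F'_cont.
Qed.

Let Es_cover : \bigcup_(e in Es) e = ~` V.
Proof.
apply/seteqP; split=> [k [_ [i ->] [r [r01 kE]]]|k nV].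
  have rl := lt_le r01.
  case=> [kg|[j kj]]; first by apply: (@f_neq0 i r) => //; rewrite -kE.
  have ij : i = j by apply: (f_disj rl one_in); rewrite -kE.
  subst j; have r1 : r = 1 by apply: (@f_inj i); rewrite ?ler01 ?lexx ?lt_le2 // -kE.
  by move: r01; rewrite r1 ltxx andbF.
have [i [r [/andP[r0 r1] kE0]]] := set_valP k.
have kE : set_val k = f i r := kE0.
exists (E i); first by exists i.
exists r; split=> //; apply/andP; split; rewrite lt_neqAle ?r0 ?r1 andbT.
  by apply/eqP => r0'; apply: nV; left; rewrite kE -r0' f0.
by apply/eqP => r1'; apply: nV; right; exists i; rewrite kE r1'.
Qed.

Let Es_triv : trivIset Es id.
Proof.
move=> _ _ [i ->] [j ->] [k [[r [r01 kE]] [s [s01 kE']]]].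
by congr E; apply: (f_disj (lt_le r01) (lt_le s01)); rewrite -kE.
Qed.

Let finite_V : finite_set V.
Proof.
have -> : V = [set k | set_val k = g0] `|` \bigcup_(i in [set: I]) [set k | set_val k = f i 1].
  apply/seteqP; split=> k; first by move=> [kg|[i ki]]; [left|right; exists i].
  by move=> [kg|[i _ ki]]; [left|right; exists i].
have fin1 g : finite_set [set k : K | set_val k = g].
  have [[k0 k0g]|no] := pselect (exists k : K, set_val k = g).
    apply: (@sub_finite_set _ _ [set k0]); last exact: finite_set1.
    by move=> k kg; apply/val_inj; exact: (etrans kg (esym k0g)).
  apply: (@sub_finite_set _ _ set0); last exact: finite_set0.
  by move=> k kg; apply: no; exists k.
rewrite finite_setU; split; first exact: fin1.
by apply: bigcup_finite => [|i _]; [exact: finite_finset|exact: fin1].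
Qed.

Let Es_boundary e : Es e -> closure e `\` e `<=` V.
Proof.
move=> [i ->] k []; rewrite closure_E => -[r [/andP[r0 r1] kE]] nE.
have [r0'|r0'] := eqVneq r 0; first by left; rewrite kE r0' f0.
have [r1'|r1'] := eqVneq r 1; first by right; exists i; rewrite kE r1'.
exfalso; apply: nE; exists r; split=> //.
by rewrite !lt_neqAle r0 r1 eq_sym r0' r1'.
Qed.

Let graphK : graph R K.
Proof.
exists V, Es; split.
- split.
  + split => //; first by move=> _ [i ->].
  + move=> _ [i ->]; exists (F i); split.
    * by apply: continuous_subspaceT; exact: F_cont.
    * move=> _ [t [->|->] <-].
        left; rewrite F_val; last by apply/andP; split; lra.
        by rewrite /par addNr mul0r.
      right; exists i; rewrite F_val; last by apply/andP; split; lra.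
      by rewrite /par; congr f; field.
    * apply/seteqP; split=> [_ [t + <-]|k [r [r01 kE]]].
        rewrite /openD1 /= in_itv /= => /andP[t1 t2].
        exists (par t); split; first by rewrite /par; apply/andP; split; lra.
        by rewrite F_val // !ltW.
      exists (F' i k); last exact: (F'FK (lt_le2 r01) kE).
      rewrite (F'K (lt_le2 r01) kE) /openD1 /= in_itv /=.
      by case/andP: r01 => r0 r1; apply/andP; split; lra.
    * exists (F' i); split; first by apply: continuous_subspaceT; exact: F'_cont.
      by move=> t; rewrite /openD1 /= in_itv /= => /andP[/ltW t1 /ltW t2]; rewrite FK // t1.
  + move=> A cA.
    have -> : A = (A `&` V) `|` \bigcup_(i in [set: I]) (A `&` closure (E i)).
      apply/seteqP; split=> k; last by move=> [[]|[i _ []]].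
      move=> Ak; have [Vk|nV] := pselect (V k); first by left.
      have : (\bigcup_(e in Es) e) k by rewrite Es_cover.
      move=> [_ [i ->] Ek]; right; exists i => //; split => //.
      exact: subset_closure.
    apply: closedU.
      have/accessible_finite_set_closed := hausdorff_accessible hK; apply.
      by apply: (@sub_finite_set _ _ V); [move=> ? []|exact: finite_V].
    apply: closed_bigcup => [|i _]; first exact: finite_finset.
    by apply: cA; exists i.
- move=> k; exists setT; split; first exact: filterT.
    by rewrite setIT; exact: finite_V.
  apply: (@sub_finite_set _ _ (E @` [set: I])).
    by move=> e [[i ->] _]; exists i.
  by apply: finite_image; exact: finite_finset.
- by move=> _ [i ->].
Qed.

(** Finitely many arcs leave [g0], and [c] is affine of nonzero slope along each, so [c] itself
    recovers the parameter and inverts the parametrizations of the cells. The vertices of the graph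
    are [g0] and the outer ends of the arcs; finiteness settles the weak topology and local
    finiteness. *)
Lemma star_not_NF : ~ NF R S g0.
Proof.
apply; exists U; split; first exact: f_nbhs.
  apply/seteqP; split=> // g [[i [r [/andP[r0 r1] ->]]] [Sg g_neq]].
  have [r0'|r0'] := eqVneq r 0; first by apply: g_neq; rewrite /= r0'.
  by apply: (@f_notS i r) Sg; rewrite r1 lt_neqAle eq_sym r0' r0.
exists K; split; first exact: graphK.
by exists id, id; split => // x; exact: cvg_id.
Qed.

End Star.

(** * Local structure of a planar Reeb space *)

Section Planar.
Context {R : realType} {G : topologicalType} (c1 c2 : R -> R).
Context (c : G -> R) (Q : R * R -> G) (S : set G).
Hypothesis PR : planar_reeb c1 c2 c Q S.
Implicit Types (A : set (R * R)) (t x : R) (g : G).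
Local Notation strip := (in_strip c1 c2).
Local Notation joined := (joined c1 c2).

Lemma joined_refl t x : strip t x -> joined t x x.
Proof. by move=> D y; rewrite minxx maxxx -eq_le => /eqP <-. Qed.

Lemma joinedC t x x' : joined t x x' -> joined t x' x.
Proof. by move=> J y; rewrite minC maxC; exact: J. Qed.

Lemma joined_r t x x' : joined t x x' -> strip t x'.
Proof. by apply; rewrite ge_min lexx le_max lexx !orbT. Qed.

Lemma joined_le t x x' : x <= x' -> (forall y, x <= y <= x' -> strip t y) -> joined t x x'.
Proof. by move=> xx' H y; rewrite (min_idPl xx') (max_idPr xx'); exact: H. Qed.

Lemma joined_wlog (P : R -> Prop) t : (forall x x', P x -> P x' -> x <= x' -> joined t x x') ->
  forall x x', P x -> P x' -> joined t x x'.
Proof.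
by move=> H x x' Px Px'; have [/H|/ltW /H] := leP x x'; [apply|move=> J; apply/joinedC/J].
Qed.

Definition saturated A := forall t x x', strip t x -> joined t x x' -> A (t, x) -> A (t, x').

Definition img A : set G := Q @` (A `&` [set p | strip p.1 p.2]).

Lemma img_open A : open A -> saturated A -> open (img A).
Proof. by move=> oA sA; exact: (pr_open PR). Qed.

Lemma imgP A t x : saturated A -> strip t x -> img A (Q (t, x)) <-> A (t, x).
Proof.
move=> sA D; split=> [[[t' x'] [/= At' D'] E]|Atx]; last by exists (t, x).
have := congr1 c E; rewrite !(pr_cQ PR) // => tE; rewrite tE in At' D' E.
by apply: sA At' => //; apply/(pr_joined PR).
Qed.

Lemma img_disjoint A A' : saturated A -> saturated A' -> A `&` A' = set0 ->
  img A `&` img A' = set0.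
Proof.
move=> sA sA' AA'; rewrite -subset0 => g [[[t x] [/= At D] <-]].
by move/(imgP sA' D) => A't; have : (A `&` A') (t, x) by []; rewrite AA'.
Qed.

(** Distinct levels are separated by [c]. On one level, two points that are not joined are separated
    by some abscissa [y] missing from the slice. The points to the left and to the right of [y]
    whose level still misses [y] form disjoint saturated open sets. *)
Lemma hausdorff_planar : hausdorff_space G.
Proof.
move=> g g' gg'.
have [t [x [D gE]]] := pr_surj PR g; have [t' [x' [D' g'E]]] := pr_surj PR g'.
have : c g = c g'.
  apply: Rhausdorff => V W Vc Wc.
  have [z [Vz Wz]] := gg' _ _ (pr_c PR Vc) (pr_c PR Wc).
  by exists (c z).
rewrite gE g'E !(pr_cQ PR) // => tt'; subst t'.
apply: contrapT => gneq.
have : ~ joined t x x' by move=> /(pr_joined PR D D').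
move=> /existsNP[y /not_implyP[/andP[ym yM] /negP nDy]].
pose A b := [set p : R * R | (if b then p.2 < y else y < p.2) /\ ~~ strip p.1 y].
have oA b : open (A b).
  have oN : open [set p : R * R | ~~ strip p.1 y].
    have -> : [set p : R * R | ~~ strip p.1 y] =
        fst @^-1` [set t : R | t < c1 y] `|` fst @^-1` [set t : R | c2 y < t].
      apply/seteqP; split=> -[u v] /=; rewrite /in_strip negb_and -!ltNge.
        by move=> /orP[]; [left|right].
      by move=> [->|->]; rewrite ?orbT.
    apply: openU; apply: open_comp; try by move=> ? _; exact: cvg_fst.
      exact: open_lt.
    exact: open_gt.
  have -> : A b = (snd @^-1` [set x : R | if b then x < y else y < x]) `&` [set p | ~~ strip p.1 y] by [].
  apply: openI => //; apply: open_comp; first by move=> ? _; exact: cvg_snd.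
  by case: b; [exact: open_lt|exact: open_gt].
have sA b : saturated (A b).
  move=> u v v' Dv J [/= bv nDu]; split => //=; apply: contraT => bv'.
  exfalso; move/negP: nDu; apply; apply: J.
  move: bv bv'; case: b; rewrite -leNgt; [move=> /ltW vy yv'|move=> /ltW yv v'y].
    by rewrite (min_idPl (le_trans vy yv')) (max_idPr (le_trans vy yv')) vy.
  by rewrite (min_idPr (le_trans v'y yv)) (max_idPl (le_trans v'y yv)) v'y.
have xy : x != y by apply/eqP => xy; move: nDy; rewrite -xy D.
have x'y : x' != y by apply/eqP => xy'; move: nDy; rewrite -xy' D'.
have [b [Ax Ax']] : exists b, A b (t, x) /\ A (~~ b) (t, x').
  have [xx'|x'x] := leP x x'.
    exists true; rewrite /A /=; rewrite (min_idPl xx') in ym; rewrite (max_idPr xx') in yM.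
    by rewrite !lt_neqAle xy ym eq_sym x'y yM; split; split => //; exact/negP.
  exists false; rewrite /A /=; rewrite (min_idPr (ltW x'x)) in ym; rewrite (max_idPl (ltW x'x)) in yM.
  by rewrite !lt_neqAle eq_sym xy ym x'y yM; split; split => //; exact/negP.
have Ag : img (A b) g by rewrite gE; apply/(imgP (sA b) D).
have Ag' : img (A (~~ b)) g' by rewrite g'E; apply/(imgP (sA (~~ b)) D').
have [z [Az Az']] := gg' _ _ (open_nbhs_nbhs (conj (img_open (oA b) (sA b)) Ag))
  (open_nbhs_nbhs (conj (img_open (oA (~~ b)) (sA (~~ b))) Ag')).
have : (img (A b) `&` img (A (~~ b))) z by [].
rewrite img_disjoint // -subset0 => -[u v] /= [[h _] [h' _]].
by move: h h'; case: (b) => /= h h'; have := lt_trans h h'; rewrite ltxx.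
Qed.

Lemma Q_continuous_fst x : continuous (fun t => Q (t, x)).
Proof.
move=> t; apply: (@continuous_comp _ _ _ (fun t => (t, x)) Q); last exact: (pr_Q PR).
by apply: (@cvg_pair _ _ _ _ (nbhs t) (nbhs x)) => /=; [exact: cvg_id|exact: cvg_cst].
Qed.

(** The part of [A] in the strip maps to a set meeting each level in at most one point. The interior
    point demanded on every occupied level allows the level to vary at fixed abscissa, so [c] is a
    local coordinate there. *)
Record leg A : Prop := Leg {
  leg_open : open A;
  leg_sat : saturated A;
  leg_joined : forall t x x', A (t, x) -> A (t, x') -> strip t x -> strip t x' -> joined t x x';
  leg_inner : forall t x, A (t, x) -> strip t x ->
    exists x', A (t, x') /\ c1 x' < t < c2 x' }.

Lemma inner_strip t x : c1 x < t < c2 x -> strip t x.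
Proof. by case/andP => /ltW + /ltW; rewrite /in_strip => -> ->. Qed.

Lemma open_slice A t x : open A -> A (t, x) -> c1 x < t < c2 x ->
  exists2 d, 0 < d & forall t', `|t - t'| < d -> A (t', x) /\ strip t' x.
Proof.
move=> oA Atx /andP[t1 t2].
have cp : (fun t => (t, x)) @ t --> (t, x).
  by apply: (@cvg_pair _ _ _ _ (nbhs t) (nbhs x)) => /=; [exact: cvg_id|exact: cvg_cst].
have : \forall t' \near t, A (t', x) /\ strip t' x.
  near=> t'; split.
    by near: t'; apply: cp; exact: open_nbhs_nbhs.
  by apply/andP; split; apply: ltW; near: t'; [exact: lt_nbhsr|exact: lt_nbhsl].
by move=> /nbhs_ballP[d /= d0 H]; exists d.
Unshelve. all: by end_near. Qed.

Lemma level_open d t : 0 < d -> open [set p : R * R | `|t - p.1| < d].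
Proof.
move=> d0; have -> : [set p : R * R | `|t - p.1| < d] = fst @^-1` (ball t d) by [].
by apply: open_comp => [? _|]; [exact: cvg_fst|exact: ball_open].
Qed.

Lemma saturated_level (P : R -> Prop) A : saturated A ->
  saturated (A `&` [set p | P p.1]).
Proof. by move=> sA t x x' D J [Atx Pt]; split => //; exact: sA J Atx. Qed.

(** An interior abscissa stays in the strip at nearby levels. Since a level of the leg is a single
    point, the vertical segment over this abscissa sweeps out the whole leg between those levels. *)
Lemma leg_section A t x : leg A -> A (t, x) -> strip t x ->
  exists d x0, [/\ 0 < d, joined t x x0,
    forall t', `|t - t'| < d -> A (t', x0) /\ strip t' x0,
    (fun t' => Q (t', x0)) @` ball t d = img (A `&` [set p | `|t - p.1| < d]) &
    open (img (A `&` [set p | `|t - p.1| < d]))].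
Proof.
move=> lA Atx D; have [x0 [Ax0 x0in]] := leg_inner lA Atx D.
have [d d0 H] := open_slice (leg_open lA) Ax0 x0in.
exists d, x0; split => //.
- by apply: (leg_joined lA) => //; exact: inner_strip.
- apply/seteqP; split=> [_ [t' tt' <-]|_ [[t' x'] [/= [At' tt'] D'] <-]].
    by have [At' D'] := H t' tt'; exists (t', x0).
  exists t' => //; have [At0 D0] := H t' tt'.
  by apply/(pr_joined PR) => //; exact: (leg_joined lA).
- apply: img_open; first by apply: openI; [exact: leg_open|exact: level_open].
  by apply: (@saturated_level (fun u => `|t - u| < d)); exact: leg_sat.
Qed.

(** The arms are vertical segments of height [d] over the abscissas [xs i], going up or down
    according to [sg i]. They must exhaust the saturated set near level [t0], and [d] must be small
    enough to meet no other critical level. *)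
Lemma planar_star t0 x0 A (I : finType) (xs sg : I -> R) (d : R) (i0 : I) :
  0 < d -> open A -> saturated A -> A (t0, x0) -> strip t0 x0 ->
  (forall i, sg i = 1 \/ sg i = -1) ->
  (forall i r, 0 <= r <= 1 -> strip (t0 + r * (sg i * d)) (xs i)) ->
  (forall i, joined t0 x0 (xs i)) ->
  (forall t x, A (t, x) -> strip t x -> `|t0 - t| < d ->
     exists i r, [/\ 0 <= r <= 1, t = t0 + r * (sg i * d) & joined t x (xs i)]) ->
  (forall i j r, 0 < r <= 1 -> sg i = sg j ->
     joined (t0 + r * (sg i * d)) (xs i) (xs j) -> i = j) ->
  (forall g, S g -> 0 < `|c g - t0| <= d -> False) ->
  ~ NF R S (Q (t0, x0)).
Proof.
move=> d0 oA sA Atx D sg1 arcs J0 cover disj noS.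
have sgd i : sg i * d != 0.
  apply: mulf_neq0; last by rewrite gt_eqF.
  by case: (sg1 i) => ->; rewrite ?oppr_eq0 oner_eq0.
have cf i r : 0 <= r <= 1 -> c (Q (t0 + r * (sg i * d), xs i)) = c (Q (t0, x0)) + r * (sg i * d).
  by move=> r01; rewrite !(pr_cQ PR) //; exact: arcs.
have lw (r : R) : 0 < r <= 1 -> 0 <= r <= 1 by move=> /andP[/ltW -> ->].
apply: (@star_not_NF R G S c _ I (fun i r => Q (t0 + r * (sg i * d), xs i)) (fun i => sg i * d)) => //.
- exact: hausdorff_planar.
- exact: (pr_c PR).
- move=> i.
  suff : continuous ((fun t => Q (t, xs i)) \o (fun r => t0 + r * (sg i * d))) by [].
  move=> r; apply: continuous_comp; last exact: Q_continuous_fst.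
  by apply: cvgD; [exact: cvg_cst|apply: cvgM; [exact: cvg_id|exact: cvg_cst]].
- move=> i; rewrite mul0r addr0; apply/(pr_joined PR) => //.
    exact: joined_r (J0 i).
  exact/joinedC/J0.
- move=> i j r r' r01 r'01 E.
  have := congr1 c E; rewrite (cf i r (lw r r01)) (cf j r' (lw r' r'01)) => /addrI.
  rewrite !mulrA => /(mulIf (lt0r_neq0 d0)) rr'.
  have [sE rE] : sg i = sg j /\ r = r'.
    case/andP: r01 => r0 _; case/andP: r'01 => r'0 _.
    move: rr'; case: (sg1 i) => ->; case: (sg1 j) => -> rr'; split => //; lra.
  apply: (disj i j r) => //; apply/(pr_joined PR); rewrite ?E //.
  + exact: arcs (lw _ r01).
  + by rewrite sE rE; exact: arcs (lw _ r'01).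
  + by rewrite sE rE.
- apply: (@filterS _ _ _ (img (A `&` [set p | `|t0 - p.1| < d]))).
    move=> _ [[t x] [/= [At td] Dt] <-].
    have [i [r [r01 tE J]]] := cover _ _ At Dt td.
    exists i, r; split => //; rewrite -tE.
    by apply/(pr_joined PR) => //; exact: joined_r J.
  apply: open_nbhs_nbhs; split.
    apply: img_open; first by apply: openI => //; exact: level_open.
    exact: (@saturated_level (fun u => `|t0 - u| < d)).
  by exists (t0, x0) => //; split => //; split => //=; rewrite subrr normr0.
- move=> i r r01 Sg; apply: (noS _ Sg); rewrite cf ?lw // (pr_cQ PR) // addrAC subrr add0r.
  have -> : `|r * (sg i * d)| = r * d.
    rewrite !normrM (gtr0_norm d0); case/andP: r01 => r0 _; rewrite (gtr0_norm r0).
    by case: (sg1 i) => ->; rewrite ?normrN normr1 mul1r.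
  by case/andP: r01 => r0 r1; rewrite mulr_gt0 //= ger_pMl.
Qed.

(** An interior abscissa gives a star with two arms, one upwards and one downwards over the same
    abscissa. *)
Lemma leg_not_NF A t0 x : leg A -> A (t0, x) -> strip t0 x ->
  (exists2 e, 0 < e & forall g, S g -> 0 < `|c g - t0| < e -> False) ->
  ~ NF R S (Q (t0, x)).
Proof.
move=> lA At D [e e0 noS].
have [d [x0 [d0 J H _ _]]] := leg_section lA At D.
pose d' := Num.min (d / 2) (e / 2).
have d'0 : 0 < d' by rewrite lt_min !divr_gt0.
have d'd : d' < d by rewrite (@le_lt_trans _ _ (d / 2)) ?ge_min ?lexx // gtr_pMr // invf_lt1 // ltr1n.
have d'e : d' < e by rewrite (@le_lt_trans _ _ (e / 2)) ?ge_min ?lexx ?orbT // gtr_pMr // invf_lt1 // ltr1n.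
pose sg (b : bool) : R := if b then 1 else -1.
apply: (@planar_star t0 x A bool (fun=> x0) sg d' true) => //.
- exact: leg_open.
- exact: leg_sat.
- by case; [left|right].
- move=> b r /andP[r0 r1]; have [] // := H (t0 + r * (sg b * d')).
  rewrite opprD addrA subrr add0r normrN !normrM (gtr0_norm d'0) ger0_norm //.
  have -> : `|sg b| = 1 by case: b; rewrite /= ?normrN normr1.
  by rewrite mul1r; apply: le_lt_trans d'd; rewrite ger_pMl.
- move=> t x' At' D' td.
  have [At0 D0] := H t (lt_trans td d'd).
  exists (t0 <= t), (`|t0 - t| / d'); split.
  + by rewrite divr_ge0 ?(ltW d'0) //= ler_pdivrMr // mul1r ltW.
  + rewrite mulrCA -mulrA mulVf ?gt_eqF // mulr1 /sg.
    case: leP => [tt|/ltW tt]; first by rewrite ler0_norm ?subr_le0 // mul1r opprB subrKC.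
    by rewrite ger0_norm ?subr_ge0 // mulN1r opprB subrKC.
  + exact: (leg_joined lA).
- move=> i j r r01; case: i; case: j => // /eqP; rewrite /sg ?[_ == 1]eq_sym -addr_eq0 ?opprK.
    by rewrite -mulr2n pnatr_eq0.
  by rewrite -mulr2n pnatr_eq0.
- by move=> g Sg /andP[h1 h2]; apply: (noS _ Sg); rewrite h1 (le_lt_trans h2).
Qed.

(** The images of the legs are open, pairwise disjoint and cover the complement of [S], so by
    connectedness each edge lies in one of them, and a leg has one point per level. Legs avoid level
    0, the only level at which critical values may accumulate, so the section of a leg can be
    shortened to avoid [S]. *)
Lemma planar_pre_digraph (L : set (set (R * R))) (B : R) :
  (forall x, - B <= c1 x /\ c2 x <= B) ->
  (forall A, L A -> leg A) ->
  (forall A A', L A -> L A' -> A `&` A' !=set0 -> A = A') ->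
  (forall A t x, L A -> A (t, x) -> t != 0) ->
  (forall t0, t0 != 0 -> exists2 e, 0 < e & forall g, S g -> 0 < `|c g - t0| < e -> False) ->
  (forall g, ~ S g -> exists2 A, L A & img A g) ->
  pre_digraph S c.
Proof.
move=> cB Lleg Ldisj L0 Sdisc cover.
have oL A : L A -> open (img A).
  by move=> LA; apply: img_open; [exact: leg_open (Lleg _ LA)|exact: leg_sat (Lleg _ LA)].
apply: (@pre_digraph_of_sections R G S c B).
- exact: hausdorff_planar.
- exact: (pr_c PR).
- move=> g; have [t [x [/andP[D1 D2] ->]]] := pr_surj PR g.
  rewrite (pr_cQ PR) /in_strip ?D1 // ler_norml.
  by have [h1 h2] := cB x; rewrite (le_trans h1) // (le_trans D2).
- move=> g nSg; have [A LA [[t x] [/= At D] gE]] := cover _ nSg; have lA := Lleg _ LA.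
  have [e e0 noS] := Sdisc t (L0 _ _ _ LA At).
  have [d [x0 [d0 J H HE _]]] := leg_section lA At D.
  have cg : c g = t by rewrite -gE (pr_cQ PR).
  pose d' := Num.min d e.
  have d'0 : 0 < d' by rewrite lt_min d0.
  have gE' : Q (t, x0) = g by rewrite -gE; apply/(pr_joined PR) => //; [exact: joined_r J|exact: joinedC].
  exists d', (fun t => Q (t, x0)); rewrite cg; split => //.
  + exact: Q_continuous_fst.
  + move=> t' tt'; have [td te] : `|t - t'| < d /\ `|t - t'| < e.
      by move: tt'; rewrite lt_min => /andP[].
    have [At' D'] := H _ td; split; first exact: (pr_cQ PR).
    have [t'E|tne] := eqVneq t' t; first by rewrite t'E gE'.
    move=> SQ; apply: (noS _ SQ); rewrite (pr_cQ PR) // normr_gt0 subr_eq0 tne /=.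
    by rewrite distrC.
  + have -> : (fun t' => Q (t', x0)) @` ball t d' = img (A `&` [set p | `|t - p.1| < d']).
      apply/seteqP; split=> [_ [t' tt' <-]|_ [[t' x'] [/= [At' tt'] D'] <-]].
        have [|At' D'] := H t'; first by move: tt'; rewrite /ball /= lt_min => /andP[].
        by exists (t', x0).
      have [|At0 D0] := H t'; first by move: tt'; rewrite lt_min => /andP[].
      by exists t' => //; apply/(pr_joined PR) => //; exact: (leg_joined lA).
    apply: img_open; first by apply: openI; [exact: leg_open|exact: level_open].
    by apply: (@saturated_level (fun u => `|t - u| < d')); exact: leg_sat.
- move=> e [g0 nSg0 eE].
  have [A LA Ag0] := cover _ nSg0; have lA := Lleg _ LA.
  have eS : e `<=` ~` S by rewrite eE; exact: connected_component_sub.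
  have eA : e `<=` img A.
    suff : e `&` img A = e by move=> <- g [].
    have ce : connected e by rewrite eE; exact: component_connected.
    apply: ce.
    - by exists g0; split => //; rewrite eE; exact: connected_component_refl.
    - by exists (img A) => //; exact: oL.
    - exists (~` \bigcup_(A' in [set A' | L A' /\ A' <> A]) img A').
        by apply: open_closedC; apply: bigcup_open => A' [LA' _]; exact: oL.
      apply/seteqP; split=> g [eg]; last first.
        move=> nog; split => //; have [A' LA' A'g] := cover _ (eS _ eg).
        have [<-//|/eqP AA'] := eqVneq A' A.
        by exfalso; apply: nog; exists A'.
      move=> Ag; split => // -[A' [LA' nA] A'g].
      have lA' := Lleg _ LA'.
      have AA' : A `&` A' = set0.
        by apply: contrapT => /eqP/set0P/(Ldisj _ _ LA LA') E; apply: nA.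
      have : (img A `&` img A') g by [].
      by rewrite img_disjoint //; exact: leg_sat.
  move=> g g'; rewrite !inE => /eA[[t x] [/= At D] <-] /eA[[t' x'] [/= At' D'] <-].
  rewrite !(pr_cQ PR) // => tt'; subst t'.
  by apply/(pr_joined PR) => //; exact: (leg_joined lA).
Qed.

End Planar.

(** * Components and ends over a valley *)

Definition side {R : realType} (xs : R) (b : bool) (x : R) : bool :=
  if b then xs < x else x < xs.

(* c2 has its negative minimum - eta at xs and humps B b i of height 1, with
   summits m b i, on both sides of xs; c1 has wells BD j of depth - mu, with
   bottoms mD j, of which only BD 0 meets the region c2 < 0. The point z b, where
   c2 leaves the valley on side b, is a critical zero of c2. *)
Record valley_shape {R : realType} (c1 c2 : R -> R) (nU : bool -> nat) (n0 : nat)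
    (xs eta mu : R) (B : bool -> nat -> set R) (m : bool -> nat -> R)
    (BD : nat -> set R) (mD : nat -> R) (z : bool -> R) : Prop := ValleyShape {
  sh_eta : 0 < eta;
  sh_mu : eta < mu;
  sh_c1 : forall x, - mu <= c1 x <= 0;
  sh_c2 : forall x, - eta <= c2 x <= 1;
  sh_up : forall b i, (i < nU b)%N ->
    [/\ open (B b i), B b i (m b i), c2 (m b i) = 1 &
        forall x, B b i x -> side xs b x /\ 0 < c2 x];
  sh_up_conv : forall b i x y w, (i < nU b)%N -> B b i x -> B b i w ->
    x <= y <= w -> Num.min (c2 x) (c2 w) <= c2 y;
  sh_up_cut : forall b i x x', (i < nU b)%N -> B b i x -> ~ B b i x' ->
    exists2 y, Num.min x x' <= y <= Num.max x x' & c2 y <= 0;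
  sh_up_cover : forall x, 0 < c2 x -> exists b i, (i < nU b)%N /\ B b i x;
  sh_up_disj : forall b i b' i' x, (i < nU b)%N -> (i' < nU b')%N ->
    B b i x -> B b' i' x -> b = b' /\ i = i';
  sh_down : forall j, (j < n0)%N ->
    [/\ open (BD j), BD j (mD j), c1 (mD j) = - mu & forall x, BD j x -> c1 x < 0];
  sh_down_conv : forall j x y w, (j < n0)%N -> BD j x -> BD j w ->
    x <= y <= w -> c1 y <= Num.max (c1 x) (c1 w);
  sh_down_cut : forall j x x', (j < n0)%N -> BD j x -> ~ BD j x' ->
    exists2 y, Num.min x x' <= y <= Num.max x x' & 0 <= c1 y;
  sh_down_cover : forall x, c1 x < 0 -> exists j, (j < n0)%N /\ BD j x;
  sh_down_disj : forall j j' x, (j < n0)%N -> (j' < n0)%N -> BD j x -> BD j' x -> j = j';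
  sh_down_pos : forall j x, (0 < j)%N -> (j < n0)%N -> BD j x -> x < xs /\ 0 <= c2 x;
  sh_n0 : (0 < n0)%N;
  sh_main : forall x, c2 x < 0 -> BD 0%N x;
  sh_peak : c2 xs = - eta;
  sh_valley : forall b x y, (if b then xs <= y <= x else x <= y <= xs) ->
    Num.min 0 (c2 y) <= c2 x;
  sh_lim : forall b t, t < 0 -> exists2 x, side xs b x & t < c2 x;
  sh_nU : (0 < nU false)%N;
  sh_none : forall b x, side xs b x -> 0 <= c2 x -> (0 < nU b)%N;
  sh_z : forall b, (0 < nU b)%N ->
    [/\ side xs b (z b), c2 (z b) = 0, derive1 c2 (z b) = 0 & BD 0%N (z b)];
  sh_acc : forall b, (0 < nU b)%N -> exists2 i, (i < nU b)%N &
    forall e, 0 < e -> exists x, [/\ B b i x, c2 x < e & derive1 c2 x = 0];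
  sh_crit : forall t0, t0 != 0 -> exists2 e, 0 < e & forall x,
    (derive1 c1 x = 0 -> 0 < `|c1 x - t0| < e -> False) /\
    (derive1 c2 x = 0 -> 0 < `|c2 x - t0| < e -> False) }.

Lemma derive1_at_global_max {R : realType} (f : R -> R) (x : R) :
  (forall y, derivable f y 1) -> (forall y, f y <= f x) -> derive1 f x = 0.
Proof.
move=> df fx; have [_] : is_derive x 1 f 0.
  apply: (@derive1_at_max _ f (x - 1) (x + 1)) => //; last by rewrite in_itv /=; apply/andP; split; lra.
  lra.
by rewrite derive1E.
Qed.

Lemma derive1_at_global_min {R : realType} (f : R -> R) (x : R) :
  (forall y, derivable f y 1) -> (forall y, f x <= f y) -> derive1 f x = 0.
Proof.
move=> df fx; have [_] : is_derive x 1 f 0.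
  apply: (@derive1_at_min _ f (x - 1) (x + 1)) => //; last by rewrite in_itv /=; apply/andP; split; lra.
  lra.
by rewrite derive1E.
Qed.

Lemma connected_pointed (T : topologicalType) (C : set T) (p : T) : C p ->
  (forall g, C g -> exists D, [/\ connected D, D `<=` C, D p & D g]) -> connected C.
Proof.
move=> Cp H.
have D g : exists D, C g -> [/\ connected D, D `<=` C, D p & D g].
  have [/H[D HD]|nC] := pselect (C g); first by exists D.
  by exists set0.
pose F g := projT1 (cid (D g)); have FP g : C g -> _ := projT2 (cid (D g)).
have -> : C = \bigcup_(g in C) F g.
  apply/seteqP; split=> [g Cg|g [h Ch]]; first by exists g => //; have [] := FP _ Cg.
  by have [_ + _ _] := FP _ Ch; apply.
apply: bigcup_connected; last by move=> g /FP[].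
by exists p => g /FP[].
Qed.

Lemma components_partition (T : topologicalType) (I : Type) (N : set T) (P : set I) (C : I -> set T) :
  (forall i, P i -> open (C i)) -> (forall i, P i -> connected (C i)) ->
  (forall i, P i -> C i !=set0) ->
  (forall i j, P i -> P j -> C i `&` C j !=set0 -> i = j) ->
  N = \bigcup_(i in P) C i -> components N = C @` P.
Proof.
move=> oC cC C0 dC NE.
have CE i g : P i -> C i g -> connected_component N g = C i.
  move=> Pi Cig; apply/seteqP; split; last first.
    by apply: connected_component_max => //; [rewrite NE => h Ch; exists i|exact: cC].
  have cc := @component_connected _ N g.
  have Ng : N g by rewrite NE; exists i.
  suff : connected_component N g `&` C i = connected_component N g by move=> <- h [].
  apply: cc.
  - by exists g; split => //; exact: connected_component_refl.
  - by exists (C i) => //; exact: oC.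
  - exists (~` \bigcup_(j in [set j | P j /\ j <> i]) C j).
      by apply: open_closedC; apply: bigcup_open => j [Pj _]; exact: oC.
    apply/seteqP; split=> h [ch].
      by move=> Cih; split => // -[j [Pj ji] Cjh]; apply: ji; apply: dC => //; exists h.
    move=> nC; split => //; have := connected_component_sub ch; rewrite NE => -[j Pj Cjh].
    have [<-//|ji] := pselect (j = i).
    by exfalso; apply: nC; exists j.
apply/seteqP; split=> [_ [g Ng ->]|_ [i Pi <-]].
  have [i Pi Cig] : (\bigcup_(i in P) C i) g by rewrite -NE.
  by exists i => //; rewrite (CE i).
have [g Cig] := C0 _ Pi; exists g; first by rewrite NE; exists i.
by rewrite (CE i).
Qed.

Section ShapeReeb.
Context {R : realType} {G : topologicalType} (c1 c2 : R -> R).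
Context (c : G -> R) (Q : R * R -> G) (S : set G).
Context (nU : bool -> nat) (n0 : nat) (xs eta mu : R).
Context (B : bool -> nat -> set R) (m : bool -> nat -> R).
Context (BD : nat -> set R) (mD : nat -> R) (z : bool -> R).
Hypothesis PR : planar_reeb c1 c2 c Q S.
Hypothesis SH : valley_shape c1 c2 nU n0 xs eta mu B m BD mD z.
Implicit Types (A : set (R * R)) (t x : R) (g : G) (b : bool) (i j : nat).
Local Notation strip := (in_strip c1 c2).
Local Notation joined := (joined c1 c2).
Local Notation side := (side xs).
Local Notation img := (img c1 c2 Q).
Local Notation sat := (saturated c1 c2).
Local Notation leg := (leg c1 c2).

(** The names in [A] are the full pieces off level 0; those in [L] are legs, obtained by deleting
    critical levels: 1 at a summit, [- mu] at a bottom. In the main well also [- eta] is deleted: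
    there the valley floor of [c2] divides the well into a stem below and one arm on each side
    above. *)
Definition upA b i : set (R * R) := [set p | 0 < p.1 /\ B b i p.2].
Definition upL b i : set (R * R) := [set p | 0 < p.1 < 1 /\ B b i p.2].
Definition downA j : set (R * R) := [set p | p.1 < 0 /\ BD j p.2].
Definition downL j : set (R * R) := [set p | - mu < p.1 < 0 /\ BD j p.2].
Definition armL b : set (R * R) := [set p | - eta < p.1 < 0 /\ (BD 0%N p.2 /\ side b p.2)].
Definition stemL : set (R * R) := [set p | - mu < p.1 < - eta /\ BD 0%N p.2].
Definition end_point b : G := Q (0, z b).

Let eta0 : 0 < eta. Proof. exact: sh_eta SH. Qed.
Let etamu : eta < mu. Proof. exact: sh_mu SH. Qed.
Let c1_le0 x : c1 x <= 0. Proof. by have /andP[] := sh_c1 SH x. Qed.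
Let c2_le1 x : c2 x <= 1. Proof. by have /andP[] := sh_c2 SH x. Qed.
Let c1_ge x : - mu <= c1 x. Proof. by have /andP[] := sh_c1 SH x. Qed.
Let c2_ge x : - eta <= c2 x. Proof. by have /andP[] := sh_c2 SH x. Qed.

Let open_rect (P : set R) (V : set R) : open P -> open V ->
  open [set p : R * R | P p.1 /\ V p.2].
Proof.
move=> oP oV; have -> : [set p : R * R | P p.1 /\ V p.2] = fst @^-1` P `&` snd @^-1` V by [].
by apply: openI; apply: open_comp => //; [move=> ? _; exact: cvg_fst|move=> ? _; exact: cvg_snd].
Qed.

Let open_itvoo (u v : R) : open [set t : R | u < t < v].
Proof.
have -> : [set t : R | u < t < v] = [set t | u < t] `&` [set t | t < v].
  by apply/seteqP; split=> t /=; [move=> /andP[]|move=> [-> ->]].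
by apply: openI; [exact: open_gt|exact: open_lt].
Qed.

Let open_side b : open [set x | side b x].
Proof. by case: b; [exact: open_gt|exact: open_lt]. Qed.

Let sat_up b i : (i < nU b)%N -> sat (upA b i).
Proof.
move=> ib t x x' D J [/= t0 Bx]; split => //=; apply: contrapT => nB.
have [y yb cy] := sh_up_cut SH ib Bx nB.
by have /andP[_ ty] := J _ yb; have := lt_le_trans t0 (le_trans ty cy); rewrite ltxx.
Qed.

Let sat_down j : (j < n0)%N -> sat (downA j).
Proof.
move=> jn t x x' D J [/= t0 Bx]; split => //=; apply: contrapT => nB.
have [y yb cy] := sh_down_cut SH jn Bx nB.
by have /andP[yt _] := J _ yb; have := le_lt_trans (le_trans cy yt) t0; rewrite ltxx.
Qed.

(** A segment crossing [xs] inside a slice forces [t <= c2 xs = - eta]. *)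
Let sat_side b t x x' : - eta < t -> joined t x x' -> side b x -> side b x'.
Proof.
move=> et J sx; apply: contraT => nsx'.
have : strip t xs.
  apply: J; move: sx nsx'; case: (b) => /=; rewrite -leNgt.
    by move=> /ltW h h'; rewrite (min_idPr (le_trans h' h)) (max_idPl (le_trans h' h)) h' h.
  by move=> /ltW h h'; rewrite (min_idPl (le_trans h h')) (max_idPr (le_trans h h')) h' h.
by move=> /andP[_]; rewrite (sh_peak SH) leNgt et.
Qed.

Let joined_up b i t x x' : (i < nU b)%N -> 0 <= t -> B b i x -> B b i x' ->
  strip t x -> strip t x' -> joined t x x'.
Proof.
move=> ib t0 Bx Bx' D D'.
apply: (@joined_wlog _ _ _ (fun x => B b i x /\ strip t x)) => // u v [Bu /andP[_ Du]] [Bv /andP[_ Dv]] uv.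
apply: joined_le => // y yb; rewrite /in_strip (le_trans (c1_le0 y)) //=.
by apply: le_trans (sh_up_conv SH ib Bu Bv yb); rewrite le_min Du.
Qed.

(** Quasiconvexity of [c1] on the well controls the lower curve. The upper curve is no obstruction
    over a secondary well, where [c2] is nonnegative, nor in the main well at or below the valley
    floor [- eta]. *)
Let joined_down j t x x' : (j < n0)%N -> (0 < j)%N || (t <= - eta) -> t <= 0 -> BD j x -> BD j x' ->
  strip t x -> strip t x' -> joined t x x'.
Proof.
move=> jn jt t0 Bx Bx' D D'.
apply: (@joined_wlog _ _ _ (fun x => BD j x /\ strip t x)) => // u v [Bu /andP[Du _]] [Bv /andP[Dv _]] uv.
apply: joined_le => // y yb; apply/andP; split.
  by apply: le_trans (sh_down_conv SH jn Bu Bv yb) _; rewrite ge_max Du.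
case/orP: jt => [j0|te]; last exact: le_trans (c2_ge y).
apply: le_trans t0 _.
have By : BD j y.
  apply: contrapT => nBy.
  have [w wb cw] := sh_down_cut SH jn Bu nBy.
  have uy : u <= y by case/andP: yb.
  have wv : u <= w <= v.
    move: wb; rewrite (min_idPl uy) (max_idPr uy) => /andP[-> wy] /=.
    by apply: le_trans wy _; case/andP: yb.
  have := sh_down_conv SH jn Bu Bv wv.
  have [_ _ _ neg] := sh_down SH jn.
  rewrite le_max !leNgt => /orP[/negP|/negP]; apply; apply: lt_le_trans cw; exact: neg.
by have [] := sh_down_pos SH j0 jn By.
Qed.

(** On one side of the valley, [c2] cannot come down below a nonpositive level once it has reached
    it. The lower curve is controlled by quasiconvexity in the main well, or by [c1 <= 0] when
    [t = 0]; the latter collapses the whole zero level on a side to one point. *)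
Let joined_arm b t x x' : t <= 0 -> side b x -> side b x' ->
  (t = 0 \/ (BD 0%N x /\ BD 0%N x')) -> strip t x -> strip t x' -> joined t x x'.
Proof.
move=> t0 sx sx' H D D'.
have {}H : t = 0 \/ (forall u, u = x \/ u = x' -> BD 0%N u).
  by case: H => [->|[h h']]; [left|right=> u [->|->]].
apply: (@joined_wlog _ _ _ (fun u => [/\ side b u, strip t u & u = x \/ u = x'])); try by split => //; [left|right].
  move=> u v [su /andP[Du1 Du2] uE] [sv /andP[Dv1 Dv2] vE] uv.
  apply: joined_le => // y yb; apply/andP; split.
    case: H => [->|H]; first exact: c1_le0.
    apply: le_trans (sh_down_conv SH (sh_n0 SH) (H _ uE) (H _ vE) yb) _.
    by rewrite ge_max Du1.
  case/andP: yb => uy yv.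
  case: (b) su sv => /= su sv.
    by have := @sh_valley _ _ _ _ _ _ _ _ _ _ _ _ _ SH true y u; rewrite (ltW su) uy => /(_ isT); apply: le_trans; rewrite le_min t0.
  by have := @sh_valley _ _ _ _ _ _ _ _ _ _ _ _ _ SH false y v; rewrite (ltW sv) yv => /(_ isT); apply: le_trans; rewrite le_min t0.
- by split => //; left.
- by split => //; right.
Qed.

(** In the valley there is a point where [c2] lies strictly between [t] and 0. If [c1] is below [t]
    there, it serves. Otherwise [c1 + c2] passes from below [2 t] at [xs] to above it, and where it
    equals [2 t] the level [t] is midway between the two curves. *)
Let arm_inner b t : - eta <= t < 0 -> exists x, [/\ side b x, BD 0%N x & c1 x < t < c2 x].
Proof.
move=> /andP[et t0].
have [x sx cx] := sh_lim SH b t0.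
pose f y := c1 y + c2 y.
have [c1c c2c] := (pr_c1 PR, pr_c2 PR).
have t2 : t / 2 < 0 by rewrite ltr_pdivrMr // mul0r.
have tt2 : t < t / 2 by lra.
(* a point of the valley at which c2 lies in (t, 0) *)
have [x' [sx' tx' x'0]] : exists x', [/\ side b x', t < c2 x' & c2 x' < 0].
  have [c20|c20] := ltP (c2 x) 0; first by exists x.
  have cs : continuous c2 by [].
  have sxs : c2 xs <= t / 2 <= c2 x by rewrite (sh_peak SH); apply/andP; split; lra.
  have [y yb yE] : exists2 y, Num.min xs x <= y <= Num.max xs x & c2 y = t / 2.
    have [xx|xx] := leP xs x.
      have h : Num.min (c2 xs) (c2 x) <= t / 2 <= Num.max (c2 xs) (c2 x).
        by case/andP: sxs => h1 h2; rewrite ge_min h1 le_max h2 orbT.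
      by have [y] := IVT xx (continuous_subspaceT cs) h; rewrite in_itv /= => yb yE; exists y.
    have h : Num.min (c2 x) (c2 xs) <= t / 2 <= Num.max (c2 x) (c2 xs).
      by case/andP: sxs => h1 h2; rewrite ge_min h1 orbT le_max h2.
    by have [y] := IVT (ltW xx) (continuous_subspaceT cs) h; rewrite in_itv /= => yb yE; exists y.
  exists y; split; rewrite ?yE //.
  have yxs : y != xs by apply/eqP => E; move: yE; rewrite E (sh_peak SH); lra.
  move: sx yb; case: (b) => /= sx.
    by rewrite (min_idPl (ltW sx)) => /andP[h _]; rewrite lt_neqAle eq_sym yxs.
  by rewrite (max_idPl (ltW sx)) => /andP[_ h]; rewrite lt_neqAle yxs.
have fxs : f xs < 2 * t.
  by rewrite /f (sh_peak SH); have := pr_lt PR xs; rewrite (sh_peak SH); lra.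
have [c1t|c1t] := ltP (c1 x') t.
  by exists x'; split=> //; [exact: (sh_main SH x'0)|rewrite c1t tx'].
have fx' : 2 * t < f x' by rewrite /f; lra.
have cf : continuous f by move=> y; apply: cvgD; [exact: c1c|exact: c2c].
have [y yb yE] : exists2 y, Num.min xs x' <= y <= Num.max xs x' & f y = 2 * t.
  have [xx|xx] := leP xs x'.
    have h : Num.min (f xs) (f x') <= 2 * t <= Num.max (f xs) (f x').
      by rewrite ge_min (ltW fxs) le_max (ltW fx') orbT.
    by have [y] := IVT xx (continuous_subspaceT cf) h; rewrite in_itv /= => yb yE; exists y.
  have h : Num.min (f x') (f xs) <= 2 * t <= Num.max (f x') (f xs).
    by rewrite ge_min (ltW fxs) orbT le_max (ltW fx').
  by have [y] := IVT (ltW xx) (continuous_subspaceT cf) h; rewrite in_itv /= => yb yE; exists y.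
have lty := pr_lt PR y.
have yxs : y != xs by apply/eqP => E; move: yE fxs; rewrite E; lra.
have [sy c2y] : side b y /\ c2 y < 0.
  move: sx' yb; case: (b) => /= sx'.
    rewrite (min_idPl (ltW sx')) (max_idPr (ltW sx')) => /andP[h h']; split.
      by rewrite lt_neqAle eq_sym yxs.
    have := @sh_valley _ _ _ _ _ _ _ _ _ _ _ _ _ SH true x' y; rewrite h h' => /(_ isT).
    by rewrite ge_min => /orP[h0|]; [have := le_lt_trans h0 x'0; rewrite ltxx|move=> h0; exact: le_lt_trans h0 x'0].
  rewrite (min_idPr (ltW sx')) (max_idPl (ltW sx')) => /andP[h h']; split.
    by rewrite lt_neqAle yxs.
  have := @sh_valley _ _ _ _ _ _ _ _ _ _ _ _ _ SH false x' y; rewrite h h' => /(_ isT).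
  by rewrite ge_min => /orP[h0|]; [have := le_lt_trans h0 x'0; rewrite ltxx|move=> h0; exact: le_lt_trans h0 x'0].
exists y; split=> //; first exact: (sh_main SH c2y).
by move: yE; rewrite /f => yE; apply/andP; split; lra.
Qed.

Let leg_up b i : (i < nU b)%N -> leg (upL b i).
Proof.
move=> ib; have [oB Bm cm _] := sh_up SH ib; split.
- by apply: (@open_rect [set t | 0 < t < 1] (B b i)) => //; exact: open_itvoo.
- move=> t x x' D J [/= /andP[t0 t1] Bx]; split; first by rewrite /= t0.
  by have [] := sat_up ib D J (conj t0 Bx).
- by move=> t x x' [/= /andP[/ltW t0 _] Bx] [/= _ Bx']; apply: (joined_up ib).
- move=> t x [/= /andP[t0 t1] Bx] D; exists (m b i); split; first by split; rewrite /= ?t0.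
  by rewrite cm t1 (le_lt_trans (c1_le0 _)).
Qed.

Let leg_down j : (0 < j)%N -> (j < n0)%N -> leg (downL j).
Proof.
move=> j0 jn; have [oB Bm cm _] := sh_down SH jn; split.
- by apply: (@open_rect [set t | - mu < t < 0] (BD j)) => //; exact: open_itvoo.
- move=> t x x' D J [/= /andP[t0 t1] Bx]; split; first by rewrite /= t0.
  by have [] := sat_down jn D J (conj t1 Bx).
- by move=> t x x' [/= /andP[_ /ltW t0] Bx] [/= _ Bx']; apply: (joined_down (j := j)); rewrite ?j0.
- move=> t x [/= /andP[t0 t1] Bx] D; exists (mD j); split; first by split; rewrite /= ?t0.
  by rewrite cm t0 (lt_le_trans t1) //; have [] := sh_down_pos SH j0 jn Bm.
Qed.

Let leg_arm b : leg (armL b).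
Proof.
have [oB _ _ _] := sh_down SH (sh_n0 SH); split.
- apply: (@open_rect [set t | - eta < t < 0] [set x | BD 0%N x /\ side b x]) => //.
  by apply: openI => //; exact: open_side.
- move=> t x x' D J [/= /andP[t0 t1] [Bx sx]]; split; first by rewrite /= t0.
  by split; [have [] := sat_down (sh_n0 SH) D J (conj t1 Bx)|exact: sat_side J sx].
- move=> t x x' [/= /andP[_ /ltW t0] [Bx sx]] [/= _ [Bx' sx']].
  by apply: (joined_arm (b := b)) => //; right.
- move=> t x [/= /andP[t0 t1] _] D.
  have [|y [sy By yE]] := @arm_inner b t; first by rewrite (ltW t0).
  by exists y; split => //; split; rewrite /= ?t0.
Qed.

Let leg_stem : leg stemL.
Proof.
have [oB Bm cm _] := sh_down SH (sh_n0 SH); split.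
- by apply: (@open_rect [set t | - mu < t < - eta] (BD 0%N)) => //; exact: open_itvoo.
- move=> t x x' D J [/= /andP[t0 t1] Bx]; split; first by rewrite /= t0.
  have t1' : t < 0 by apply: lt_trans t1 _; rewrite oppr_lt0.
  by have [] := sat_down (sh_n0 SH) D J (conj t1' Bx).
- move=> t x x' [/= /andP[_ t0] Bx] [/= _ Bx']; apply: (joined_down (j := 0%N)) => //.
    exact: sh_n0 SH.
    by rewrite (ltW t0).
  by apply: ltW; apply: lt_trans t0 _; rewrite oppr_lt0.
- move=> t x [/= /andP[t0 t1] Bx] D; exists (mD 0%N); split; first by split; rewrite /= ?t0.
  by rewrite cm t0 (lt_le_trans t1).
Qed.

Let pole_tip_up b i : (i < nU b)%N -> S (Q (1, m b i)).
Proof.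
move=> ib; have [_ _ cm _] := sh_up SH ib.
have D : strip 1 (m b i) by rewrite /in_strip cm lexx (le_trans (c1_le0 _)).
apply/(pr_S PR) => //; exists (m b i); split; first exact: joined_refl.
right; split => //; apply: derive1_at_global_max; first exact: pr_d2 PR.
by rewrite cm.
Qed.

Let pole_tip_down j : (j < n0)%N -> S (Q (- mu, mD j)).
Proof.
move=> jn; have [_ _ cm _] := sh_down SH jn.
have D : strip (- mu) (mD j) by rewrite /in_strip cm lexx -cm (ltW (pr_lt PR _)).
apply/(pr_S PR) => //; exists (mD j); split; first exact: joined_refl.
left; split => //; apply: derive1_at_global_min; first exact: pr_d1 PR.
by rewrite cm.
Qed.

Let strip_peak : strip (- eta) xs.
Proof. by rewrite /in_strip (sh_peak SH) lexx -(sh_peak SH) (ltW (pr_lt PR _)). Qed.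

Let main_peak : BD 0%N xs.
Proof. by apply: (sh_main SH); rewrite (sh_peak SH) oppr_lt0. Qed.

Let pole_peak : S (Q (- eta, xs)).
Proof.
apply/(pr_S PR); first exact: strip_peak.
exists xs; split; first exact: joined_refl strip_peak.
right; split; first by rewrite (sh_peak SH).
apply: derive1_at_global_min; first exact: pr_d2 PR.
by move=> y; rewrite (sh_peak SH).
Qed.

Let strip_end b : (0 < nU b)%N -> strip 0 (z b).
Proof. by move=> /(sh_z SH)[_ h _ _]; rewrite /in_strip h lexx andbT. Qed.

Let pole_end b : (0 < nU b)%N -> S (end_point b).
Proof.
move=> nb; have [_ cz dz _] := sh_z SH nb; have D := strip_end nb.
apply/(pr_S PR) => //; exists (z b); split; first exact: joined_refl.
by right.
Qed.

Let level0 x : strip 0 x -> exists b, (0 < nU b)%N /\ Q (0, x) = end_point b.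
Proof.
move=> D; have c20 : 0 <= c2 x by case/andP: D.
have xxs : x != xs by apply/eqP => E; move: c20; rewrite E (sh_peak SH) oppr_ge0 leNgt eta0.
have [b sx] : exists b, side b x.
  by move: xxs; rewrite neq_lt => /orP[h|h]; [exists false|exists true].
have nb := sh_none SH sx c20; exists b; split => //.
have [sz _ _ _] := sh_z SH nb.
apply/(pr_joined PR) => //; first exact: strip_end.
by apply: (joined_arm (b := b)) => //; [left|exact: strip_end].
Qed.

(** Every point of the Reeb space is an end on level 0, lies in a leg, or is one of finitely many
    exceptional points: summits, bottoms and the fork over the valley floor. *)
Let special t x : strip t x ->
  [\/ exists b, (0 < nU b)%N /\ Q (t, x) = end_point b,
      exists b i, [/\ (i < nU b)%N, upL b i (t, x) \/ t = 1 & B b i x],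
      exists j, [/\ (0 < j)%N, (j < n0)%N, BD j x & downL j (t, x) \/ t = - mu]
    | [/\ t < 0, BD 0%N x & [\/ exists b, armL b (t, x), t = - eta, stemL (t, x) | t = - mu]]].
Proof.
move=> D; have /andP[D1 D2] := D; have [t0|t0|t0] := ltrgtP t 0.
- have [j [jn Bx]] := sh_down_cover SH (le_lt_trans D1 t0).
  have mut : - mu <= t := le_trans (c1_ge x) D1.
  have mut' : t = - mu \/ - mu < t by move: mut; rewrite le_eqVlt => /predU1P[->|]; [left|right].
  have [j0|j0] := posnP j; last first.
    apply: Or43; exists j; split => //; case: mut' => h; [by right|left].
    by split; rewrite /= ?h.
  subst j; apply: Or44; split => //.
  have [te|te|te] := ltrgtP t (- eta).
  + by case: mut' => h; [apply: Or44|apply: Or43; split; rewrite /= ?h].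
  + apply: Or41; have xxs : x != xs by apply/eqP => E; move: D2; rewrite E (sh_peak SH) leNgt te.
    move: xxs; rewrite neq_lt => /orP[h|h]; [exists false|exists true].
      by split; rewrite /= ?te.
    by split; rewrite /= ?te.
  + by apply: Or42.
- have [b [i [ib Bx]]] := sh_up_cover SH (lt_le_trans t0 D2).
  apply: Or42; exists b, i; split => //.
  have : t <= 1 := le_trans D2 (c2_le1 x).
  by rewrite le_eqVlt => /predU1P[->|t1]; [right|left; split; rewrite /= ?t0].
- by apply: Or41; move: D; rewrite t0; exact: level0.
Qed.

Let tip_up b i x : (i < nU b)%N -> B b i x -> strip 1 x -> Q (1, x) = Q (1, m b i).
Proof.
move=> ib Bx D; have [_ Bm cm _] := sh_up SH ib.
have Dm : strip 1 (m b i) by rewrite /in_strip cm lexx (le_trans (c1_le0 _)).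
by apply/(pr_joined PR) => //; exact: (joined_up ib).
Qed.

Let mu_eta : - mu < - eta. Proof. by rewrite ltrN2. Qed.
Let eta_lt0 : - eta < 0. Proof. by rewrite oppr_lt0. Qed.
Let mu_lt0 : - mu < 0. Proof. exact: lt_trans mu_eta eta_lt0. Qed.

Let tip_down j x : (j < n0)%N -> BD j x -> strip (- mu) x -> Q (- mu, x) = Q (- mu, mD j).
Proof.
move=> jn Bx D; have [_ Bm cm _] := sh_down SH jn.
have Dm : strip (- mu) (mD j) by rewrite /in_strip cm lexx -cm (ltW (pr_lt PR _)).
apply/(pr_joined PR) => //; apply: (joined_down jn) => //; last exact: ltW.
by rewrite (ltW mu_eta) orbT.
Qed.

Let fork x : BD 0%N x -> strip (- eta) x -> Q (- eta, x) = Q (- eta, xs).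
Proof.
move=> Bx D; apply/(pr_joined PR) => //.
apply: (joined_down (sh_n0 SH)) => //; [by rewrite lexx orbT|exact: ltW].
Qed.

Let Sdisc t0 : t0 != 0 ->
  exists2 e, 0 < e & forall g, S g -> 0 < `|c g - t0| < e -> False.
Proof.
move=> t00; have [e e0 H] := sh_crit SH t00; exists e => // g.
have [t [x [D ->]]] := pr_surj PR g; rewrite (pr_cQ PR) //.
move=> /(pr_S PR D)[x' [J [[tE dE]|[tE dE]]]] tt.
  by have [+ _] := H x'; apply; rewrite -?tE.
by have [_ +] := H x'; apply; rewrite -?tE.
Qed.

Definition legs : set (set (R * R)) :=
  [set A | [\/ exists b i, (i < nU b)%N /\ A = upL b i,
               exists j, [/\ (0 < j)%N, (j < n0)%N & A = downL j],
               exists b, A = armL b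
             | A = stemL]].

Lemma shape_pre_digraph : pre_digraph S c.
Proof.
apply: (@planar_pre_digraph _ _ _ _ _ _ _ PR legs (1 + mu)).
- move=> x; split.
    by apply: le_trans (c1_ge x); rewrite lerN2 lerDr ler01.
  apply: le_trans (c2_le1 x) _; rewrite lerDl ltW //; exact: lt_trans eta0 etamu.
- move=> A [[b [i [ib ->]]]|[j [j0 jn ->]]|[b ->]|->].
  + exact: leg_up.
  + exact: leg_down.
  + exact: leg_arm.
  + exact: leg_stem.
- have nolt (t u v : R) : v <= u -> u < t -> t < v -> False.
    by move=> vu ut tv; have := lt_trans ut (lt_le_trans tv vu); rewrite ltxx.
  move=> A A' [[b [i [ib ->]]]|[j [j0 jn ->]]|[b ->]|->]
    [[b' [i' [ib' ->]]]|[j' [j'0 j'n ->]]|[b' ->]|->] [[t x]] [/= [/andP[h1 h2] h3] [/andP[h4 h5] h6]].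
  + by have [-> ->] := sh_up_disj SH ib ib' h3 h6.
  + by exfalso; apply: (nolt t 0 0).
  + by exfalso; apply: (nolt t 0 0).
  + by exfalso; apply: (nolt t 0 (- eta)) => //; exact: ltW.
  + by exfalso; apply: (nolt t 0 0).
  + by rewrite (sh_down_disj SH jn j'n h3 h6).
  + by case: h6 => h6 _; move: j0; rewrite (sh_down_disj SH jn (sh_n0 SH) h3 h6).
  + by move: j0; rewrite (sh_down_disj SH jn (sh_n0 SH) h3 h6).
  + by exfalso; apply: (nolt t 0 0).
  + by case: h3 => h3 _; move: j'0; rewrite (sh_down_disj SH j'n (sh_n0 SH) h6 h3).
  + case: h3 => _; case: h6 => _; case: (b); case: (b') => //= u v; exfalso.
      exact: (nolt x xs xs).
    exact: (nolt x xs xs).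
  + by exfalso; apply: (nolt t (- eta) (- eta)).
  + by exfalso; apply: (nolt t 0 (- eta)) => //; exact: ltW.
  + by move: j'0; rewrite (sh_down_disj SH j'n (sh_n0 SH) h6 h3).
  + by exfalso; apply: (nolt t (- eta) (- eta)).
  + by [].
- move=> A t x [[b [i [ib ->]]]|[j [j0 jn ->]]|[b ->]|->] [/= /andP[h1 h2] _].
  + by rewrite gt_eqF.
  + by rewrite lt_eqF.
  + by rewrite lt_eqF.
  + by rewrite lt_eqF // (lt_trans h2).
- exact: Sdisc.
- move=> g nS; have [t [x [D gE]]] := pr_surj PR g; rewrite gE in nS *.
  case: (special D) => [[b [nb E]]|[b [i [ib [H|H] Bx]]]|[j [j0 jn Bx [H|H]]]|[t0 Bx H]].
  + by exfalso; apply: nS; rewrite E; exact: pole_end.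
  + by exists (upL b i); [apply: Or41; exists b, i|exists (t, x)].
  + by exfalso; apply: nS; rewrite H (tip_up ib) -?H //; rewrite H; exact: pole_tip_up.
  + by exists (downL j); [apply: Or42; exists j|exists (t, x)].
  + by exfalso; apply: nS; rewrite H (tip_down jn) -?H //; rewrite H; exact: pole_tip_down.
  + case: H => [[b H]|H|H|H].
    * by exists (armL b); [apply: Or43; exists b|exists (t, x)].
    * by exfalso; apply: nS; rewrite H fork -?H //; rewrite H; exact: pole_peak.
    * by exists stemL; [apply: Or44|exists (t, x)].
    * by exfalso; apply: nS; rewrite H (tip_down (sh_n0 SH)) -?H //; rewrite H; exact: pole_tip_down (sh_n0 SH).
Qed.

Let tip_up_not_NF b i : (i < nU b)%N -> ~ NF R S (Q (1, m b i)).
Proof.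
move=> ib; have [oB Bm cm _] := sh_up SH ib.
have [e e0 noS] := Sdisc (oner_neq0 R).
(* Below [e] no other critical level is met; below 1 the arm stays above level 0, inside the
   hump. *)
pose d := Num.min e 1 / 2.
have [d0 de d1] : [/\ 0 < d, d < e & d < 1].
  have : 0 < Num.min e 1 by rewrite lt_min e0 ltr01.
  have : Num.min e 1 <= e by rewrite ge_min lexx.
  have : Num.min e 1 <= 1 by rewrite ge_min lexx orbT.
  by rewrite /d; split; lra.
have strip_m t : 0 <= t <= 1 -> strip t (m b i).
  by move=> /andP[t0 t1]; rewrite /in_strip cm t1 (le_trans (c1_le0 _)).
have D1 : strip 1 (m b i) by apply: strip_m; rewrite ler01 lexx.
apply: (@planar_star _ _ _ _ _ _ _ PR 1 (m b i) (upA b i) unit (fun=> m b i) (fun=> -1) d tt) => //.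
- by apply: (@open_rect [set t | 0 < t] (B b i)) => //; exact: open_gt.
- exact: sat_up.
- by right.
- by move=> _ r /andP[r0 r1]; apply: strip_m; apply/andP; split; nra.
- by move=> _; exact: joined_refl.
- move=> t x [/= t0 Bx] D td.
  have t1 : t <= 1 by case/andP: D => _ h; exact: le_trans h (c2_le1 x).
  exists tt, ((1 - t) / d); split.
  + apply/andP; split; first by rewrite divr_ge0 ?subr_ge0 // ltW.
    by rewrite ler_pdivrMr // mul1r ltW // (le_lt_trans (ler_norm _) td).
  + by rewrite mulN1r mulrN divfK ?gt_eqF //; lra.
  + by apply: (joined_up ib) => //; [exact: ltW|apply: strip_m; rewrite (ltW t0)].
- by move=> [] [].
- by move=> g Sg /andP[h1 h2]; apply: (noS _ Sg); rewrite h1 (le_lt_trans h2).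
Qed.

Let tip_down_not_NF j : (j < n0)%N -> ~ NF R S (Q (- mu, mD j)).
Proof.
move=> jn; have [oB Bm cm _] := sh_down SH jn.
have [|e e0 noS] := @Sdisc (- mu); first by rewrite lt_eqF.
(* The bound [mu - eta] keeps the arm below the valley floor, where a level of any well is a single
   point. *)
pose d := Num.min e (mu - eta) / 2.
have me : 0 < mu - eta by rewrite subr_gt0.
have [d0 de d1] : [/\ 0 < d, d < e & d < mu - eta].
  have : 0 < Num.min e (mu - eta) by rewrite lt_min e0.
  have : Num.min e (mu - eta) <= e by rewrite ge_min lexx.
  have : Num.min e (mu - eta) <= mu - eta by rewrite ge_min lexx orbT.
  by rewrite /d; split; lra.
have strip_m t : - mu <= t <= - mu + d -> strip t (mD j).
  move=> /andP[t0 t1]; rewrite /in_strip cm t0 /=; apply: le_trans (c2_ge _); lra.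
have D1 : strip (- mu) (mD j) by apply: strip_m; rewrite lexx lerDl ltW.
apply: (@planar_star _ _ _ _ _ _ _ PR (- mu) (mD j) (downA j) unit (fun=> mD j) (fun=> 1) d tt) => //.
- by apply: (@open_rect [set t | t < 0] (BD j)) => //; exact: open_lt.
- exact: sat_down.
- by left.
- by move=> _ r /andP[r0 r1]; apply: strip_m; apply/andP; split; nra.
- by move=> _; exact: joined_refl.
- move=> t x [/= t0 Bx] D td.
  have t1 : - mu <= t by case/andP: D => h _; exact: le_trans (c1_ge x) h.
  have td' : t + mu < d by move: td; rewrite distrC ger0_norm ?subr_ge0 // opprK.
  exists tt, ((t + mu) / d); split.
  + apply/andP; split; first by rewrite divr_ge0 ?(ltW d0) //; lra.
    by rewrite ler_pdivrMr // mul1r ltW.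
  + by rewrite mul1r divfK ?gt_eqF //; lra.
  + apply: (joined_down jn) => //; last 2 first.
    * exact: ltW.
    * by apply: strip_m; rewrite t1; lra.
    by apply/orP; right; lra.
- by move=> [] [].
- by move=> g Sg /andP[h1 h2]; apply: (noS _ Sg); rewrite h1 (le_lt_trans h2).
Qed.

(** A star with three arms: [None] goes down over [xs], and [Some b] goes up over an abscissa on
    side [b] that is interior to the strip at level [- eta]. The two upper arms differ because no
    slice above [- eta] crosses [xs]. *)
Let fork_not_NF : ~ NF R S (Q (- eta, xs)).
Proof.
have [oB _ _ _] := sh_down SH (sh_n0 SH).
have [|e e0 noS] := @Sdisc (- eta); first by rewrite lt_eqF.
have inner b : exists x, [/\ side b x, BD 0%N x & c1 x < - eta < c2 x].
  by apply: arm_inner; rewrite lexx eta_lt0.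
pose X b := projT1 (cid (inner b)).
have XP b : [/\ side b (X b), BD 0%N (X b) & c1 (X b) < - eta < c2 (X b)] := projT2 (cid (inner b)).
have c1xs : 0 < - eta - c1 xs by rewrite subr_gt0 -(sh_peak SH); exact: pr_lt PR xs.
have Xgap b : 0 < c2 (X b) + eta by have [_ _ /andP[_ h]] := XP b; lra.
pose mn := Num.min (Num.min e eta) (Num.min (- eta - c1 xs) (Num.min (c2 (X true) + eta) (c2 (X false) + eta))).
pose d := mn / 2.
have [d0 [de deta dc [dt df]]] : 0 < d /\ [/\ d < e, d < eta, d < - eta - c1 xs &
    d < c2 (X true) + eta /\ d < c2 (X false) + eta].
  have mn0 : 0 < mn by rewrite !lt_min e0 eta0 c1xs !Xgap.
  have h1 : mn <= e by rewrite !ge_min lexx.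
  have h2 : mn <= eta by rewrite !ge_min lexx !orbT.
  have h3 : mn <= - eta - c1 xs by rewrite !ge_min lexx !orbT.
  have h4 : mn <= c2 (X true) + eta by rewrite !ge_min lexx !orbT.
  have h5 : mn <= c2 (X false) + eta by rewrite !ge_min lexx !orbT.
  by rewrite /d; split; [lra|split; try lra; split; lra].
have dX b : d < c2 (X b) + eta by case: b.
pose x_ (k : option bool) := if k is Some b then X b else xs.
pose sg (k : option bool) : R := if k is Some b then 1 else -1.
have B_ k : BD 0%N (x_ k) by case: k => [b|]; [have [] := XP b|exact: main_peak].
have stripX b t : - eta <= t <= - eta + d -> strip t (X b).
  move=> /andP[t0 t1]; have [_ _ /andP[h1 h2]] := XP b; have := dX b => h.
  by rewrite /in_strip; apply/andP; split; lra.
have stripxs t : - eta - d <= t <= - eta -> strip t xs.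
  by move=> /andP[t0 t1]; rewrite /in_strip (sh_peak SH) t1 andbT; lra.
apply: (@planar_star _ _ _ _ _ _ _ PR (- eta) xs (downA 0) (option bool) x_ sg d None) => //.
- by apply: (@open_rect [set t | t < 0] (BD 0%N)) => //; exact: open_lt.
- exact: sat_down (sh_n0 SH).
- by case=> [b|]; [left|right].
- case=> [b|] r /andP[r0 r1] /=; [apply: stripX|apply: stripxs]; apply/andP; split; nra.
- case=> [b|] /=; last exact: joined_refl.
  apply: (joined_down (sh_n0 SH)) => //; [by rewrite lexx orbT|exact: ltW|by have [] := XP b|].
  by apply: stripX; rewrite lexx lerDl ltW.
- move=> t x [/= t0 Bx] D td.
  move: td; rewrite ltr_norml => /andP[td1 td2].
  have [te|te] := leP t (- eta).
    exists None, ((- eta - t) / d); split => /=.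
    + apply/andP; split; first by rewrite divr_ge0 ?(ltW d0) // subr_ge0.
      by rewrite ler_pdivrMr // mul1r ltW.
    + by rewrite mulN1r mulrN divfK ?gt_eqF //; lra.
    + apply: (joined_down (sh_n0 SH)) => //; [exact: ltW|apply: stripxs].
      by apply/andP; split; lra.
  have xxs : x != xs by apply/eqP => E; case/andP: D => _; rewrite E (sh_peak SH) leNgt te.
  have [b sx] : exists b, side b x.
    by move: xxs; rewrite neq_lt => /orP[h|h]; [exists false|exists true].
  have DX : strip t (X b) by apply: stripX; apply/andP; split; lra.
  exists (Some b), ((t + eta) / d); split => /=.
  + apply/andP; split; first by rewrite divr_ge0 ?(ltW d0) //; lra.
    by rewrite ler_pdivrMr // mul1r; lra.
  + by rewrite mul1r divfK ?gt_eqF //; lra.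
  + have [sX BX _] := XP b.
    by apply: (joined_arm (b := b)) => //; [exact: ltW|right].
- have N1 : (1 : R) <> -1 by move=> E; have : (0 : R) < 0; [lra|rewrite ltxx].
  case=> [b|] [b'|] r /andP[r0 r1] /= sE J; rewrite ?sE //.
  + congr Some; have [sX _ _] := XP b; have [sX' _ _] := XP b'.
    have et : - eta < - eta + r * (1 * d) by rewrite ltrDl mul1r mulr_gt0.
    have := sat_side et J sX; move: sX sX'; case: (b); case: (b') => //= h1 h2 h3.
      by have := lt_trans h2 h3; rewrite ltxx.
    by have := lt_trans h2 h3; rewrite ltxx.
  + by case: N1; rewrite sE.
- by move=> g Sg /andP[h1 h2]; apply: (noS _ Sg); rewrite h1 (le_lt_trans h2).
Qed.

Let NF_end g : NF R S g -> exists2 b, (0 < nU b)%N & g = end_point b.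
Proof.
have [t [x [D ->]]] := pr_surj PR g => N.
case: (special D) => [[b [nb E]]|[b [i [ib [H|H] Bx]]]|[j [j0 jn Bx [H|H]]]|[t0 Bx H]].
- by exists b.
- exfalso; apply: (leg_not_NF PR (leg_up ib) H D) N; apply: Sdisc.
  by case: H => /= /andP[h _] _; rewrite gt_eqF.
- by exfalso; move: N D; rewrite H => N D; apply: (tip_up_not_NF ib); rewrite -(tip_up ib Bx D).
- exfalso; apply: (leg_not_NF PR (leg_down j0 jn) H D) N; apply: Sdisc.
  by case: H => /= /andP[_ h] _; rewrite lt_eqF.
- by exfalso; move: N D; rewrite H => N D; apply: (tip_down_not_NF jn); rewrite -(tip_down jn Bx D).
- have tn : t != 0 by rewrite lt_eqF.
  exfalso; case: H => [[b H]|H|H|H].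
  + by apply: (leg_not_NF PR (leg_arm b) H D) N; exact: Sdisc.
  + by move: N D; rewrite H => N D; apply: fork_not_NF; rewrite -(fork Bx D).
  + by apply: (leg_not_NF PR leg_stem H D) N; exact: Sdisc.
  + by move: N D; rewrite H => N D; apply: (tip_down_not_NF (sh_n0 SH)); rewrite -(tip_down (sh_n0 SH) Bx D).
Qed.

Let c_end b : (0 < nU b)%N -> c (end_point b) = 0.
Proof. by move=> nb; rewrite (pr_cQ PR) //; exact: strip_end. Qed.

Let end_up b i : (i < nU b)%N -> Q (0, m b i) = end_point b.
Proof.
move=> ib; have nb : (0 < nU b)%N by exact: leq_ltn_trans (leq0n _) ib.
have [_ Bm cm sB] := sh_up SH ib; have [sm _] := sB _ Bm; have [sz _ _ _] := sh_z SH nb.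
have D : strip 0 (m b i) by rewrite /in_strip cm c1_le0 ler01.
apply/(pr_joined PR) => //; first exact: strip_end.
by apply: (joined_arm (b := b)) => //; [left|exact: strip_end].
Qed.

(** The critical points of [c2] with small values in one hump are joined, on their own levels, to
    the vertical line through the summit. That line descends to the end, so critical points of the
    Reeb space accumulate there. *)
Let end_NF b : (0 < nU b)%N -> NF R S (end_point b).
Proof.
move=> nb [V [Vs VS _]].
have [i ib acc] := sh_acc SH nb; have [_ Bm cm sB] := sh_up SH ib.
have Vm : \forall t \near (0 : R), V (Q (t, m b i)).
  by apply: (Q_continuous_fst PR); rewrite end_up.
have /nbhs_ballP[d /= d0 dV] := Vm.
have [x [Bx xd dx]] := acc _ d0; have [_ x0] := sB _ Bx.
have cxm : c2 x <= c2 (m b i) by rewrite cm.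
have Dx : strip (c2 x) x by rewrite /in_strip lexx (ltW (pr_lt PR _)).
have Dm : strip (c2 x) (m b i) by rewrite /in_strip cxm (le_trans (c1_le0 _)) // ltW.
have E : Q (c2 x, x) = Q (c2 x, m b i).
  by apply/(pr_joined PR) => //; apply: (joined_up ib) => //; exact: ltW.
have : (V `&` (S `\ end_point b)) (Q (c2 x, m b i)).
  split; first by apply: dV; rewrite /ball /= sub0r normrN gtr0_norm.
  split; first by rewrite -E; apply/(pr_S PR Dx); exists x; split; [exact: joined_refl|right].
  by move=> /(congr1 c); rewrite c_end // (pr_cQ PR) // => /eqP; rewrite gt_eqF.
by rewrite VS.
Qed.

Lemma NF_shapeE : NF R S = [set g | exists2 b, (0 < nU b)%N & g = end_point b].
Proof. by apply/seteqP; split=> [g /NF_end|g [b nb ->]]; [|exact: end_NF]. Qed.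

(** A saturated neighbourhood of the end on side [b], disjoint from everything on the other side; it
    tells the two ends apart and keeps the humps of one side away from the other end. *)
Let side_slice b : set (R * R) := [set p | - eta < p.1 /\ side b p.2].

Let side_sliceP b : open (img (side_slice b)) /\ sat (side_slice b).
Proof.
have sS : sat (side_slice b).
  by move=> t x x' D J [/= et sx]; split => //=; exact: sat_side J sx.
split=> //; apply: (img_open PR) => //.
by apply: (@open_rect [set t | - eta < t] [set x | side b x]); [exact: open_gt|exact: open_side].
Qed.

Let end_slice b : (0 < nU b)%N -> img (side_slice b) (end_point b).
Proof.
move=> nb; have [sz _ _ _] := sh_z SH nb; exists (0, z b) => //.
by split; [split => //=|exact: strip_end].
Qed.

Let side_excl b x : side b x -> side (~~ b) x -> False.
Proof. by case: b => /= h h'; have := lt_trans h h'; rewrite ltxx. Qed.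

Lemma end_point_inj b b' : (0 < nU b)%N -> (0 < nU b')%N ->
  end_point b = end_point b' -> b = b'.
Proof.
move=> nb nb' E; apply/eqP; apply: contraT => bb'.
have b'E : b' = ~~ b by move: bb'; case: (b); case: (b').
have [_ sS] := side_sliceP b; have := end_slice nb; rewrite E => /(imgP PR sS (strip_end nb'))[_ /= h].
by have [sz _ _ _] := sh_z SH nb'; exfalso; apply: (@side_excl b (z b')); rewrite // -b'E.
Qed.

Definition pieces : set ((bool * nat) + nat) :=
  [set k | match k with inl (b, i) => (i < nU b)%N | inr j => (j < n0)%N end].

Definition piece (k : (bool * nat) + nat) : set G :=
  match k with inl (b, i) => img (upA b i) | inr j => img (downA j) end.

Let c_up b i g : img (upA b i) g -> 0 < c g.
Proof. by move=> [[t x] [/= [t0 _] D] <-]; rewrite (pr_cQ PR). Qed.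

Let c_down j g : img (downA j) g -> c g < 0.
Proof. by move=> [[t x] [/= [t0 _] D] <-]; rewrite (pr_cQ PR). Qed.

Let open_piece k : pieces k -> open (piece k).
Proof.
case: k => [[b i]|j] /= h; apply: (img_open PR).
- have [oB _ _ _] := sh_up SH h.
  by apply: (@open_rect [set t | 0 < t] (B b i)) => //; exact: open_gt.
- exact: sat_up.
- have [oB _ _ _] := sh_down SH h.
  by apply: (@open_rect [set t | t < 0] (BD j)) => //; exact: open_lt.
- exact: sat_down.
Qed.

Let strip_up_m b i t : (i < nU b)%N -> 0 <= t <= 1 -> strip t (m b i).
Proof.
by move=> /(sh_up SH)[_ _ cm _] /andP[t0 t1]; rewrite /in_strip cm t1 (le_trans (c1_le0 _)).
Qed.

Let up_point b i t : (i < nU b)%N -> 0 < t <= 1 -> piece (inl (b, i)) (Q (t, m b i)).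
Proof.
move=> ib /andP[t0 t1]; have [_ Bm _ _] := sh_up SH ib.
by exists (t, m b i) => //; split; [split|apply: strip_up_m; rewrite ?(ltW t0)].
Qed.

Let down_tip j : (j < n0)%N -> piece (inr j) (Q (- mu, mD j)).
Proof.
move=> jn; have [_ Bm cm _] := sh_down SH jn; exists (- mu, mD j) => //; split; first by split.
by rewrite /= /in_strip cm lexx -cm (ltW (pr_lt PR _)).
Qed.

(** A hump is the image of the vertical segment over its summit. A level of the main well may
    consist of two points, so a well is instead joined to the image of the graph of [c1] over it by
    descending. *)
Let connected_piece k : pieces k -> connected (piece k).
Proof.
case: k => [[b i]|j] h.
  have -> : piece (inl (b, i)) = (fun t => Q (t, m b i)) @` `]0, 1].
    apply/seteqP; split=> [_ [[t x] [/= [t0 Bx] D] <-]|_ [t /= + <-]].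
      have t1 : t <= 1 by case/andP: D => _ h'; exact: le_trans h' (c2_le1 x).
      have Dm : strip t (m b i) by apply: strip_up_m; rewrite ?(ltW t0).
      have [_ Bm _ _] := sh_up SH h.
      exists t; first by rewrite /= in_itv /= t0.
      by apply/(pr_joined PR) => //; apply: (joined_up h) => //; exact: ltW.
    by rewrite in_itv /=; exact: up_point.
  apply: connected_continuous_connected; last by apply: continuous_subspaceT; exact: Q_continuous_fst PR _.
  by apply/connected_intervalP; exact: interval_is_interval.
have jn : (j < n0)%N := h; have [oB Bm cm neg] := sh_down SH jn.
pose curve x := Q (c1 x, x).
have ccurve : continuous curve.
  move=> x; apply: (@continuous_comp _ _ _ (fun x => (c1 x, x)) Q); last exact: (pr_Q PR).
  by apply: (@cvg_pair _ _ _ _ (nbhs (c1 x)) (nbhs x)) => /=; [exact: (pr_c1 PR)|exact: cvg_id].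
have strip1 x : strip (c1 x) x by rewrite /in_strip lexx (ltW (pr_lt PR _)).
have iB : is_interval (BD j).
  move=> u v Bu Bv w uwv; apply: contrapT => nBw.
  have [y yb cy] := sh_down_cut SH jn Bu nBw.
  case/andP: uwv => uw wv.
  have uyv : u <= y <= v.
    by move: yb; rewrite (min_idPl uw) (max_idPr uw) => /andP[-> /le_trans]; apply.
  have := sh_down_conv SH jn Bu Bv uyv; rewrite le_max leNgt (lt_le_trans (neg _ Bu) cy) /=.
  by rewrite leNgt (lt_le_trans (neg _ Bv) cy).
apply: (@connected_pointed _ _ _ (down_tip jn)) => _ [[t x] [/= [t0 Bx] D] <-].
exists (curve @` BD j `|` (fun t => Q (t, x)) @` `[c1 x, t]); split.
- apply: connectedU.
  + exists (curve x); split; first by exists x.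
    by exists (c1 x) => //=; rewrite in_itv /= lexx; case/andP: D.
  + apply: connected_continuous_connected; first exact/connected_intervalP.
    exact: continuous_subspaceT.
  + apply: connected_continuous_connected; last by apply: continuous_subspaceT; exact: Q_continuous_fst PR _.
    by apply/connected_intervalP; exact: interval_is_interval.
- move=> _ [[y By <-]|[u /= + <-]].
    by exists (c1 y, y) => //; split; [split => //; exact: neg|exact: strip1].
  rewrite in_itv /= => /andP[u1 u2]; exists (u, x) => //; split.
    by split => //=; exact: le_lt_trans t0.
  by case/andP: D => _ h2; rewrite /= /in_strip u1 (le_trans u2).
- by left; exists (mD j) => //; rewrite /curve cm.
- by right; exists t => //=; rewrite in_itv /= lexx andbT; case/andP: D.
Qed.

Let disjoint_pieces k k' : pieces k -> pieces k' -> piece k `&` piece k' !=set0 -> k = k'.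
Proof.
case: k => [[b i]|j]; case: k' => [[b' i']|j'] h h' [g [kg k'g]].
- move: kg => [[t x] [/= [t0 Bx] D] gE]; move: k'g; rewrite -gE => /(imgP PR (sat_up h') D)[_ /= B'x].
  by have [-> ->] := sh_up_disj SH h h' Bx B'x.
- by have := lt_trans (c_up kg) (c_down k'g); rewrite ltxx.
- by have := lt_trans (c_up k'g) (c_down kg); rewrite ltxx.
- move: kg => [[t x] [/= [t0 Bx] D] gE]; move: k'g; rewrite -gE => /(imgP PR (sat_down h') D)[_ /= B'x].
  by rewrite (sh_down_disj SH h h' Bx B'x).
Qed.

Let cover_pieces : ~` NF R S = \bigcup_(k in pieces) piece k.
Proof.
apply/seteqP; split=> g.
  have [t [x [D ->]]] := pr_surj PR g => nN; have /andP[D1 D2] := D.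
  have [t0|t0|t0] := ltrgtP t 0.
  - have [j [jn Bx]] := sh_down_cover SH (le_lt_trans D1 t0).
    by exists (inr j) => //; exists (t, x).
  - have [b [i [ib Bx]]] := sh_up_cover SH (lt_le_trans t0 D2).
    by exists (inl (b, i)) => //; exists (t, x).
  - exfalso; apply: nN; move: D; rewrite t0 => /level0[b [nb ->]].
    exact: end_NF.
move=> [k hk kg] /NF_end[b nb gE]; have cg : c g = 0 by rewrite gE c_end.
case: k hk kg => [[b' i]|j] hk kg; first by have := c_up kg; rewrite cg ltxx.
by have := c_down kg; rewrite cg ltxx.
Qed.

Lemma NF_components_shape : @NF_components R G S = piece @` pieces.
Proof.
apply: components_partition.
- exact: open_piece.
- exact: connected_piece.
- case=> [[b i]|j] h; last by exists (Q (- mu, mD j)); exact: down_tip.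
  by exists (Q (1, m b i)); apply: up_point => //; rewrite ltr01 lexx.
- exact: disjoint_pieces.
- exact: cover_pieces.
Qed.

Lemma piece_inj k k' : pieces k -> pieces k' -> piece k = piece k' -> k = k'.
Proof.
move=> h h' E; apply: disjoint_pieces => //; rewrite -E setIid.
case: k h {E} => [[b i]|j] h; last by exists (Q (- mu, mD j)); exact: down_tip.
by exists (Q (1, m b i)); apply: up_point => //; rewrite ltr01 lexx.
Qed.

(** The NF points are ends and belong to [S], so an edge is a connected subset of the complement of
    NF and stays in one piece. *)
Let edge_in_piece k g : pieces k -> piece k g -> ~ S g ->
  connected_component (~` S) g `<=` piece k.
Proof.
move=> hk kg nSg.
have kN : (~` NF R S) g by rewrite cover_pieces; exists k.
have E : connected_component (~` NF R S) g = piece k.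
  have : @NF_components R G S (connected_component (~` NF R S) g) by exists g.
  rewrite NF_components_shape => -[k' hk' k'E].
  have -> : k = k'.
    apply: disjoint_pieces => //; exists g; split => //; rewrite k'E.
    exact: connected_component_refl.
  by [].
rewrite -E; apply: connected_component_max.
- exact: connected_component_refl.
- apply: (@subset_trans _ (~` S)); first exact: connected_component_sub.
  by move=> h nSh /NF_end[b nb hE]; apply: nSh; rewrite hE; exact: pole_end.
- exact: component_connected.
Qed.

Let extremal_piece (le : G -> G -> Prop) k s : pieces k ->
  closed [set z | le z s] -> (forall z, piece k z -> le z s) ->
  (forall W, nbhs s W -> exists g, [/\ W g, piece k g & ~ S g]) ->
  extremal_at S le (piece k) s.
Proof.
move=> hk cl kle acc.
exists [set e | edges S e /\ e `<=` piece k]; split.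
- have [g [_ kg nSg]] := acc setT filterT.
  by exists (connected_component (~` S) g); split; [exists g|exact: edge_in_piece].
- by move=> e [].
- by move=> g [e [_ ek] /ek].
- move=> W /acc[g [Wg kg nSg]]; exists g; split => //.
  exists (connected_component (~` S) g); last exact: connected_component_refl.
  by split; [exists g|exact: edge_in_piece].
- have sub : \bigcup_(e in [set e | edges S e /\ e `<=` piece k]) e `<=` [set z | le z s].
    by move=> g [e [_ ek] /ek /kle].
  by move=> z0 /(closureS sub); rewrite -(closure_id _).1.
Qed.

(** Critical levels may accumulate at 0, but not at [e * (d / 2)]; a shift of that level by less
    than its isolating distance is regular. *)
Let regular_level d (e : R) : 0 < d -> e = 1 \/ e = -1 ->
  exists t, [/\ 0 < e * t, e * t < d & forall g, S g -> c g <> t].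
Proof.
move=> d0 e1; have ee : e * e = 1 by case: e1 => ->; rewrite ?mulrNN mulr1.
have en0 : e != 0 by apply/eqP => E; move: ee; rewrite E mul0r => /eqP; rewrite eq_sym oner_eq0.
have [|e' e'0 noS] := @Sdisc (e * (d / 2)); first by rewrite mulf_neq0 // gt_eqF // divr_gt0.
pose r := Num.min e' (d / 2) / 2.
have m0 : 0 < Num.min e' (d / 2) by rewrite lt_min e'0 divr_gt0.
have m1 : Num.min e' (d / 2) <= e' by rewrite ge_min lexx.
have m2 : Num.min e' (d / 2) <= d / 2 by rewrite ge_min lexx orbT.
exists (e * (d / 2 + r)); rewrite mulrA ee mul1r; split; rewrite /r; [lra|lra|].
move=> g Sg cg; apply: (noS _ Sg); rewrite cg -mulrBr addrAC subrr add0r.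
have -> : `|e * (Num.min e' (d / 2) / 2)| = Num.min e' (d / 2) / 2.
  rewrite normrM (gtr0_norm (divr_gt0 m0 _)) //.
  by case: e1 => ->; rewrite ?normrN normr1 mul1r.
by apply/andP; split; lra.
Qed.

(** The vertical path over [x] tends to [s], and its points on regular levels lie on edges of the
    piece, so the union of these edges accumulates at [s]. The sign [e] is 1 for an approach from
    above and -1 for one from below. *)
Let extremal_path (le : G -> G -> Prop) k s x (e : R) : pieces k -> e = 1 \/ e = -1 ->
  closed [set z | le z s] -> (forall z, piece k z -> le z s) ->
  (exists2 d, 0 < d & forall t, 0 < e * t < d -> strip t x /\ piece k (Q (t, x))) ->
  Q (0, x) = s -> extremal_at S le (piece k) s.
Proof.
move=> hk e1 cl kle [d d0 H] sE; apply: extremal_piece => // W; rewrite -sE => Ws.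
have : \forall t \near (0 : R), W (Q (t, x)) by exact: (Q_continuous_fst PR).
move=> /nbhs_ballP[d' /= d'0 dW].
have [|t [t0 td reg]] := @regular_level (Num.min d d') e _ e1; first by rewrite lt_min d0.
move: td; rewrite lt_min => /andP[td td'].
have [|D kt] := H t; first by rewrite t0.
exists (Q (t, x)); split => //; last by move=> /reg; rewrite (pr_cQ PR).
apply: dW; rewrite /ball /= sub0r normrN.
have -> : `|t| = e * t; last by [].
rewrite -(gtr0_norm t0) normrM.
by case: e1 => ->; rewrite ?normrN normr1 mul1r.
Qed.

Let closed_ge_c s : closed [set z' | c s <= c z'].
Proof.
apply: (@preimage_closed _ _ c [set y | c s <= y]); last exact: closed_ge.
by move=> ? _; exact: (pr_c PR).
Qed.

Let closed_le_c s : closed [set z' | c z' <= c s].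
Proof.
apply: (@preimage_closed _ _ c [set y | y <= c s]); last exact: closed_le.
by move=> ? _; exact: (pr_c PR).
Qed.

Lemma minimal_at_up b i : (i < nU b)%N -> minimal_at S c (piece (inl (b, i))) (end_point b).
Proof.
move=> ib; have nb : (0 < nU b)%N by exact: leq_ltn_trans (leq0n _) ib.
apply: (@extremal_path (fun z0 s0 => c s0 <= c z0) (inl (b, i)) _ (m b i) 1) => //; last exact: end_up.
- by left.
- by move=> z' /c_up /ltW; rewrite c_end.
- exists 1 => // t; rewrite mul1r => /andP[t0 /ltW t1]; split.
    by apply: strip_up_m; rewrite ?(ltW t0).
  by apply: up_point; rewrite ?t0.
Qed.

Lemma maximal_at_down j : (0 < j)%N -> (j < n0)%N ->
  maximal_at S c (piece (inr j)) (end_point false).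
Proof.
move=> j0 jn; have nb := sh_nU SH; have [_ Bm cm _] := sh_down SH jn.
have [mxs cm2] := sh_down_pos SH j0 jn Bm.
apply: (@extremal_path (fun z0 s0 => c z0 <= c s0) (inr j) _ (mD j) (-1)) => //.
- by right.
- by move=> z' /c_down /ltW; rewrite c_end.
- exists mu => [|t]; first exact: lt_trans eta0 etamu.
  rewrite mulN1r oppr_gt0 ltrNl => /andP[t0 t1].
  have D : strip t (mD j) by rewrite /in_strip cm (ltW t1) (le_trans (ltW t0)).
  by split => //; exists (t, mD j).
- have D : strip 0 (mD j) by rewrite /in_strip cm (ltW mu_lt0).
  have [sz _ _ _] := sh_z SH nb.
  apply/(pr_joined PR) => //; first exact: strip_end.
  by apply: (joined_arm (b := false)) => //; [left|exact: strip_end].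
Qed.

Lemma maximal_at_main b : (0 < nU b)%N -> maximal_at S c (piece (inr 0%N)) (end_point b).
Proof.
move=> nb; have [sz cz _ Bz] := sh_z SH nb.
have c1z : c1 (z b) < 0 by rewrite -cz; exact: pr_lt PR _.
apply: (@extremal_path (fun z0 s0 => c z0 <= c s0) (inr 0%N) _ (z b) (-1)) => //.
- exact: sh_n0 SH.
- by right.
- by move=> z' /c_down /ltW; rewrite c_end.
- exists (- c1 (z b)) => [|t]; first by rewrite oppr_gt0.
  rewrite mulN1r oppr_gt0 ltrN2 => /andP[t0 t1].
  have D : strip t (z b) by rewrite /in_strip cz (ltW t0) (ltW t1).
  by split => //; exists (t, z b).
Qed.

Let extremal_point le C s : extremal_at S le C s -> exists2 g, C g & le g s.
Proof.
move=> [J [[e Je] Jedges JC _ Jle]]; have [g nSg eE] := Jedges _ Je.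
have eg : (\bigcup_(e in J) e) g by exists e => //; rewrite eE; exact: connected_component_refl.
by exists g; [exact: JC|apply: Jle; exact: subset_closure].
Qed.

Lemma not_maximal_up b i b' : (0 < nU b')%N ->
  ~ maximal_at S c (piece (inl (b, i))) (end_point b').
Proof.
move=> nb /extremal_point[g /c_up cg]; rewrite c_end // => cg'.
by have := lt_le_trans cg cg'; rewrite ltxx.
Qed.

Lemma not_minimal_down j b' : (0 < nU b')%N ->
  ~ minimal_at S c (piece (inr j)) (end_point b').
Proof.
move=> nb /extremal_point[g /c_down cg]; rewrite c_end // => cg'.
by have := lt_le_trans cg cg'; rewrite ltxx.
Qed.

(** Edges accumulating at the end on side [b'] would meet its side neighbourhood, which contains no
    point of a hump on the opposite side. *)
Lemma minimal_at_up_side b i b' : (i < nU b)%N -> (0 < nU b')%N ->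
  minimal_at S c (piece (inl (b, i))) (end_point b') -> b = b'.
Proof.
move=> ib nb' [J [_ _ JC sJ _]].
apply/eqP; apply: contraT => bb'.
have b'E : b' = ~~ b by move: bb'; case: (b); case: (b').
have [oS sS] := side_sliceP b'.
have [g [Jg Sg]] := sJ _ (open_nbhs_nbhs (conj oS (end_slice nb'))).
have [[t x] [/= [t0 Bx] D] gE] := JC _ Jg.
move: Sg; rewrite -gE => /(imgP PR sS D)[_ /= sx'].
have [_ _ _ sB] := sh_up SH ib; have [sx _] := sB _ Bx.
by exfalso; apply: (side_excl sx); rewrite -b'E.
Qed.

End ShapeReeb.

(** * Humps and wells from Chebyshev polynomials *)

Section Chebyshev.
Context {R : realType}.
Implicit Types (v w y t : R) (N i j k : nat).

(** The Chebyshev polynomials of the second kind, for which [sin t * chebU k (cos t) = sin (k.+1%:R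
    * t)]. *)
Fixpoint chebU k v : R :=
  match k with
  | 0%N => 1
  | k'.+1 => match k' with
             | 0%N => 2 * v
             | k''.+1 => 2 * v * chebU k' v - chebU k'' v
             end
  end.

Lemma chebUSS k v : chebU k.+2 v = 2 * v * chebU k.+1 v - chebU k v.
Proof. by []. Qed.

Lemma sin_chebU k t : sin t * chebU k (cos t) = sin (k.+1%:R * t).
Proof.
suff : sin t * chebU k (cos t) = sin (k.+1%:R * t) /\
    sin t * chebU k.+1 (cos t) = sin (k.+2%:R * t) by case.
elim: k => [|k [IH1 IH2]].
  split; first by rewrite mulr1 mul1r.
  rewrite (_ : 2%:R * t = t + t) ?sinD /=; last by rewrite mulr_natl mulr2n.
  by ring.
split=> //; rewrite chebUSS mulrBr IH1 mulrCA IH2.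
have E3 : k.+3%:R * t = k.+2%:R * t + t by rewrite -[k.+3]addn1 natrD mulrDl mul1r.
have E1 : k.+1%:R * t = k.+2%:R * t - t.
  by rewrite -[k.+2]addn1 natrD mulrDl mul1r addrK.
by rewrite E3 E1; move: (k.+2%:R * t) => s; rewrite sinB sinD; ring.
Qed.

Lemma real_analytic_chebU k (f : R -> R) : real_analytic f ->
  real_analytic (fun x => chebU k (f x)).
Proof.
move=> fa; suff : real_analytic (fun x => chebU k (f x)) /\
    real_analytic (fun x => chebU k.+1 (f x)) by case.
elim: k => [|k [IH1 IH2]].
  split; first exact: real_analytic_cst.
  by apply: real_analyticM => //; exact: real_analytic_cst.
split=> //; apply: real_analyticB => //; apply: real_analyticM => //.
by apply: real_analyticM => //; exact: real_analytic_cst.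
Qed.

(** The recursion subtracts a term, so the induction also carries the increments
    [chebU k.+1 - chebU k], shown to be nonnegative and increasing in the argument. *)
Lemma chebU_mono k v w : 1 <= v -> v <= w -> 1 <= chebU k v <= chebU k w.
Proof.
move=> v1 vw; suff : [/\ 1 <= chebU k v, chebU k v <= chebU k w,
    0 <= chebU k.+1 v - chebU k v &
    chebU k.+1 v - chebU k v <= chebU k.+1 w - chebU k w] by case=> -> ->.
elim: k => [|k [h1 h2 h3 h4]]; first by split => /=; lra.
rewrite !chebUSS; split; [lra|lra|nra|].
have : 0 <= (w - v) * (chebU k.+1 w) by rewrite mulr_ge0 ?subr_ge0 //; lra.
have : 0 <= (v - 1) * (chebU k.+1 w - chebU k.+1 v) by rewrite mulr_ge0 ?subr_ge0 //; lra.
by nra.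
Qed.

(** The polynomial with value [sin (N%:R * t) ^ 2] at [cos t]: on the interval from -1 to 1 it has
    [N] humps of the same height 1 separated by zeros, and beyond 1 it is negative. *)
Definition chebF N v : R := (1 - v ^+ 2) * chebU N.-1 v ^+ 2.

Lemma chebF_cos N t : (0 < N)%N -> chebF N (cos t) = sin (N%:R * t) ^+ 2.
Proof.
case: N => // N _; rewrite /chebF /= -sin_chebU exprMn.
by congr (_ * _); rewrite sin2cos2.
Qed.

Lemma real_analytic_chebF N (f : R -> R) : real_analytic f ->
  real_analytic (fun x => chebF N (f x)).
Proof.
move=> fa; apply: real_analyticM; last by apply: real_analyticX; exact: real_analytic_chebU.
by apply: real_analyticB; [exact: real_analytic_cst|exact: real_analyticX].
Qed.

Lemma chebF_ge1 N v w : 1 <= v -> v <= w -> chebF N w <= chebF N v <= 0.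
Proof.
move=> v1 vw; have /andP[h1 h2] := chebU_mono N.-1 v1 vw; rewrite /chebF.
have U2 : chebU N.-1 v ^+ 2 <= chebU N.-1 w ^+ 2.
  by rewrite lerXn2r // nnegrE; lra.
have U0 : 0 <= chebU N.-1 v ^+ 2 by exact: sqr_ge0.
have v2 : 0 <= v ^+ 2 - 1 by rewrite expr2; nra.
have vw2 : v ^+ 2 <= w ^+ 2 by rewrite lerXn2r // nnegrE; lra.
by apply/andP; split; nra.
Qed.

Lemma chebF_gt1 N v : 1 < v -> chebF N v < 0.
Proof.
move=> v1; have /andP[h1 _] := chebU_mono N.-1 (ltW v1) (lexx v); rewrite /chebF.
have : 1 <= chebU N.-1 v ^+ 2 by rewrite expr_ge1 //; lra.
have : 0 < v ^+ 2 - 1 by rewrite expr2; nra.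
by nra.
Qed.

(** The index is real and runs from right to left: integers give the zeros of [chebF N],
    half-integers its maxima. Band 0 is therefore the one adjacent to 1. *)
Definition node N (r : R) : R := cos (r * pi / N%:R).
Definition band N i v : bool := node N i.+1%:R < v < node N i%:R.

Let N0 N : (0 < N)%N -> 0 < (N%:R : R).
Proof. by rewrite ltr0n. Qed.

Lemma node_lt N (r s : R) : (0 < N)%N -> 0 <= r -> r < s -> s <= N%:R -> node N s < node N r.
Proof.
move=> nN r0 rs sN; have pi0 := pi_gt0 R; have n0 := N0 nN.
have arg_in (u : R) : 0 <= u -> u <= N%:R -> u * pi / N%:R \in `[0, pi].
  move=> u0 uN; rewrite in_itv /= divr_ge0 ?mulr_ge0 ?(ltW n0) ?(ltW pi0) //=.
  by rewrite ler_pdivrMr // mulrC ler_wpM2l // ltW.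
rewrite /node ltr_cos ?arg_in //; [|lra|lra].
by rewrite ltr_pM2r ?invr_gt0 // ltr_pM2r.
Qed.

Lemma node_le N (r s : R) : (0 < N)%N -> 0 <= r -> r <= s -> s <= N%:R -> node N s <= node N r.
Proof.
move=> nN r0; rewrite le_eqVlt => /predU1P[->//|rs sN]; exact/ltW/node_lt.
Qed.

Lemma node0 N : node N 0 = 1.
Proof. by rewrite /node !mul0r cos0. Qed.

Lemma nodeN N : (0 < N)%N -> node N N%:R = -1.
Proof. by move=> nN; rewrite /node mulrAC divff ?mul1r ?cospi // gt_eqF // N0. Qed.

Lemma sqr_sin_shift i t : sin (t + i%:R * pi) ^+ 2 = sin t ^+ 2.
Proof.
elim: i => [|i IH]; first by rewrite mul0r addr0.
by rewrite -natr1 mulrDl mul1r addrA sinDpi sqrrN.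
Qed.

Lemma chebF_node N (r : R) : (0 < N)%N -> chebF N (node N r) = sin (r * pi) ^+ 2.
Proof.
move=> nN; rewrite /node chebF_cos //; congr (sin _ ^+ 2).
by rewrite mulrC mulfVK // gt_eqF // N0.
Qed.

Lemma chebF_node0 N i : (0 < N)%N -> chebF N (node N i%:R) = 0.
Proof.
by move=> nN; rewrite chebF_node // -[_ * pi]add0r sqr_sin_shift sin0 expr0n.
Qed.

Lemma chebF_half_node N i : (0 < N)%N -> chebF N (node N (i%:R + 1 / 2)) = 1.
Proof.
move=> nN; rewrite chebF_node // mulrDl addrC sqr_sin_shift mul1r mulrC.
by rewrite sin_pihalf expr1n.
Qed.

Lemma band_half_node N i : (i < N)%N -> band N i (node N (i%:R + 1 / 2)).
Proof.
move=> iN; have nN : (0 < N)%N by exact: leq_ltn_trans iN.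
have iN' : i%:R + 1 <= N%:R :> R by rewrite natr1 ler_nat.
have i0 : 0 <= i%:R :> R by [].
have iE : i.+1%:R = i%:R + 1 :> R by rewrite natr1.
by apply/andP; rewrite iE; split; apply: node_lt => //; lra.
Qed.

Lemma node_bounds N r : -1 <= node N r <= 1.
Proof. by rewrite /node cos_geN1 cos_le1. Qed.

Lemma band_bounds N i v : band N i v -> -1 < v < 1.
Proof.
move=> /andP[h1 h2]; have /andP[a1 _] := node_bounds N i.+1%:R.
have /andP[_ a2] := node_bounds N i%:R.
by rewrite (le_lt_trans a1) // (lt_le_trans h2).
Qed.

Lemma band_phase N i v : (i < N)%N -> band N i v ->
  exists2 t, 0 < t < pi & v = cos ((t + i%:R * pi) / N%:R) /\ chebF N v = sin t ^+ 2.
Proof.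
move=> iN bv; have nN : (0 < N)%N by exact: leq_ltn_trans iN.
have n0 := N0 nN; have pi0 := pi_gt0 R.
have /andP[v1 v2] := band_bounds bv.
have vin : v \in `[(-1), 1] by rewrite in_itv /= !ltW.
have vb : -1 <= v <= 1 by rewrite !ltW.
have vE : v = cos (acos v) by rewrite acosK.
have ain : acos v \in `[0, pi] by rewrite in_itv /= acos_ge0 // acos_lepi.
have iN' : i%:R + 1 <= N%:R :> R by rewrite natr1 ler_nat.
have i0 : 0 <= i%:R :> R by [].
have iE : i.+1%:R = i%:R + 1 :> R by rewrite natr1.
have arg_in (u : R) : 0 <= u -> u <= N%:R -> u * pi / N%:R \in `[0, pi].
  move=> u0 uN; rewrite in_itv /= divr_ge0 ?mulr_ge0 ?(ltW n0) ?(ltW pi0) //=.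
  by rewrite ler_pdivrMr // mulrC ler_wpM2l // ltW.
have /andP[] := bv; rewrite {1 2}vE /node iE !ltr_cos ?arg_in //; try lra.
rewrite ltr_pdivrMr // ltr_pdivlMr // => h1 h2.
exists (acos v * N%:R - i%:R * pi).
  by rewrite mulrDl mul1r in h1; apply/andP; split; lra.
rewrite subrK mulfK ?gt_eqF //; split => //.
by rewrite {1}vE chebF_cos // mulrC -[in RHS](sqr_sin_shift i) subrK.
Qed.

Lemma chebF_band N i v : (i < N)%N -> band N i v -> 0 < chebF N v <= 1.
Proof.
move=> iN bv; have [t t0 [_ ->]] := band_phase iN bv.
by rewrite exprn_gt0 ?sin_gt0_pi //= expr_le1 ?sin_le1 // ltW // sin_gt0_pi.
Qed.

Lemma chebF_le1 N v : (0 < N)%N -> -1 <= v -> chebF N v <= 1.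
Proof.
move=> nN v1; have [v2|v2] := leP v 1.
  have vin : v \in `[(-1), 1] by rewrite in_itv /= v1.
  rewrite -(acosK vin) chebF_cos // -real_normK ?num_real // expr_le1 // sin_max //.
by rewrite (le_trans (ltW (chebF_gt1 N v2))).
Qed.

Lemma chebF_ge0 N v : (0 < N)%N -> -1 <= v <= 1 -> 0 <= chebF N v.
Proof.
move=> nN vb; have vin : v \in `[(-1), 1] by rewrite in_itv.
by rewrite -(acosK vin) chebF_cos // sqr_ge0.
Qed.

Let sin_quasi (a b c : R) : 0 <= a -> a <= b -> b <= c -> c <= pi ->
  Num.min (sin a) (sin c) <= sin b.
Proof.
move=> a0 ab bc cpi; have pi0 := pi_gt0 R; rewrite ge_min.
have [b2|b2] := leP b (pi / 2).
  apply/orP; left; move: ab; rewrite le_eqVlt => /predU1P[->//|ab].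
  by apply/ltW; rewrite ltr_sin ?in_itv //=; apply/andP; split; lra.
apply/orP; right; move: bc; rewrite le_eqVlt => /predU1P[->//|bc].
have E (u : R) : sin u = sin (pi - u) by rewrite sinB sinpi cospi mul0r sub0r mulN1r opprK.
by apply/ltW; rewrite (E c) (E b) ltr_sin ?in_itv //=; try (apply/andP; split); lra.
Qed.

(** In the angular coordinate of a band, [chebF N] is the square of the sine on the interval from 0
    to pi, hence unimodal; cosine is monotone there, so betweenness is preserved. *)
Lemma band_quasi N i v y w : (i < N)%N -> band N i v -> band N i w -> v <= y <= w ->
  Num.min (chebF N v) (chebF N w) <= chebF N y.
Proof.
move=> iN bv bw /andP[vy yw].
have by_ : band N i y.
  by case/andP: bv => h1 _; case/andP: bw => _ h2; rewrite /band (lt_le_trans h1) // (le_lt_trans yw).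
have nN : (0 < N)%N by exact: leq_ltn_trans iN.
have n0 := N0 nN; have pi0 := pi_gt0 R.
have iN' : i%:R + 1 <= N%:R :> R by rewrite natr1 ler_nat.
have i0 : 0 <= i%:R :> R by [].
have phase_le (s t : R) : 0 < s < pi -> 0 < t < pi ->
    cos ((s + i%:R * pi) / N%:R) <= cos ((t + i%:R * pi) / N%:R) -> t <= s.
  move=> /andP[s0 s1] /andP[t0 t1]; rewrite leNgt => H; rewrite leNgt.
  apply: contra H => st; rewrite ltr_cos.
  - by rewrite ltr_pM2r ?invr_gt0 // ltrD2r.
  - rewrite in_itv /= divr_ge0 ?(ltW n0) //=; last by rewrite addr_ge0 ?mulr_ge0 // ltW.
    by rewrite ler_pdivrMr //; nra.
  - rewrite in_itv /= divr_ge0 ?(ltW n0) //=; last by rewrite addr_ge0 ?mulr_ge0 // ltW.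
    by rewrite ler_pdivrMr //; nra.
have [s s0 [vE ->]] := band_phase iN bv.
have [t t0 [wE ->]] := band_phase iN bw.
have [r r0 [yE ->]] := band_phase iN by_.
have rs : r <= s by apply: phase_le => //; rewrite -vE -yE.
have tr : t <= r by apply: phase_le => //; rewrite -wE -yE.
have := @sin_quasi t r s; case/andP: (t0) => /ltW -> _; case/andP: (s0) => _ /ltW -> /(_ isT tr rs isT).
have sp := sin_gt0_pi s0; have tp := sin_gt0_pi t0; have rp := sin_gt0_pi r0.
rewrite !ge_min => /orP[h|h]; apply/orP; [right|left]; by rewrite lerXn2r // nnegrE ltW.
Qed.

Lemma band_disjoint N i j v : (i < N)%N -> (j < N)%N -> band N i v -> band N j v -> i = j.
Proof.
move=> iN jN bi bj; have nN : (0 < N)%N by exact: leq_ltn_trans iN.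
have aux k l : (k < l)%N -> (l < N)%N -> band N k v -> band N l v -> False.
  move=> kl lN /andP[h1 _] /andP[_ h2].
  have : node N l%:R <= node N k.+1%:R by apply: node_le; rewrite ?ler_nat // ltnW.
  by move=> h; have := lt_le_trans h2 (le_trans h (ltW h1)); rewrite ltxx.
by have [h|h|//] := ltngtP i j; [case: (aux _ _ h jN bi bj)|case: (aux _ _ h iN bj bi)].
Qed.

Lemma band_cover N v : (0 < N)%N -> -1 < v < 1 -> chebF N v != 0 ->
  exists2 i, (i < N)%N & band N i v.
Proof.
move=> nN /andP[v1 v2] Fv; have n0 := N0 nN; have pi0 := pi_gt0 R.
have vin : v \in `[(-1), 1] by rewrite in_itv /= !ltW.
have vE : v = cos (acos v) by rewrite acosK.
have a0 : 0 < acos v by rewrite acos_gt0 // ltW.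
have api : acos v < pi by rewrite acos_ltpi // v1 ltW.
pose r := acos v * N%:R / pi.
have r0 : 0 <= r by rewrite divr_ge0 ?mulr_ge0 // ltW.
have rN : r < N%:R by rewrite ltr_pdivrMr // mulrC ltr_pM2l.
have vr : v = node N r by rewrite /node /r divfK ?gt_eqF // mulfK ?gt_eqF.
have /andP[i1 i2] := truncn_itv r0; set i := Num.truncn r in i1 i2.
have iN : (i < N)%N by rewrite -(ltr_nat R) (le_lt_trans i1).
exists i => //; rewrite /band vr; apply/andP; split.
  by apply: node_lt => //; rewrite ler_nat.
apply: node_lt => //; last exact: ltW.
rewrite lt_neqAle i1 andbT; apply/eqP => ir.
by move: Fv; rewrite vr -ir chebF_node0 // eqxx.
Qed.

End Chebyshev.

(** * A sigmoid with critical points going to both infinities *)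

Section Sigmoid.
Context {R : realType}.
Implicit Types (x y e M : R).

(** A primitive of [- expR (- x) * (1 + cos x)], which is never positive and vanishes exactly at the
    odd multiples of pi. *)
Let damp x : R := expR (- x) * (1 + (cos x - sin x) / 2).

Let is_derive_damp x : is_derive x 1 damp (- expR (- x) * (1 + cos x)).
Proof.
have h1 : is_derive x 1 (fun y : R => expR (- y)) (expR (- x) * -1).
  exact: (is_derive1_comp (is_derive_expR (- x)) (is_deriveN (is_derive_id x 1))).
have h2 : is_derive x 1 (fun y : R => cos y - sin y) (- sin x - cos x) by apply: is_deriveB.
have h3 : is_derive x 1 (fun y : R => (1 / 2) *: (cos y - sin y)) ((1 / 2) *: (- sin x - cos x)) by apply: is_deriveZ.
have h4 : is_derive x 1 (fun y : R => 1 + (1 / 2) *: (cos y - sin y)) (0 + (1 / 2) *: (- sin x - cos x)) by apply: is_deriveD.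
have -> : damp = (fun y : R => expR (- y)) * (fun y : R => 1 + (1 / 2) *: (cos y - sin y)).
  by apply/funext => y; rewrite /damp mulrC -[RHS]mulrC /GRing.scale /= mul1r [in RHS](mulrC 2^-1).
apply: (is_derive_eq (is_deriveM h1 h4)); rewrite /GRing.scale /=.
by field.
Qed.

Lemma damp_bounds x : expR (- x) / 4 <= damp x <= 2 * expR (- x).
Proof.
have e0 := expR_gt0 (- x); have sc := cos2Dsin2 x.
have : (cos x - sin x) ^+ 2 <= 2.
  by have := sqr_ge0 (cos x + sin x); rewrite sqrrD sqrrB; lra.
set d := cos x - sin x => d2; have : -(3/2) <= d <= 3/2 by apply/andP; split; nra.
by rewrite /damp -/d => /andP[d1 d3]; apply/andP; split; nra.
Qed.

(* ell is a nondecreasing sigmoid whose critical points, the odd multiples of pi,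
   are unbounded on both sides. *)
Definition ell x : R := (1 + damp x)^-1.

Let damp_gt0 x : 0 < damp x.
Proof.
by have /andP[h _] := damp_bounds x; apply: lt_le_trans h; rewrite divr_gt0 ?expR_gt0.
Qed.

Let damp1 x : 0 < 1 + damp x.
Proof. by rewrite ltr_pwDl // ltW. Qed.

Lemma real_analytic_ell : real_analytic ell.
Proof.
apply: real_analyticV; first by move=> x; rewrite gt_eqF.
apply: real_analyticD; first exact: real_analytic_cst.
apply: real_analyticM.
  have -> : (fun x : R => expR (- x)) = (fun x => (expR x)^-1) by apply/funext => x; rewrite expRN.
  apply: real_analyticV; last exact: real_analytic_expR.
  by move=> x; rewrite gt_eqF // expR_gt0.
apply: real_analyticD; first exact: real_analytic_cst.
apply: real_analyticM; last exact: real_analytic_cst.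
by apply: real_analyticB; [exact: real_analytic_cos|exact: real_analytic_sin].
Qed.

Lemma ell_bounds x : 0 < ell x < 1.
Proof.
have d0 := damp_gt0 x; rewrite /ell invr_gt0 damp1 /=.
by rewrite invf_lt1 ?ltrDl.
Qed.

Lemma ell_le x y : x <= y -> ell x <= ell y.
Proof.
move=> xy; rewrite /ell lef_pV2 ?posrE // lerD2l.
move: xy; rewrite le_eqVlt => /predU1P[->//|xy].
have dd z : derivable damp z 1 by have [] := is_derive_damp z.
apply: (@ler0_derive1_nincr _ damp x y) => //; rewrite ?ltW //.
- move=> z _; rewrite derive1E; have [_ ->] := is_derive_damp z.
  have := cos_geN1 z; have := expR_gt0 (- z); nra.
- by apply: derivable_within_continuous => z _.
Qed.

Lemma ell_cvgy : ell @ +oo --> (1 : R).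
Proof.
apply/cvgrPdist_lt => e e0; near=> x.
have d0 := damp_gt0 x; have /andP[_ d2] := damp_bounds x.
have x0 : 0 < x by near: x; apply: nbhs_pinfty_gt; exact: num_real.
have E : 1 - ell x = damp x * ell x by rewrite /ell; field; rewrite gt_eqF.
have /andP[l0 l1] := ell_bounds x.
have ex : expR (- x) <= (1 + x)^-1.
  by rewrite expRN lef_pV2 ?posrE ?expR_gt0 ?expR_ge1Dx //; lra.
rewrite ger0_norm ?E; last by rewrite mulr_ge0 // ltW.
have : damp x < e; last by nra.
apply: le_lt_trans d2 _; rewrite mulrC -ltr_pdivlMr //; apply: le_lt_trans ex _.
rewrite invf_plt ?posrE ?divr_gt0 //; last lra.
suff : (e / 2)^-1 < x by lra.
by near: x; apply: nbhs_pinfty_gt; exact: num_real.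
Unshelve. all: by end_near. Qed.

Lemma ell_cvgNy : ell @ -oo --> (0 : R).
Proof.
apply/cvgrPdist_lt => e e0; near=> x.
have d0 := damp_gt0 x; have /andP[d1 _] := damp_bounds x.
have /andP[l0 l1] := ell_bounds x.
rewrite sub0r normrN ger0_norm ?(ltW l0) // /ell invf_plt ?posrE //.
have := expR_ge1Dx (- x).
have : x < - (4 * e^-1) by near: x; apply: nbhs_ninfty_lt; exact: num_real.
by lra.
Unshelve. all: by end_near. Qed.

Lemma ell_critical (b : bool) M :
  exists x, (if b then M < x else x < M) /\ derive1 ell x = 0.
Proof.
have crit x : cos x = -1 -> derive1 ell x = 0.
  move=> cx; have dx := is_derive_damp x.
  have n0 : (1 + damp x) != 0 by rewrite gt_eqF.
  have : is_derive x 1 (fun y => 1 + damp y) (- expR (- x) * (1 + cos x)).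
    by rewrite -[X in is_derive _ _ _ X]add0r; apply: is_deriveD.
  move=> /(is_deriveV (f := fun y => 1 + damp y) n0) [_]; rewrite -derive1E => ->.
  by rewrite cx subrr mulr0 /GRing.scale /= mulr0.
have per n : cos (pi + n%:R * (pi *+ 2)) = -1 :> R.
  elim: n => [|n IH]; first by rewrite mul0r addr0 cospi.
  by rewrite -natr1 mulrDl mul1r addrA cosD cos2pi sin2pi mulr1 mulr0 subr0.
pose n := Num.bound (`|M| / (pi *+ 2)).
have p0 := pi_gt0 R; have p2 : 0 < (pi : R) *+ 2 by rewrite pmulrn_lgt0.
have nM : `|M| < pi + n%:R * (pi *+ 2).
  rewrite (lt_trans (y := n%:R * (pi *+ 2))) ?ltrDr // -ltr_pdivrMr //.
  by rewrite archi_boundP // divr_ge0 // ltW.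
case: b; [exists (pi + n%:R * (pi *+ 2))|exists (- (pi + n%:R * (pi *+ 2)))].
  by split; [rewrite (le_lt_trans (ler_norm M))|exact/crit/per].
by split; [rewrite ltrNl (le_lt_trans (ler_norm (- M))) ?normrN|apply: crit; rewrite cosN per].
Qed.

Lemma ell_surj y : 0 < y < 1 -> exists x, ell x = y.
Proof.
move=> /andP[y0 y1].
have [a ay] : exists a, ell a < y.
  have /cvgrPdist_lt/(_ _ y0)/filter_ex[x] := ell_cvgNy.
  by rewrite sub0r normrN => /ltr_normlW h; exists x.
have [b yb] : exists b, y < ell b.
  have y10 : 0 < 1 - y by rewrite subr_gt0.
  have /cvgrPdist_lt/(_ _ y10)/filter_ex[x] := ell_cvgy.
  by move=> /ltr_normlW h; exists x; lra.
have ab : a <= b by rewrite leNgt; apply/negP => /ltW /ell_le; lra.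
have [] := @IVT _ ell a b y ab; last by move=> x _ xE; exists x.
- exact/continuous_subspaceT/real_analytic_continuous/real_analytic_ell.
- by rewrite ge_min (ltW ay) le_max (ltW yb) orbT.
Qed.

End Sigmoid.

(** * Comparison estimates around the point 1 *)

Section ChebyshevBounds.
Context {R : realType}.
Implicit Types (v w V : R) (N : nat).

(** Between the first maximum and 1 the angle [N t] is at most a right angle, so
    [sin (N t) ^ 2 >= sin t ^ 2 = 1 - w ^ 2], and [w] is nonnegative there. It gives the wells a
    linear lower bound on their depth near [w = 1]. *)
Lemma chebF_ge_first N w : (0 < N)%N -> node N (1 / 2) <= w <= 1 -> 1 - w <= chebF N w.
Proof.
move=> nN /andP[nw w1]; have n0 : 0 < N%:R :> R by rewrite ltr0n.
have n1 : 1 <= N%:R :> R by rewrite ler1n.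
have pi0 := pi_gt0 R; have /andP[b1 _] := node_bounds N (1 / 2 : R).
have wN1 : -1 <= w by exact: le_trans nw.
have vin : w \in `[(-1), 1] by rewrite in_itv /= wN1.
have wE : w = cos (acos w) by rewrite acosK.
have th0 : 0 <= acos w by rewrite acos_ge0 // wN1.
have thpi : acos w <= pi by rewrite acos_lepi // wN1.
have arg : 0 <= 1 / 2 * (pi : R) / N%:R <= pi / 2.
  apply/andP; split; first by rewrite !(divr_ge0, mulr_ge0) // ltW.
  by rewrite ler_pdivrMr //; nra.
have th1 : acos w <= 1 / 2 * pi / N%:R.
  rewrite leNgt; apply/negP => h; move: nw; rewrite leNgt => /negP; apply.
  case/andP: arg => h1 h2; rewrite {1}wE /node ltr_cos ?in_itv //= ?th0 //.
  by rewrite h1 (le_trans h2) //; lra.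
have Nth : N%:R * acos w <= pi / 2.
  by move: th1; rewrite ler_pdivlMr // mulrC; lra.
have Nge : acos w <= N%:R * acos w by nra.
have sle : sin (acos w) <= sin (N%:R * acos w).
  move: Nge; rewrite le_eqVlt => /predU1P[<-//|Nlt].
  by apply/ltW; rewrite ltr_sin ?in_itv //=; try (apply/andP; split); nra.
have s0 : 0 <= sin (acos w) by apply: sin_ge0_pi; rewrite th0.
have c0 : 0 <= w.
  by rewrite wE cos_ge0_pihalf //; apply/andP; split; nra.
rewrite {2}wE chebF_cos //.
have : sin (acos w) ^+ 2 <= sin (N%:R * acos w) ^+ 2 by rewrite lerXn2r // nnegrE // (le_trans s0).
have := cos2Dsin2 (acos w); rewrite -wE; nra.
Qed.

(** The factor [v - 1] splits off and the remaining factor is increasing; this bounds linearly how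
    deep the valley is just beyond 1. *)
Lemma chebF_lower N v V : 1 <= v -> v <= V ->
  - chebF N v <= (V + 1) * chebU N.-1 V ^+ 2 * (v - 1).
Proof.
move=> v1 vV; have /andP[h1 h2] := chebU_mono N.-1 v1 vV; rewrite /chebF.
have U2 : chebU N.-1 v ^+ 2 <= chebU N.-1 V ^+ 2 by rewrite lerXn2r // nnegrE; lra.
have U0 : 0 <= chebU N.-1 v ^+ 2 by exact: sqr_ge0.
rewrite (_ : - _ = (v + 1) * chebU N.-1 v ^+ 2 * (v - 1)); last by ring.
rewrite ler_wpM2r ?subr_ge0 // ler_pM //; lra.
Qed.

Lemma odd_expr_le K v w : v <= w -> v ^+ K.*2.+1 <= w ^+ K.*2.+1.
Proof.
have od : odd K.*2.+1 by rewrite /= odd_double.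
move=> vw; have [w0|w0] := leP 0 w; last first.
  have E x : x ^+ K.*2.+1 = - (- x) ^+ K.*2.+1 :> R.
    by rewrite exprNn -signr_odd od expr1 mulN1r opprK.
  by rewrite (E v) (E w) lerN2 lerXn2r // ?lerN2 // nnegrE oppr_ge0 ltW // (le_lt_trans vw).
have [v0|v0] := leP 0 v; first by rewrite lerXn2r.
by apply: (@le_trans _ _ 0); [rewrite exprn_odd_le0 // ltW|rewrite exprn_odd_ge0].
Qed.

End ChebyshevBounds.

(** * The model pair of boundary functions *)

Section Model.
Context {R : realType} (n1 n2 n0 K : nat) (xs : R).
Hypothesis n1_gt0 : (0 < n1)%N.
Hypothesis n0_gt0 : (0 < n0)%N.
Hypothesis K_gt0 : (0 < K)%N.
Implicit Types (x y r : R) (b : bool) (i j : nat).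

Definition arm_count b : nat := if b then n2 else n1.
Let N := (n1 + n2)%N.
Let vend b : R := node N (arm_count b)%:R.
Let d : R := vend true - vend false.
(** The zero of [d + 12 - 24 * l], the derivative of [profile]. The coefficient 12 outweighs
    [|d| <= 2]: it keeps [ep] close to one half, and the rise [12 * ep ^ 2] exceeds 2, which lifts
    the vertex above 1 from any starting node. *)
Let ep : R := (12 + d) / 24.
Let top : R := vend false + 12 * ep ^+ 2.
Let profile (l : R) : R := vend false + l * d + 12 * l * (1 - l).
Let weight (l : R) : R := 1 - 2 * (1 - l) ^+ K.
Let v x : R := profile (ell x).
Let w x : R := weight (ell x).
(** For [ell x < l1] the profile has not yet left the outermost band on the left: it starts at the
    lower end of that band, and its slope is less than 24. *)
Let l1 : R := Num.min ep ((node N n1.-1%:R - vend false) / 24).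
(** An odd power keeps the sign of [chebF]. As [K] is positive the exponent is at least 3, so every
    zero becomes critical, in particular the point where [upper] leaves the valley. *)
Let p := K.*2.+1.
Let C : R := (top + 1) * chebU N.-1 top ^+ 2.
(** [C] bounds the slope of [chebF N] between 1 and [top], and 24 bounds how fast [v] approaches its
    right end in terms of [1 - ell x]. Hence the valley is never deeper than
    [mu * (1 - ell x) ^+ p]. *)
Let mu : R := (24 * C) ^+ p.
Let eta : R := - (chebF N top ^+ p).

Hypothesis xsE : ell xs = ep.
(** Says that from [l1] on, [weight] is past the first maximum of [chebF n0], hence in band 0. All
    the wells but the main one are thereby squeezed into [ell x < l1]. *)
Hypothesis K_large : (1 - l1) ^+ K <= (1 - node n0 (1 / 2)) / 2.

(* profile is a concave parabola in l = ell x with vertex value top > 1 at ep,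
   ending at the nodes vend false for l = 0 and vend true for l = 1: the bands of
   chebF N crossed on either side are those of index < arm_count b. The exponent
   p > K keeps upper above lower near +oo, where both vanish like powers of
   1 - ell x. *)
Definition upper x : R := chebF N (v x) ^+ p.
Definition lower x : R := - (mu * chebF n0 (w x)).

Let B b i : set R := [set x | side xs b x /\ band N i (v x)].
Let BD j : set R := [set x | band n0 j (w x)].
Let mB b i : R := xget 0 [set x | side xs b x /\ v x = node N (i%:R + 1 / 2)].
Let mBD j : R := xget 0 [set x | w x = node n0 (j%:R + 1 / 2)].
Let z b : R := xget 0 [set x | side xs b x /\ v x = 1].

Let N_gt0 : (0 < N)%N. Proof. by rewrite addn_gt0 n1_gt0. Qed.
Let arm_leN b : (arm_count b <= N)%N.
Proof. by case: b; rewrite /N ?leq_addl ?leq_addr. Qed.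
Let vend_bounds b : -1 <= vend b <= 1. Proof. exact: node_bounds. Qed.
Let d_bounds : -2 <= d <= 2.
Proof.
by have /andP[a1 a2] := vend_bounds true; have /andP[b1 b2] := vend_bounds false; rewrite /d; apply/andP; split; lra.
Qed.
Let ep_bounds : 10 / 24 <= ep <= 14 / 24.
Proof. by have /andP[a1 a2] := d_bounds; rewrite /ep; apply/andP; split; lra. Qed.
Let top_gt1 : 1 < top.
Proof.
have /andP[b1 b2] := vend_bounds false; have /andP[e1 e2] := ep_bounds.
by rewrite /top; nra.
Qed.

Let vE x : v x = top - 12 * (ell x - ep) ^+ 2.
Proof.
have dE : d = 24 * ep - 12 by rewrite /ep; field.
by rewrite /v /profile /top dE; ring.
Qed.

Let topE b : top = vend b + 12 * ((if b then 1 else 0) - ep) ^+ 2.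
Proof.
case: b; rewrite /top /=; last by ring.
have dE : d = 24 * ep - 12 by rewrite /ep; field.
have -> : vend true = vend false + (24 * ep - 12) by rewrite -dE /d; ring.
by ring.
Qed.

Let ell_side b x : (if b then xs <= x else x <= xs) ->
  if b then ep <= ell x < 1 else 0 < ell x <= ep.
Proof. by have /andP[l0 l2] := ell_bounds x; rewrite -xsE; case: b => /ell_le ->; rewrite ?l0 ?l2. Qed.

Let side_le b x : side xs b x -> if b then xs <= x else x <= xs.
Proof. by case: b => /ltW. Qed.

Let v_xs : v xs = top. Proof. by rewrite vE xsE subrr expr0n mulr0 subr0. Qed.
Let v_top x : v x <= top. Proof. by rewrite vE lerBlDr lerDl mulr_ge0 // sqr_ge0. Qed.

Let v_gt b x : (if b then xs <= x else x <= xs) -> vend b < v x.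
Proof.
move=> /ell_side; rewrite vE (topE b); have /andP[e1 e2] := ep_bounds.
by case: b => /andP[h1 h2]; nra.
Qed.

Let side_or x : exists b, if b then xs <= x else x <= xs.
Proof. by have [h|/ltW h] := leP xs x; [exists true|exists false]. Qed.

Let v_gtN1 x : -1 < v x.
Proof.
have [b /v_gt h] := side_or x; apply: le_lt_trans h.
by have /andP[] := vend_bounds b.
Qed.

Let v_mono b x y : (if b then xs <= y <= x else x <= y <= xs) -> v x <= v y.
Proof.
have aux (e y1 y2 : R) : 0 <= (y1 - y2) * (y1 + y2 - 2 * e) -> (y2 - e) ^+ 2 <= (y1 - e) ^+ 2.
  by move=> h; rewrite -subr_ge0; apply: le_trans h _; rewrite le_eqVlt; apply/orP; left; apply/eqP; ring.
case: b => /andP[h1 h2]; rewrite !vE lerB // ler_wpM2l //; apply: aux.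
  have /= /andP[a1 _] := @ell_side true y h1; have a2 := ell_le h2.
  by apply: mulr_ge0; lra.
have /= /andP[_ a1] := @ell_side false y h2; have a2 := ell_le h1.
by apply: mulr_le0; lra.
Qed.

Let v_hit b r : vend b < r < top -> exists x, side xs b x /\ v x = r.
Proof.
move=> /andP[r1 r2]; set s := Num.sqrt ((top - r) / 12).
have q0 : 0 < (top - r) / 12 by lra.
have s0 : 0 < s by rewrite sqrtr_gt0.
have sE : s ^+ 2 = (top - r) / 12 by rewrite sqr_sqrtr // ltW.
have tE := topE b; have /andP[e1 e2] := ep_bounds.
have [x xE] : exists x, ell x = ep + (if b then s else - s).
  pose q := if b then 1 - ep else ep.
  have q_gt0 : 0 < q by rewrite /q; case: (b); lra.
  have qE : q ^+ 2 = (top - vend b) / 12 by rewrite tE /q; case: (b); field.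
  have sq : s < q.
    rewrite ltNge; apply/negP => qs.
    have : q ^+ 2 <= s ^+ 2 by rewrite lerXn2r // nnegrE ltW.
    by rewrite qE sE; lra.
  by apply: ell_surj; rewrite /q in sq; case: (b) sq => sq; apply/andP; split; lra.
exists x; split; last first.
  have xs2 : (ell x - ep) ^+ 2 = s ^+ 2 by rewrite xE; case: (b); ring.
  by rewrite vE xs2 sE; lra.
by case: b r1 tE xE => r1 tE xE; rewrite /side /= ltNge; apply/negP => /ell_le; rewrite xE xsE; lra.
Qed.

Let ra_profile (f : R -> R) : real_analytic f -> real_analytic (fun x => profile (f x)).
Proof.
move=> fa; apply: real_analyticD.
  apply: real_analyticD; first exact: real_analytic_cst.
  by apply: real_analyticM => //; exact: real_analytic_cst.
apply: real_analyticM; first by apply: real_analyticM => //; exact: real_analytic_cst.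
by apply: real_analyticB => //; exact: real_analytic_cst.
Qed.

Let ra_weight (f : R -> R) : real_analytic f -> real_analytic (fun x => weight (f x)).
Proof.
move=> fa; apply: real_analyticB; first exact: real_analytic_cst.
apply: real_analyticM; first exact: real_analytic_cst.
by apply: real_analyticX; apply: real_analyticB => //; exact: real_analytic_cst.
Qed.

(** Both boundary functions are polynomials in [l = ell x], so their limits at the two infinities
    are the values of these polynomials at 0 and 1. *)
Let U (l : R) : R := chebF N (profile l) ^+ p.
Let L (l : R) : R := - (mu * chebF n0 (weight l)).

Let ra_U (f : R -> R) : real_analytic f -> real_analytic (fun x => U (f x)).
Proof. by move=> fa; apply: real_analyticX; apply: real_analytic_chebF; exact: ra_profile. Qed.

Let ra_L (f : R -> R) : real_analytic f -> real_analytic (fun x => L (f x)).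
Proof.
move=> fa; apply: real_analyticN; apply: real_analyticM; first exact: real_analytic_cst.
by apply: real_analytic_chebF; exact: ra_weight.
Qed.

Lemma real_analytic_upper : real_analytic upper.
Proof. exact: (ra_U real_analytic_ell). Qed.

Lemma real_analytic_lower : real_analytic lower.
Proof. exact: (ra_L real_analytic_ell). Qed.

Let U_end b : U (if b then 1 else 0) = 0.
Proof.
have pE : profile (if b then 1 else 0) = vend b by rewrite /profile /d; case: b; ring.
by rewrite /U pE chebF_node0 // expr0n.
Qed.

Let chebF_pm1 M : (0 < M)%N -> chebF M (-1) = 0 :> R /\ chebF M 1 = 0 :> R.
Proof.
by move=> M0; rewrite -{1}(nodeN M0) -{2}(node0 M) chebF_node0 // (chebF_node0 0).
Qed.

Let L_end b : L (if b then 1 else 0) = 0.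
Proof.
have [h1 h2] := chebF_pm1 n0_gt0.
rewrite /L /weight; case: b.
  by rewrite subrr expr0n gtn_eqF //= mulr0 subr0 h2 mulr0 oppr0.
by rewrite subr0 expr1n mulr1 (_ : 1 - 2 = -1 :> R) ?h1 ?mulr0 ?oppr0 //; lra.
Qed.

Let ell_lim b : ell @ (if b then +oo else -oo) --> (if b then 1 else 0 : R).
Proof. by case: b; [exact: ell_cvgy|exact: ell_cvgNy]. Qed.

Let lim_comp (h : R -> R) b : real_analytic h -> h (if b then 1 else 0) = 0 ->
  (fun x => h (ell x)) @ (if b then +oo else -oo) --> (0 : R).
Proof.
move=> ha <-; apply: (@cvg_comp _ _ _ ell h); first exact: ell_lim.
exact: real_analytic_continuous.
Qed.

Lemma upper_cvg b : upper @ (if b then +oo else -oo) --> (0 : R).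
Proof. by apply: (@lim_comp U b) => //; apply: (ra_U (f := id)); exact: real_analytic_id. Qed.

Lemma lower_cvg b : lower @ (if b then +oo else -oo) --> (0 : R).
Proof. by apply: (@lim_comp L b) => //; apply: (ra_L (f := id)); exact: real_analytic_id. Qed.

Let p_odd : odd p. Proof. by rewrite /p /= odd_double. Qed.
Let u (x : R) := chebF N (v x).

Let upper_gt0 x : (0 < upper x) = (0 < u x). Proof. exact: exprn_odd_gt0. Qed.
Let upper_ge0 x : (0 <= upper x) = (0 <= u x). Proof. exact: exprn_odd_ge0. Qed.

Let v_le1 x : 0 < u x -> v x < 1.
Proof.
move=> u0; rewrite ltNge; apply/negP => v1.
by have /andP[_] := @chebF_ge1 R N _ _ v1 (lexx (v x)); rewrite leNgt u0.
Qed.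

Let u_ge0 x : v x <= 1 -> 0 <= u x.
Proof. by move=> v1; apply: chebF_ge0 => //; rewrite v1 ltW. Qed.

Let l1_gt0 : 0 < l1.
Proof.
have /andP[e1 e2] := ep_bounds; rewrite lt_min; apply/andP; split; first by lra.
rewrite divr_gt0 // subr_gt0 /vend /=; apply: node_lt => //.
  by rewrite ltr_nat ltn_predL.
by rewrite ler_nat leq_addr.
Qed.

Let l1_le1 : l1 < 1.
Proof. by have /andP[e1 e2] := ep_bounds; rewrite gt_min; apply/orP; left; lra. Qed.

Let v_left x : ell x < l1 -> x < xs /\ band N n1.-1 (v x).
Proof.
rewrite lt_min => /andP[h1 h2]; have /andP[a0 a1] := ell_bounds x.
have xl : x < xs by rewrite ltNge; apply/negP => /ell_le; rewrite xsE; lra.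
split => //; rewrite /band prednK //; apply/andP; split.
  exact: (@v_gt false x (ltW xl)).
rewrite -(subrK (vend false) (node _ _)) -ltrBlDr.
have : ell x * 24 < node N n1.-1%:R - vend false by rewrite -ltr_pdivlMr.
have /andP[d1 d2] := d_bounds; apply: le_lt_trans.
by rewrite /v /profile; nra.
Qed.

Let l1_le x : u x <= 0 -> l1 <= ell x.
Proof.
rewrite leNgt => /negP h; rewrite leNgt; apply/negP => /v_left[_ bx]; apply: h.
have nN : (n1.-1 < N)%N by rewrite prednK // leq_addr.
by have /andP[] := chebF_band nN bx.
Qed.

Let w_le x y : x <= y -> w x <= w y.
Proof.
move=> xy; rewrite /w /weight lerB // ler_wpM2l // lerXn2r // ?nnegrE ?lerB ?ell_le //.
  by have /andP[_ /ltW] := ell_bounds y; lra.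
by have /andP[_ /ltW] := ell_bounds x; lra.
Qed.

Let w_bounds x : -1 < w x < 1.
Proof.
have /andP[a0 a1] := ell_bounds x; rewrite /w /weight.
have : 0 < (1 - ell x) ^+ K by rewrite exprn_gt0; lra.
have : (1 - ell x) ^+ K < 1 by rewrite exprn_ilt1 ?gtn_eqF //; lra.
by move=> h1 h2; apply/andP; split; lra.
Qed.

Let w_ge x : l1 <= ell x -> node n0 (1 / 2) <= w x.
Proof.
move=> h; have /andP[a0 a1] := ell_bounds x.
have : (1 - ell x) ^+ K <= (1 - l1) ^+ K by rewrite lerXn2r // ?nnegrE; lra.
by rewrite /w /weight; move: K_large; lra.
Qed.

Let chebF_w x : l1 <= ell x -> 2 * (1 - ell x) ^+ K <= chebF n0 (w x).
Proof.
move=> /w_ge h; have /andP[_ /ltW w1] := w_bounds x.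
have := @chebF_ge_first R n0 (w x) n0_gt0; rewrite h w1 => /(_ isT).
by rewrite {1}/w /weight; lra.
Qed.

Let C_gt0 : 0 < C.
Proof.
have /andP[h1 _] := chebU_mono N.-1 (ltW top_gt1) (lexx top); rewrite /C.
rewrite mulr_gt0 //; first by have := top_gt1; lra.
by rewrite exprn_gt0 //; lra.
Qed.

Let mu_gt0 : 0 < mu. Proof. by rewrite exprn_gt0 // mulr_gt0. Qed.

Let v_end x : v x - vend true <= 24 * (1 - ell x).
Proof.
have -> : v x - vend true = (1 - ell x) * (12 * ell x - d) by rewrite /v /profile /d; ring.
by have /andP[a0 a1] := ell_bounds x; have /andP[d1 d2] := d_bounds; nra.
Qed.

(** Only the points with [u x <= 0] matter, and there [ell x >= l1]. The well has depth at least
    [2 * mu * (1 - ell x) ^+ K], while the valley has depth at most [mu * (1 - ell x) ^+ p], which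
    is smaller because [p > K]. *)
Let lower_lt_upper x : lower x < upper x.
Proof.
have /andP[w1 w2] := w_bounds x; have /andP[a0 a1] := ell_bounds x.
have F0 : 0 <= chebF n0 (w x) by apply: chebF_ge0 => //; rewrite !ltW.
have [u0|u0] := ltP 0 (u x).
  by apply: (@le_lt_trans _ _ 0); rewrite ?upper_gt0 // oppr_le0 mulr_ge0 // ltW.
have Fw := chebF_w (l1_le u0).
have K0 : 0 < (1 - ell x) ^+ K by rewrite exprn_gt0 // subr_gt0.
have up : - mu * (1 - ell x) ^+ K <= upper x.
  have [v1|v1] := leP (v x) 1.
    rewrite (@le_trans _ _ 0) ?upper_ge0 ?u_ge0 // mulNr oppr_le0 mulr_ge0 //; exact: ltW.
  have le1 : - u x <= 24 * C * (1 - ell x).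
    apply: le_trans (chebF_lower N (ltW v1) (v_top x)) _; rewrite -/C.
    have := v_end x; have /andP[_ b2] := vend_bounds true; have := C_gt0; nra.
  have -> : upper x = - (- u x) ^+ p.
    by rewrite exprNn -signr_odd p_odd expr1 mulN1r opprK.
  rewrite mulNr lerN2.
  apply: (@le_trans _ _ ((24 * C * (1 - ell x)) ^+ p)).
    have mu0 : 0 <= - u x by rewrite oppr_ge0.
    by rewrite lerXn2r // nnegrE // (le_trans mu0).
  rewrite exprMn.
  apply: ler_wpM2l.
    exact: (ltW mu_gt0).
  have l2 : 0 <= 1 - ell x <= 1 by apply/andP; split; lra.
  have Kp : (K <= p)%N by rewrite /p -addnn -addnS leq_addr.
  case/andP: l2 => l2 l3.
  exact: ler_wiXn2l.
apply: lt_le_trans up; rewrite /lower mulNr ltrN2 ltr_pM2l //; lra.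
Qed.

Let iv_half M i : (i < M)%N -> i%:R + 1 <= M%:R :> R.
Proof. by move=> iM; rewrite natr1 ler_nat. Qed.

Let mBP b i : (i < arm_count b)%N -> side xs b (mB b i) /\ v (mB b i) = node N (i%:R + 1 / 2).
Proof.
move=> ib; have := iv_half ib; have i0 : 0 <= i%:R :> R by [].
move=> iM; have aN : (arm_count b)%:R <= N%:R :> R by rewrite ler_nat.
apply: (@xgetPex R 0 [set x | side xs b x /\ v x = node N (i%:R + 1 / 2)]).
apply: v_hit; apply/andP; split; first by apply: node_lt => //; lra.
by have /andP[_ h] := node_bounds N (i%:R + 1 / 2 : R); apply: le_lt_trans h _.
Qed.

Let zP b : (0 < arm_count b)%N -> side xs b (z b) /\ v (z b) = 1.
Proof.
move=> b0; apply: (@xgetPex R 0 [set x | side xs b x /\ v x = 1]).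
apply: v_hit; rewrite top_gt1 andbT -{1}(node0 N); apply: node_lt => //.
  by rewrite ltr0n.
by rewrite ler_nat.
Qed.

Let mBDP j : (j < n0)%N -> w (mBD j) = node n0 (j%:R + 1 / 2).
Proof.
move=> jn; apply: (@xgetPex R 0 [set x | w x = node n0 (j%:R + 1 / 2)]).
set r := node n0 _; have /andP[r1 r2] : -1 < r < 1 := band_bounds (band_half_node jn).
have cw : continuous weight.
  by apply: real_analytic_continuous; apply: (ra_weight (f := id)); exact: real_analytic_id.
have w0 : weight 0 = -1 by rewrite /weight subr0 expr1n; lra.
have w1 : weight 1 = 1 by rewrite /weight subrr expr0n gtn_eqF //= mulr0 subr0.
have h : Num.min (weight 0) (weight 1) <= r <= Num.max (weight 0) (weight 1).
  by rewrite w0 w1 ge_min le_max (ltW r1) (ltW r2) orbT.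
have [l] := IVT ler01 (continuous_subspaceT cw) h.
rewrite in_itv /= => /andP[l0 l2] lE.
have [|x xE] := @ell_surj R l; last by exists x; rewrite /w xE.
rewrite !lt_neqAle l0 l2 !andbT; apply/andP; split; apply/eqP => E.
  by move: lE; rewrite -E w0; lra.
by move: lE; rewrite E w1; lra.
Qed.

Let cont_v : continuous v.
Proof. exact: real_analytic_continuous (ra_profile real_analytic_ell). Qed.

Let cont_w : continuous w.
Proof. exact: real_analytic_continuous (ra_weight real_analytic_ell). Qed.

Let open_band (f : R -> R) M i : continuous f -> open [set x | band M i (f x)].
Proof.
move=> cf; have -> : [set x | band M i (f x)] =
    f @^-1` [set t | node M i.+1%:R < t] `&` f @^-1` [set t | t < node M i%:R].
  by apply/seteqP; split=> x /=; [move=> /andP[]|move=> [h1 h2]; rewrite /band h1].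
by apply: openI; apply: open_comp.
Qed.

Let between (f : R -> R) x x' r : continuous f ->
  Num.min (f x) (f x') <= r <= Num.max (f x) (f x') ->
  exists2 y, Num.min x x' <= y <= Num.max x x' & f y = r.
Proof.
move=> cf h; have [xx|/ltW xx] := leP x x'.
  by have [y] := IVT xx (continuous_subspaceT cf) h; rewrite in_itv /= => yb yE; exists y.
rewrite minC maxC in h.
by have [y] := IVT xx (continuous_subspaceT cf) h; rewrite in_itv /= => yb yE; exists y.
Qed.

(* leaving a band, f crosses one of the nodes bounding it *)
Let band_exit (f : R -> R) M i x x' : (i < M)%N -> continuous f -> band M i (f x) -> ~~ band M i (f x') ->
  exists2 y, Num.min x x' <= y <= Num.max x x' & chebF M (f y) = 0.
Proof.
move=> iM cf /andP[b1 b2] nb; have M0 : (0 < M)%N by exact: leq_ltn_trans iM.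
have [r rb rE] : exists2 r, Num.min (f x) (f x') <= r <= Num.max (f x) (f x') & chebF M r = 0.
  move: nb; rewrite negb_and -!leNgt => /orP[h|h].
    exists (node M i.+1%:R); last exact: chebF_node0.
    by rewrite ge_min le_max h (ltW b1) orbT.
  exists (node M i%:R); last exact: chebF_node0.
  by rewrite ge_min le_max h (ltW b2) orbT.
by have [y yb yE] := between cf rb; exists y => //; rewrite yE.
Qed.

Let upper_xs : upper xs = - eta.
Proof. by rewrite /upper v_xs opprK. Qed.

Let eta_gt0 : 0 < eta.
Proof. by rewrite oppr_gt0 exprn_odd_lt0 //; exact: chebF_gt1. Qed.

Let lower_bounds x : - mu <= lower x <= 0.
Proof.
have /andP[h1 h2] := w_bounds x.
have F1 : chebF n0 (w x) <= 1 by apply: chebF_le1 => //; exact: ltW.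
have F0 : 0 <= chebF n0 (w x) by apply: chebF_ge0 => //; rewrite !ltW.
rewrite /lower lerN2 oppr_le0 mulr_ge0 ?(ltW mu_gt0) // andbT.
by rewrite -{2}(mulr1 mu) ler_wpM2l // ltW.
Qed.

Let upper_mono x y : u x <= u y -> upper x <= upper y.
Proof. exact: odd_expr_le. Qed.

Let upper_bounds x : - eta <= upper x <= 1.
Proof.
apply/andP; split.
  rewrite -upper_xs; apply: upper_mono; rewrite /u v_xs.
  have [v1|/ltW v1] := leP (v x) 1.
    by apply: (@le_trans _ _ 0); [exact: ltW (chebF_gt1 _ top_gt1)|exact: u_ge0].
  by have /andP[] := chebF_ge1 N v1 (v_top x).
rewrite -(expr1n _ p); apply: odd_expr_le; apply: chebF_le1 => //; exact: ltW.
Qed.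

(** On side [b] the profile stays above its end node, of index [arm_count b], so it meets only bands
    of smaller index. *)
Let upper_cover x : 0 < upper x -> exists b i, (i < arm_count b)%N /\ B b i x.
Proof.
rewrite upper_gt0 => u0.
have [b sb] : exists b, side xs b x.
  have [h|h|h] := ltgtP x xs; [by exists false|by exists true|].
  by move: u0; rewrite h /u v_xs => /(lt_trans (chebF_gt1 N top_gt1)); rewrite ltxx.
have [i iN bi] : exists2 i, (i < N)%N & band N i (v x).
  by apply: band_cover; rewrite ?v_gtN1 ?v_le1 // gt_eqF.
exists b, i; split; last by split.
rewrite ltnNge; apply/negP => bi'; case/andP: bi => _ bi.
have := v_gt (side_le sb); rewrite ltNge => /negP; apply.
by apply: le_trans (ltW bi) _; apply: node_le => //; rewrite ler_nat // ltnW.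
Qed.

Let dcrit x : derive1 ell x = 0 -> derive1 upper x = 0.
Proof.
move=> dx; have -> : upper = U \o ell by [].
rewrite derive1_comp ?dx ?mulr0 //; apply: real_analytic_derivable.
  exact: real_analytic_ell.
by apply: (ra_U (f := id)); exact: real_analytic_id.
Qed.

Let dzero x : u x = 0 -> derive1 upper x = 0.
Proof.
move=> ux; have du : derivable u x 1.
  apply: real_analytic_derivable; apply: real_analytic_chebF.
  exact: (ra_profile real_analytic_ell).
have : is_derive x 1 (u ^+ K.*2.+1) ((K.*2.+1%:R * u x ^+ K.*2) *: derive1 u x).
  by apply: is_deriveX; rewrite derive1E; exact: DeriveDef.
rewrite ux expr0n double_eq0 gtn_eqF //= mulr0 scale0r => -[_]; rewrite derive1E => <-.
congr ('D_1 _ x); apply/funext => y; rewrite /upper -/(u y).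
by rewrite fctE.
Qed.

Let main_band x : l1 <= ell x -> BD 0 x.
Proof.
move=> h; have /andP[_ w1] := w_bounds x; rewrite /BD /= /band (_ : node n0 0%:R = 1) ?node0 // w1 andbT.
apply: lt_le_trans (w_ge h); apply: node_lt => //; [lra|].
by rewrite ler1n.
Qed.

(** Beyond the summit of the hump of largest index the profile is monotone and stays above its end
    node, so it never leaves that band: all far critical points belong to one hump. *)
Let far_band b : (0 < arm_count b)%N -> exists2 i, (i < arm_count b)%N &
  exists M, forall x, (if b then M < x else x < M) -> B b i x.
Proof.
move=> b0; exists (arm_count b).-1; first by rewrite prednK.
have iE : (arm_count b).-1.+1 = arm_count b by rewrite prednK.
have [x0 [sx0 vx0]] : exists x, side xs b x /\ v x = node N ((arm_count b).-1%:R + 1 / 2).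
  by exists (mB b (arm_count b).-1); apply: mBP; rewrite prednK.
exists x0 => x xb.
have sx : side xs b x by case: b sx0 xb {b0 iE vx0} => /=; lra.
split => //; rewrite /band iE; apply/andP; split; first exact: v_gt (side_le sx).
have : v x <= v x0.
  apply: (@v_mono b); case: b sx0 xb {b0 iE vx0 sx} => /= h1 h2; by rewrite !ltW.
move/le_lt_trans; apply; rewrite vx0; apply: node_lt => //; first by lra.
by have := @iv_half N (arm_count b).-1; rewrite prednK ?arm_leN // => /(_ isT); lra.
Qed.

Lemma model_shape : valley_shape lower upper arm_count n0 xs eta mu B mB BD mBD z.
Proof.
have ltN b i : (i < arm_count b)%N -> (i < N)%N by move=> ib; exact: leq_trans (arm_leN b).
have lo0 x : chebF n0 (w x) = 0 -> lower x = 0 by move=> h; rewrite /lower h mulr0 oppr0.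
have up0 x : u x = 0 -> upper x = 0 by move=> h; rewrite /upper -/(u x) h expr0n.
have lo_neg x : (lower x < 0) = (0 < chebF n0 (w x)) by rewrite /lower oppr_lt0 pmulr_rgt0.
have l1_up x : upper x <= 0 -> l1 <= ell x by move=> h; apply: l1_le; rewrite leNgt -upper_gt0 -leNgt.
split.
- exact: eta_gt0.
- have := lower_lt_upper xs; have /andP[h _] := lower_bounds xs.
  by move=> /(le_lt_trans h); rewrite upper_xs ltrN2.
- exact: lower_bounds.
- exact: upper_bounds.
- move=> b i ib; have [sm vm] := mBP ib; split.
  + apply: openI; last exact: open_band.
    by case: b {ib sm vm}; [exact: open_gt|exact: open_lt].
  + by split => //=; rewrite vm; apply: band_half_node; exact: ltN ib.
  + by rewrite /upper vm chebF_half_node ?expr1n.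
  + by move=> x [sx bx]; split=> //; rewrite upper_gt0; have /andP[] := chebF_band (ltN _ _ ib) bx.
- move=> b i x y t ib [sx bx] [st bt] /andP[xy yt].
  have q : Num.min (u x) (u t) <= u y.
    case: b ib sx st => ib sx st.
      rewrite minC; apply: (band_quasi (ltN _ _ ib) bt bx).
      by rewrite !(@v_mono true) ?yt ?xy ?(ltW sx) ?(le_trans (ltW sx) xy).
    apply: (band_quasi (ltN _ _ ib) bx bt).
    by rewrite !(@v_mono false) ?yt ?xy ?(ltW st) ?(le_trans yt (ltW st)).
  by move: q; rewrite !ge_min => /orP[/upper_mono->|/upper_mono->]; rewrite ?orbT.
- move=> b i x x' ib [sx bx] nB.
  have [sx'|nsx'] := boolP (side xs b x'); last first.
    exists xs; last by rewrite upper_xs oppr_le0 ltW.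
    case: b sx nsx' {ib bx nB} => /= sx; rewrite -leNgt => sx'.
      by rewrite ge_min le_max sx' (ltW sx) orbT.
    by rewrite ge_min le_max sx' (ltW sx) orbT.
  have [|y yb yE] := band_exit (ltN _ _ ib) cont_v bx (x' := x').
    by apply/negP => bx'; apply: nB; split.
  by exists y => //; rewrite up0.
- exact: upper_cover.
- move=> b i b' i' x ib ib' [sx bx] [sx' bx'].
  have bb : b = b' by move: sx sx'; case: (b); case: (b') => //=; lra.
  by split=> //; apply: band_disjoint bx bx'; [exact: ltN ib|exact: ltN ib'].
- move=> j jn; have vm := mBDP jn; split.
  + exact: open_band.
  + by rewrite /BD /= vm; apply: band_half_node.
  + by rewrite /lower vm chebF_half_node ?mulr1.
  + by move=> x bx; rewrite lo_neg; have /andP[] := chebF_band jn bx.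
- move=> j x y t jn bx bt /andP[xy yt].
  have q : Num.min (chebF n0 (w x)) (chebF n0 (w t)) <= chebF n0 (w y).
    by apply: (band_quasi jn bx bt); rewrite !w_le.
  rewrite le_max /lower !lerN2 !ler_pM2l //.
  by move: q; rewrite ge_min.
- move=> j x x' jn bx nB.
  have [|y yb yE] := band_exit jn cont_w bx (x' := x'); first by apply/negP.
  by exists y => //; rewrite lo0.
- move=> x; rewrite lo_neg => F0.
  have [j jn bj] : exists2 j, (j < n0)%N & band n0 j (w x).
    by apply: band_cover; rewrite ?w_bounds // gt_eqF.
  by exists j.
- by move=> j j' x jn jn' bj bj'; exact: band_disjoint bj bj'.
- move=> j x j0 jn bx.
  (* From [l1] on only the main well is met, so a secondary well lies to the left, under the
     outermost hump. *)
  have h : ell x < l1.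
    rewrite ltNge; apply/negP => /main_band b0.
    by have := band_disjoint jn n0_gt0 bx b0; move: j0 => /[swap] ->.
  have [xl bv] := v_left h; split => //.
  rewrite ltW // upper_gt0.
  have nN : (n1.-1 < N)%N by rewrite prednK // leq_addr.
  by have /andP[] := chebF_band nN bv.
- exact: n0_gt0.
- by move=> x /ltW/l1_up/main_band.
- exact: upper_xs.
- move=> b x y h; rewrite ge_min.
  have vxy : v x <= v y by apply: (@v_mono b).
  have [v1|/ltW v1] := leP (v x) 1; first by rewrite upper_ge0 u_ge0.
  by rewrite upper_mono ?orbT //; have /andP[] := chebF_ge1 N v1 vxy.
- move=> b t t0.
  have F : ProperFilter (if b then +oo else -oo : set_system R) by case: b; exact: _.
  have sF : \forall x \near (if b then +oo else -oo : set_system R), side xs b x.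
    by case: b {F}; [apply: nbhs_pinfty_gt|apply: nbhs_ninfty_lt]; exact: num_real.
  have Nt0 : 0 < - t by rewrite oppr_gt0.
  have /cvgrPdist_lt/(_ _ Nt0) up := upper_cvg b.
  have [x [sx]] := filter_ex (filterI sF up).
  by rewrite sub0r => /ltr_normlW h; exists x => //; lra.
- exact: n1_gt0.
- move=> b x sx u0; rewrite lt0n; apply/eqP => b0.
  (* Without humps on side [b] the profile ends at node 0, which is 1; it stays above 1 on that side
     and [upper] is negative there. *)
  have := v_gt (side_le sx); rewrite /vend b0 node0 => /(chebF_gt1 N).
  by move: u0; rewrite upper_ge0 leNgt => /negP.
- move=> b b0; have [sz vz] := zP b0.
  have uz : u (z b) = 0 by rewrite /u vz; have [] := chebF_pm1 N_gt0.
  split => //; [exact: up0|exact: dzero|].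
  by apply: main_band; apply: l1_up; rewrite up0.
- move=> b b0; have [i ib [M MP]] := far_band b0; exists i => // e e0.
  have F : ProperFilter (if b then +oo else -oo : set_system R) by case: (b); exact: _.
  have /cvgrPdist_lt/(_ _ e0) up := upper_cvg b.
  have [M' M'P] : exists M', forall x, (if b then M' < x else x < M') -> upper x < e.
    case: (b) up => -[M' [_ M'P]]; exists M' => x /M'P /=; rewrite sub0r normrN => /ltr_normlW; lra.
  (* A critical point of the sigmoid, far enough out to lie in the last band and to have a value
     below [e]; the chain rule makes it critical for [upper]. *)
  have [x [xM dx]] := ell_critical b (if b then Num.max M M' else Num.min M M').
  exists x; split; last exact: dcrit.
    by apply: MP; case: (b) xM; rewrite ?gt_max ?lt_min => /andP[].
  by apply: M'P; case: (b) xM; rewrite ?gt_max ?lt_min => /andP[].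
- move=> t0 t00.
  have mB0 : (0 < arm_count false)%N by [].
  have up1 : upper (mB false 0) = 1.
    by have [_ vm] := mBP mB0; rewrite /upper vm chebF_half_node ?expr1n.
  have [e1 e10 E1] : exists2 e, 0 < e & forall x, derive1 upper x = 0 -> 0 < `|upper x - t0| < e -> False.
    apply: critical_values_discrete => //; [exact: real_analytic_upper| |exact: (upper_cvg false)|exact: (upper_cvg true)].
    by exists xs, (mB false 0%N); rewrite up1 upper_xs lt_eqF //; have := eta_gt0; lra.
  have lo1 : lower (mBD 0) = - mu by rewrite /lower mBDP // chebF_half_node ?mulr1.
  have [e2 e20 E2] : exists2 e, 0 < e & forall x, derive1 lower x = 0 -> 0 < `|lower x - t0| < e -> False.
    apply: critical_values_discrete => //; [exact: real_analytic_lower| |exact: (lower_cvg false)|exact: (lower_cvg true)].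
    have /cvgrPdist_lt/(_ _ mu_gt0)/filter_ex[x] := lower_cvg true.
    rewrite sub0r normrN => h; exists (mBD 0%N), x; rewrite lo1; apply/eqP => E.
    by move: h; rewrite -E normrN gtr0_norm // ltxx.
  exists (Num.min e1 e2); first by rewrite lt_min e10.
  move=> x; split=> dx; rewrite lt_min => /and3P[h1 h2 h3].
    by apply: E2 dx _; rewrite h1.
  by apply: E1 dx _; rewrite h1.
Qed.

Lemma model_functions : exists c1 c2 : R -> R,
  [/\ zero_set_pair c1 c2, SAB_at_infinity_in_top c1 c2,
      forall t, exists x, ~~ in_strip c1 c2 t x
    & exists xs eta mu B m BD mD z, valley_shape c1 c2 arm_count n0 xs eta mu B m BD mD z].
Proof.
exists lower, upper; split.
- by split; [exact: real_analytic_lower|exact: real_analytic_upper|exact: lower_lt_upper].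
- split; apply: Or31; exists 0; split.
  + exact: (lower_cvg false).
  + exact: (upper_cvg false).
  + exact: (lower_cvg true).
  + exact: (upper_cvg true).
- move=> t; have [t0|t0|->] := ltgtP t 0.
  + have Nt0 : 0 < - t by rewrite oppr_gt0.
    have /cvgrPdist_lt/(_ _ Nt0)/filter_ex[x] := lower_cvg true.
    by rewrite sub0r normrN ltr_norml opprK => /andP[h _]; exists x; rewrite /in_strip negb_and -!ltNge h.
  + have /cvgrPdist_lt/(_ _ t0)/filter_ex[x] := upper_cvg true.
    by rewrite sub0r normrN => /ltr_normlW h; exists x; rewrite /in_strip negb_and -!ltNge h orbT.
  + by exists xs; rewrite /in_strip negb_and -!ltNge upper_xs oppr_lt0 eta_gt0 orbT.
- by exists xs, eta, mu, B, mB, BD, mBD, z; exact: model_shape.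
Qed.

(** [ep] and [l1] depend on [n1] and [n2] alone, so these bounds are available before the section
    parameters [xs] and [K] are chosen from them. *)
Lemma model_parameters : 0 < ep < 1 /\ 0 < l1 < 1.
Proof.
split; last by rewrite l1_gt0 l1_le1.
by have /andP[h1 h2] := ep_bounds; apply/andP; split; lra.
Qed.

End Model.

Lemma expr_small {R : realType} (a e : R) : 0 < a < 1 -> 0 < e ->
  exists2 K, (0 < K)%N & (1 - a) ^+ K <= e.
Proof.
move=> /andP[a0 a1] e0; have na : `|1 - a| < 1.
  by rewrite ger0_norm ?gtrBl // subr_ge0 ltW.
have /cvgrPdist_lt/(_ _ e0)[M _ MP] := cvg_expr na.
exists M.+1 => //; have /= := MP M.+1 (leqnSn _).
by rewrite sub0r normrN => /ltr_normlW/ltW.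
Qed.

Lemma valley_functions_exist {R : realType} (n1 n2 n0 : nat) : (0 < n1)%N -> (0 < n0)%N ->
  exists c1 c2 : R -> R,
  [/\ zero_set_pair c1 c2, SAB_at_infinity_in_top c1 c2,
      forall t, exists x, ~~ in_strip c1 c2 t x
    & exists xs eta mu B m BD mD z,
        valley_shape c1 c2 (fun b => if b then n2 else n1) n0 xs eta mu B m BD mD z].
Proof.
move=> n1_gt0 n0_gt0; have [/= ep01 l01] := @model_parameters R n1 n2 n1_gt0.
have [xs xsE] := ell_surj ep01.
have n01 : 1 <= n0%:R :> R by rewrite ler1n.
have e0 : 0 < (1 - node n0 (1 / 2)) / 2 :> R.
  have : node n0 (1 / 2) < node n0 0 :> R by apply: node_lt => //; lra.
  by rewrite node0 => h; rewrite divr_gt0 // subr_gt0.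
have [K K0 KP] := expr_small l01 e0.
exact: (model_functions n1_gt0 n0_gt0 K0 xsE KP).
Qed.

(** * Graph diagrams *)

Section GraphDiagram.
Context {G : Type} (nU : bool -> nat) (n0 : nat).
Local Notation index := ((bool * nat) + nat)%type.
Context (piece : index -> set G) (ep : bool -> G).
Context (comps : set (set G)) (N : set G) (rule : set G -> set G -> Prop).
Context (Mx Mn : set G -> G -> Prop).
Implicit Types (k : index) (b : bool) (i j : nat) (C : set G).

Let valid b := (0 < nU b)%N.
Let pieces : set index :=
  [set k | match k with inl (b, i) => (i < nU b)%N | inr j => (j < n0)%N end].

Hypothesis n0_gt0 : (0 < n0)%N.
Hypothesis valid_false : valid false.
Hypothesis compsE : comps = piece @` pieces.
Hypothesis piece_inj : forall k k', pieces k -> pieces k' -> piece k = piece k' -> k = k'.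
Hypothesis NE : N = [set g | exists2 b, valid b & g = ep b].
Hypothesis ep_inj : forall b b', valid b -> valid b' -> ep b = ep b' -> b = b'.
Hypothesis ruleE : forall C C', rule C C' <-> [/\ comps C, comps C' &
  exists2 s, N s & (Mx C s /\ Mx C' s) \/ (Mn C s /\ Mn C' s)].
Hypothesis Mn_up : forall b i, (i < nU b)%N -> Mn (piece (inl (b, i))) (ep b).
Hypothesis Mx_down : forall j, (0 < j)%N -> (j < n0)%N -> Mx (piece (inr j)) (ep false).
Hypothesis Mx_main : forall b, valid b -> Mx (piece (inr 0%N)) (ep b).
Hypothesis not_Mx_up : forall b i b', valid b' -> ~ Mx (piece (inl (b, i))) (ep b').
Hypothesis not_Mn_down : forall j b', valid b' -> ~ Mn (piece (inr j)) (ep b').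
Hypothesis Mn_side : forall b i b', (i < nU b)%N -> valid b' ->
  Mn (piece (inl (b, i))) (ep b') -> b = b'.

(** The complete invariant of the equivalence: humps are classified by their side, and all wells
    fall into the class [None]. *)
Let kind k : option bool := match k with inl (b, _) => Some b | inr _ => None end.
Let valid_kind (o : option bool) := if o is Some b then valid b else true.
Let cls (o : option bool) : set (set G) := piece @` [set k | pieces k /\ kind k = o].

Let rst := clos_refl_sym_trans (set G) rule.
Let class C : set (set G) := [set C' | comps C' /\ rst C C'].
Let classes : set (set (set G)) := [set V | exists2 C, comps C & V = class C].

Let pieces_valid k : pieces k -> valid_kind (kind k).
Proof. by case: k => [[b i]|j] //= ib; exact: leq_ltn_trans ib. Qed.

Let rule_kind k k' : pieces k -> pieces k' -> rule (piece k) (piece k') -> kind k = kind k'.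
Proof.
move=> pk pk' /ruleE[_ _ [s]]; rewrite NE => -[b vb ->] [[]|[]].
  case: k pk => [[a i]|j] pk; first by move=> /(not_Mx_up vb).
  by case: k' pk' => [[a' i']|j'] pk' // _ /(not_Mx_up vb).
case: k pk => [[a i]|j] pk; last by move=> /(not_Mn_down vb).
case: k' pk' => [[a' i']|j'] pk' h; last by move=> /(not_Mn_down vb).
by move=> /(Mn_side pk' vb) /= ->; rewrite (Mn_side pk vb h).
Qed.

Let comps_piece k : pieces k -> comps (piece k).
Proof. by move=> pk; rewrite compsE; exists k. Qed.

Let kind_rst k k' : pieces k -> pieces k' -> kind k = kind k' -> rst (piece k) (piece k').
Proof.
move=> pk pk' kk; apply: rst_step; apply/ruleE; split; [exact: comps_piece|exact: comps_piece|].
have down j : (j < n0)%N -> Mx (piece (inr j)) (ep false).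
  by case: j => [_|j jn]; [exact: Mx_main|exact: Mx_down].
case: k k' pk pk' kk => [[b i]|j] [[b' i']|j'] //= pk pk' kk.
  move: kk pk' => -[<-] pk'; exists (ep b); last by right; split; exact: Mn_up.
  by rewrite NE; exists b => //; exact: leq_ltn_trans pk.
exists (ep false); last by left; split; exact: down.
by rewrite NE; exists false.
Qed.

(** The closure is taken over all sets and is reflexive also outside the components, hence the
    separate case of equality; otherwise both sets are pieces, and injectivity of [piece] lets the
    kinds be compared across transitivity. *)
Let rst_kind C C' : rst C C' -> comps C \/ C = C' ->
  C = C' \/ exists k k', [/\ pieces k, pieces k', C = piece k, C' = piece k' & kind k = kind k'].
Proof.
move=> h _; elim: h => {C C'}.
- move=> C C' r; right; have /ruleE[] := r; rewrite compsE => -[k pk kE] [k' pk' kE'] _.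
  by exists k, k'; split => //; apply: rule_kind => //; rewrite kE kE'.
- by move=> C; left.
- move=> C C' _ [->|[k [k' [h1 h2 h3 h4 h5]]]]; first by left.
  by right; exists k', k.
- move=> C C' C'' _ [->//|[k [k' [h1 h2 h3 h4 h5]]]] _ [<-|[l [l' [g1 g2 g3 g4 g5]]]].
    by right; exists k, k'.
  right; exists k, l'; split => //; rewrite h5 -g5; congr kind.
  by apply: piece_inj => //; rewrite -h4.
Qed.

Let class_piece k : pieces k -> class (piece k) = cls (kind k).
Proof.
move=> pk; apply/seteqP; split=> C.
  move=> [cC /rst_kind[]]; first by left; exact: comps_piece.
    by move=> <-; exists k.
  move=> [l [l' [h1 h2 h3 -> h5]]]; exists l' => //; split => //.
  by rewrite -h5; congr kind; apply: piece_inj.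
move=> [k' [pk' kk] <-]; split; first exact: comps_piece.
exact: kind_rst.
Qed.

Let rep (o : option bool) : index := if o is Some b then inl (b, 0%N) else inr 0%N.

Let rep_pieces o : valid_kind o -> pieces (rep o). Proof. by case: o. Qed.
Let kind_rep o : kind (rep o) = o. Proof. by case: o. Qed.

Let classesP V : classes V <-> exists2 o, valid_kind o & V = cls o.
Proof.
split=> [[C]|[a vo ->]].
  rewrite compsE => -[k pk <-] ->; exists (kind k); first exact: pieces_valid.
  exact: class_piece.
have po := rep_pieces vo; exists (piece (rep a)); first exact: comps_piece.
by rewrite class_piece // kind_rep.
Qed.

Let cls_inj o o' : valid_kind o -> cls o = cls o' -> o = o'.
Proof.
move=> vo E; have : cls o (piece (rep o)).
  by exists (rep o) => //; split; [exact: rep_pieces|exact: kind_rep].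
rewrite E => -[k [pk <-]] /(piece_inj pk (rep_pieces vo)) ->.
by rewrite kind_rep.
Qed.

Let cls_card o : cls o #= `I_(if o is Some b then nU b else n0).
Proof.
case: o => [b|].
  have -> : cls (Some b) = (fun i => piece (inl (b, i))) @` `I_(nU b).
    apply/seteqP; split=> C.
      by case=> -[[b' i]|j] [/= pk kk] <- //; case: kk pk => -> pk; exists i.
    by move=> [i ib <-]; exists (inl (b, i)).
  apply: inj_card_eq => i i' /set_mem ib /set_mem ib' E.
  by have [] := @piece_inj (inl (b, i)) (inl (b, i')) ib ib' E.
have -> : cls None = (fun j => piece (inr j)) @` `I_n0.
  apply/seteqP; split=> C; first by case=> -[[b' i]|j] [/= pk kk] <- //; exists j.
  by move=> [i ib <-]; exists (inr i).
apply: inj_card_eq => i i' /set_mem ib /set_mem ib' E.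
by have [] := @piece_inj (inr i) (inr i') ib ib' E.
Qed.

Context (K : diagram) (nK : vertex K -> nat).
Context (nu : option bool -> vertex K) (nu' : vertex K -> option bool).
Context (ed : bool -> edge K) (ed' : edge K -> bool).
Hypothesis nu'K : cancel nu' nu.
Hypothesis nuK : forall o, valid_kind o -> nu' (nu o) = o.
Hypothesis nu'_valid : forall x, valid_kind (nu' x).
Hypothesis ed'K : cancel ed' ed.
Hypothesis edK : forall b, valid b -> ed' (ed b) = b.
Hypothesis ed'_valid : forall x, valid (ed' x).
Hypothesis nK_nu : forall o, valid_kind o -> nK (nu o) = if o is Some b then nU b else n0.
Context (dep ent : edge K -> vertex K -> Prop).
Hypothesis depE : forall b o, valid b -> valid_kind o -> dep (ed b) (nu o) <-> o = None.
Hypothesis entE : forall b o, valid b -> valid_kind o -> ent (ed b) (nu o) <-> o = Some b.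

(** The target diagram is presented by kinds and sides, with inverse maps required only where the
    side carries humps. One statement thus serves the diagram with a single edge and those with
    two. *)
Lemma diagram_of_pieces : exists (f : set_type classes -> vertex K) (g : set_type N -> edge K),
  [/\ bijective f, bijective g,
      forall e v, (exists2 C, set_val v C & Mx C (set_val e)) <-> dep (g e) (f v),
      forall e v, (exists2 C, set_val v C & Mn C (set_val e)) <-> ent (g e) (f v)
    & forall v, set_val v #= `I_(nK (f v))].
Proof.
have val_eq (T : Type) (A : set T) (x y : set_type A) : set_val x = set_val y -> x = y.
  by rewrite set_valE; exact: val_inj.
have vo (v : set_type classes) : exists o, valid_kind o /\ set_val v = cls o.
  have /classesP[a h1 h2] : classes (set_val v) by exact: set_valP.
  by exists a.
have eb (e : set_type N) : exists b, valid b /\ set_val e = ep b.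
  by have := set_valP e; rewrite {1}NE => -[b h1 h2]; exists b.
pose ov v := projT1 (cid (vo v)).
have ovP v : valid_kind (ov v) /\ set_val v = cls (ov v) := projT2 (cid (vo v)).
pose be e := projT1 (cid (eb e)).
have beP e : valid (be e) /\ set_val e = ep (be e) := projT2 (cid (eb e)).
have mkv x : classes (cls (nu' x)) by apply/classesP; exists (nu' x).
have mke x : N (ep (ed' x)) by rewrite NE; exists (ed' x).
pose f' x : set_type classes := exist (fun V => V \in classes) _ (mem_set (mkv x)).
pose g' x : set_type N := exist (fun s => s \in N) _ (mem_set (mke x)).
exists (fun v => nu (ov v)), (fun e => ed (be e)); split.
- exists f' => [v|x].
    have [h E] := ovP v; apply: val_eq; rewrite E.
    by change (cls (nu' (nu (ov v))) = cls (ov v)); rewrite nuK.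
  have [h E] := ovP (f' x); rewrite -[RHS]nu'K; congr nu.
  by apply/esym/cls_inj.
- exists g' => [e|x].
    have [h E] := beP e; apply: val_eq; rewrite E.
    by change (ep (ed' (ed (be e))) = ep (be e)); rewrite edK.
  have [h E] := beP (g' x); rewrite -[RHS]ed'K; congr ed.
  by apply/esym/ep_inj.
- move=> e v; have [ve ->] := beP e; have [vv ->] := ovP v; rewrite depE //.
  split; last by move=> ->; exists (piece (inr 0%N)); [exists (inr 0%N)|exact: Mx_main].
  move=> [_ [[[b i]|j] [pk <-] <-]] //.
  by move=> /(not_Mx_up ve).
- move=> e v; have [ve ->] := beP e; have [vv ->] := ovP v; rewrite entE //.
  split; last first.
    by move=> ->; exists (piece (inl (be e, 0%N))); [exists (inl (be e, 0%N))|exact: Mn_up].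
  move=> [_ [[[b i]|j] [pk <-] <-]] //.
    by move=> /(Mn_side pk ve) /= ->.
  by move=> /(not_Mn_down ve).
- by move=> v; have [vv ->] := ovP v; rewrite nK_nu //; exact: cls_card.
Qed.

End GraphDiagram.

(** * Changing the sign of the level function *)

Section Opposite.
Context {R : realType} {G : topologicalType} (S : set G) (c : G -> R).
Local Notation cN := (fun g => - c g).

Lemma maximal_atN : maximal_at S cN = minimal_at S c.
Proof.
by rewrite /maximal_at /minimal_at; congr extremal_at; apply/funext => z; apply/funext => s; rewrite lerN2.
Qed.

Lemma minimal_atN : minimal_at S cN = maximal_at S c.
Proof.
by rewrite /maximal_at /minimal_at; congr extremal_at; apply/funext => z; apply/funext => s; rewrite lerN2.
Qed.

(** The generating rule asks for two maxima or two minima at a common point, so it is invariant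
    under exchanging the two. *)
Lemma NF_classesN : NF_classes S cN = NF_classes S c.
Proof.
suff rE : NF_rule S cN = NF_rule S c by rewrite /NF_classes /NF_class rE.
apply/funext => C; apply/funext => C'; apply/propext; rewrite /NF_rule maximal_atN minimal_atN.
by split=> -[h1 h2 [s Ns h]]; split => //; exists s => //; case: h; [right|left|right|left].
Qed.

Lemma pre_digraphN : pre_digraph S cN -> pre_digraph S c.
Proof.
move=> [cc h2 h3 h4]; split => //.
  move=> g; have -> : c = (fun h => - (- c h)) by apply/funext => h; rewrite opprK.
  by apply: cvgN; exact: cc.
by move=> e he x y xe ye E; apply: h4 ye _; rewrite ?E.
Qed.

End Opposite.

Section ShapeDiagram.
Context {R : realType} {G : topologicalType} (c1 c2 : R -> R).
Context (c : G -> R) (Q : R * R -> G) (S : set G).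
Context (nU : bool -> nat) (n0 : nat) (xs eta mu : R).
Context (B : bool -> nat -> set R) (m : bool -> nat -> R).
Context (BD : nat -> set R) (mD : nat -> R) (z : bool -> R).
Hypothesis PR : planar_reeb c1 c2 c Q S.
Hypothesis SH : valley_shape c1 c2 nU n0 xs eta mu B m BD mD z.

Lemma shape_diagram (K : diagram) (nK : vertex K -> nat)
    (nu : option bool -> vertex K) (nu' : vertex K -> option bool)
    (ed : bool -> edge K) (ed' : edge K -> bool)
    (dep ent : edge K -> vertex K -> Prop) :
  let valid (o : option bool) := if o is Some b then (0 < nU b)%N else true in
  cancel nu' nu -> (forall o, valid o -> nu' (nu o) = o) -> (forall x, valid (nu' x)) ->
  cancel ed' ed -> (forall b, (0 < nU b)%N -> ed' (ed b) = b) ->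
  (forall x, (0 < nU (ed' x))%N) ->
  (forall o, valid o -> nK (nu o) = if o is Some b then nU b else n0) ->
  (forall b o, (0 < nU b)%N -> valid o -> dep (ed b) (nu o) <-> o = None) ->
  (forall b o, (0 < nU b)%N -> valid o -> ent (ed b) (nu o) <-> o = Some b) ->
  exists (f : set_type (NF_classes S c) -> vertex K) (g : set_type (NF R S) -> edge K),
  [/\ bijective f, bijective g,
      forall e v, (exists2 C, set_val v C & maximal_at S c C (set_val e)) <-> dep (g e) (f v),
      forall e v, (exists2 C, set_val v C & minimal_at S c C (set_val e)) <-> ent (g e) (f v)
    & forall v, set_val v #= `I_(nK (f v))].
Proof.
move=> valid nu'K nuK nu'v ed'K edK ed'v nKE depE entE.
apply: (@diagram_of_pieces G nU n0 (piece c1 c2 Q B BD) (end_point Q z)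
  (@NF_components R G S) (NF R S) (NF_rule S c) (maximal_at S c) (minimal_at S c)
  (sh_n0 SH) (sh_nU SH) (NF_components_shape PR SH) _ (NF_shapeE PR SH) _ _ _ _ _ _ _ _
  K nK nu nu' ed ed') => //.
- exact: (piece_inj PR SH).
- exact: (end_point_inj PR SH).
- exact: (minimal_at_up PR SH).
- exact: (maximal_at_down PR SH).
- exact: (maximal_at_main PR SH).
- exact: (not_maximal_up PR SH).
- exact: (not_minimal_down PR SH).
- exact: (minimal_at_up_side PR SH).
Qed.

End ShapeDiagram.

Theorem diagram_realization (R : realType) (m : nat) (hm : (1 < m)%N) (K : diagram) :
  [\/ K = segment_diagram, K = two_out_diagram | K = two_in_diagram] ->
  forall n : vertex K -> nat, (forall v, (0 < n v)%N) ->
  exists c1 c2 : R -> R,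
    [/\ zero_set_pair c1 c2, SAB_at_infinity_in_top c1 c2, zero_set_pre_digraph m c1 c2
      & exists (f : vertex (zero_set_GDNF m c1 c2) -> vertex K)
               (g : edge (zero_set_GDNF m c1 c2) -> edge K),
          is_diagram_iso f g /\
          forall v : vertex (zero_set_GDNF m c1 c2), class_of_vertex v #= `I_(n (f v))].
Proof.
case=> -> n n_gt0.
(* With no hump on the right, only the left end is NF: the wells form its initial vertex and the
   humps its final one. *)
- have [c1 [c2 [c12 SAB ns [xs [eta [mu [B [mB [BD [mD [z SH]]]]]]]]]]] :=
    @valley_functions_exist R (n true) 0 (n false) (n_gt0 true) (n_gt0 false).
  have PR := zero_set_planar_reeb hm c12 ns.
  exists c1, c2; split => //; first exact: (shape_pre_digraph PR SH).
  have [|||||||||f [g [bf bg h1 h2 h3]]] := @shape_diagram _ _ _ _ _ _ _ _ _ _ _ _ _ _ _ _ _ PR SH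
    segment_diagram n (fun o => if o is Some _ then true else false)
    (fun x => if x then Some false else None) (fun=> tt) (fun=> false)
    (fun _ v => v = false) (fun _ v => v = true); last by exists f, g; split.
  + by case.
  + by case=> [[]|].
  + by case=> //=; exact: n_gt0.
  + by case.
  + by case.
  + by move=> x; exact: n_gt0.
  + by case=> [[]|].
  + by move=> b [[]|].
  + by move=> [] [[]|].
- have [c1 [c2 [c12 SAB ns [xs [eta [mu [B [mB [BD [mD [z SH]]]]]]]]]]] :=
    @valley_functions_exist R (n (Some false)) (n (Some true)) (n None) (n_gt0 _) (n_gt0 _).
  have PR := zero_set_planar_reeb hm c12 ns.
  exists c1, c2; split => //; first exact: (shape_pre_digraph PR SH).
  have [|||||||||f [g [bf bg h1 h2 h3]]] := @shape_diagram _ _ _ _ _ _ _ _ _ _ _ _ _ _ _ _ _ PR SH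
    two_out_diagram n id id id id
    (fun _ v => v = None) (fun e v => v = Some e); last by exists f, g; split.
  + by [].
  + by [].
  + by case=> [[]|] //=; exact: n_gt0.
  + by [].
  + by [].
  + by case=> //=; exact: n_gt0.
  + by case=> [[]|].
  + by [].
  + by [].
- have [d1 [d2 [d12 SAB ns [xs [eta [mu [B [mB [BD [mD [z SH]]]]]]]]]]] :=
    @valley_functions_exist R (n (Some false)) (n (Some true)) (n None) (n_gt0 _) (n_gt0 _).
  (* The shape of the preceding case turned upside down: both ends are still NF, and maxima and
     minima at them are exchanged. *)
  pose c1 x := - d2 x; pose c2 x := - d1 x.
  have c12 : zero_set_pair c1 c2.
    case: d12 => a1 a2 lt12; split; [exact: real_analyticN|exact: real_analyticN|].
    by move=> x; rewrite ltrN2.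
  have nsc t : exists x, ~~ in_strip c1 c2 t x.
    by have [x h] := ns (- t); exists x; rewrite /in_strip /c1 /c2 lerNl lerNr andbC.
  have PR0 := planar_reebN (zero_set_planar_reeb hm c12 nsc).
  have E1 : (fun x => - c2 x) = d1 by apply/funext => x; rewrite opprK.
  have E2 : (fun x => - c1 x) = d2 by apply/funext => x; rewrite opprK.
  rewrite E1 E2 in PR0.
  exists c1, c2; split => //.
  + case: SAB => SABl SABr; split; [move: SABl|move: SABr] => -[[l [h1 h2]]|[h1 h2]|[h1 h2]].
    * by apply: Or31; exists (- l); split; exact: cvgN.
    * by apply: Or33; split; apply/cvgNry.
    * by apply: Or32; split; apply/cvgNrNy.
    * by apply: Or31; exists (- l); split; exact: cvgN.
    * by apply: Or33; split; apply/cvgNry.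
    * by apply: Or32; split; apply/cvgNrNy.
  + exact: pre_digraphN (shape_pre_digraph PR0 SH).
  have [|||||||||f [g]] := @shape_diagram _ _ _ _ _ _ _ _ _ _ _ _ _ _ _ _ _ PR0 SH
    two_in_diagram n id id id id (fun _ v => v = None) (fun e v => v = Some e).
  + by [].
  + by [].
  + by case=> [[]|] //=; exact: n_gt0.
  + by [].
  + by [].
  + by case=> //=; exact: n_gt0.
  + by case=> [[]|].
  + by [].
  + by [].
  move: f g; rewrite NF_classesN maximal_atN minimal_atN => f g [bf bg h1 h2 h3].
  by exists f, g; split.
Qed.

Lemma extend_from_set_type (T U : topologicalType) (A : set T) (f : A -> U) (u0 : U) :
  continuous f -> exists F : T -> U, {within A, continuous F} /\ forall a : A, F (set_val a) = f a.
Proof.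
move=> cf.
pose F t := if pselect (A t) is left At then f (exist (fun x => x \in A) t (mem_set At)) else u0.
have FE a : F (set_val a) = f a.
  rewrite /F; case: pselect => [At|nA]; last by case: nA; exact: set_valP.
  by congr f; apply: val_inj.
exists F; split => //; apply/subspace_sigL_continuousP.
by have -> : sigL A F = f by apply/funext => a; rewrite -FE.
Qed.

(** * Rays *)

Section EdgeTopology.
Context {R : realType} {G : topologicalType} (S : set G) (c : G -> R).
Hypothesis pd : pre_digraph S c.

Lemma edge_param e : edges S e -> exists F : R -> G,
  {within openD1 R, continuous F} /\ F @` openD1 R = e.
Proof.
move=> ee; have [_ _ [_ _ _ he _] _] := pd.
have [f [g [cf cg fK gK]]] := he e ee.
have [x0 _ eE] := ee.
have cF : continuous (fun a => set_val (f a)).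
  by move=> a; apply: continuous_comp; [exact: cf|exact: set_val_continuous].
have [F [cFw FE]] := extend_from_set_type x0 cF.
exists F; split => //; apply/seteqP; split=> [_ [r r1 <-]|h eh].
  have := FE (exist (fun x => x \in openD1 R) r (mem_set r1)).
  by rewrite {1}set_valE /= => ->; exact: set_valP.
pose h' : e := exist (fun x => x \in e) h (mem_set eh).
exists (set_val (g h')); first exact: set_valP.
by rewrite FE gK.
Qed.

(** A pre-digraph does not require [S] to be closed, so openness is only relative to its complement.
    It comes from the homeomorphism with a disjoint union: the image of the summand through a point
    is connected, hence contained in the edge of that point. *)
Lemma edge_relatively_open e : edges S e -> exists2 W, open W & e = W `&` ~` S.
Proof.
move=> ee; have [_ [I [f [g [cf cg fK gK]]]] _ _] := pd.
have [x0 Sx0 eE] := ee.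
have eS : e `<=` ~` S by rewrite eE; exact: connected_component_sub.
exists (\bigcup_(W in [set W | open W /\ W `&` ~` S `<=` e]) W).
  by apply: bigcup_open => W [].
apply/seteqP; split=> [h eh|h [[W [_ Oe] Oh] Sh]]; last exact: Oe.
split; last exact: eS.
pose h' : ~` S := exist (fun x => x \in ~` S) h (mem_set (eS _ eh)).
case gE : (g h') => [i r0].
have oW : open (g @^-1` (existT (fun _ => openD1 R : topologicalType) i @` setT)).
  by apply: open_comp => [x _|]; [exact: cg|apply: existT_open_map; exact: openT].
have [W oO OE] := oW.
exists W; last by have : (set_val @^-1` W) h' by rewrite OE; exists r0.
split => // y [Oy Sy].
pose y' : ~` S := exist (fun x => x \in ~` S) y (mem_set Sy).
have [r _ rE] : (g @^-1` (existT (fun _ => openD1 R : topologicalType) i @` setT)) y' by rewrite -OE.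
have cF : continuous (fun a : openD1 R => set_val (f (existT (fun _ => openD1 R : topologicalType) i a))).
  move=> a; apply: continuous_comp; last exact: set_val_continuous.
  by apply: continuous_comp; [exact: existT_continuous|exact: cf].
have [F [cFw FE]] := extend_from_set_type x0 cF.
have cP : connected (F @` openD1 R).
  apply: connected_continuous_connected => //.
  by apply/connected_intervalP; exact: interval_is_interval.
have Fh : (F @` openD1 R) h.
  by exists (set_val r0); [exact: set_valP|rewrite FE -gE gK].
have Fy : (F @` openD1 R) y.
  by exists (set_val r); [exact: set_valP|rewrite FE rE gK].
have PS : F @` openD1 R `<=` ~` S.
  move=> _ [a a1 <-].
  pose a' : openD1 R := exist (fun x => x \in openD1 R) a (mem_set a1).
  have -> : F a = F (set_val a') by [].
  rewrite FE; exact: (set_valP (f (existT (fun _ => openD1 R : topologicalType) i a'))).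
have := connected_component_max Fh PS cP Fy.
by have := eh; rewrite {1 2}eE; exact: connected_component_trans.
Qed.

Lemma edge_sub e : edges S e -> e `<=` ~` S.
Proof. by move=> [x _ ->]; exact: connected_component_sub. Qed.

Lemma edge_connected e : edges S e -> connected e.
Proof. by move=> [x _ ->]; exact: component_connected. Qed.

Lemma edge_mem g : ~ S g -> edges S (connected_component (~` S) g) /\ connected_component (~` S) g g.
Proof. by move=> Sg; split; [exists g|exact: connected_component_refl]. Qed.

Lemma edge_meet e e' g : edges S e -> edges S e' -> e g -> e' g -> e = e'.
Proof.
move=> ee ee' eg e'g; have [_ _ [_ _ tr _ _] _] := pd.
by apply: tr => //; exists g.
Qed.

(** Otherwise [s] lies on an edge; being relatively open, this edge meets one of the accumulating
    edges and so equals it, which puts [s] inside [C]. *)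
Lemma extremal_at_mem (le : G -> G -> Prop) C s : C `<=` ~` [set s] -> extremal_at S le C s -> S s.
Proof.
move=> Cs [J [_ Je JC sJ _]]; apply: contrapT => Ss.
have [ee es] := edge_mem Ss; have [W oO eO] := edge_relatively_open ee.
have Os : W s by move: es; rewrite eO => -[].
have [h [[e' Je' e'h] Oh]] := sJ W (open_nbhs_nbhs (conj oO Os)).
have eh : connected_component (~` S) s h by rewrite eO; split => //; exact: edge_sub (Je _ Je') _ e'h.
have E := edge_meet ee (Je _ Je') eh e'h.
by apply: (Cs s) => //; apply: JC; exists e' => //; rewrite -E.
Qed.

End EdgeTopology.

Lemma countable_avoid_near {R : realType} (A U : set R) (a b t : R) : countable A -> open U ->
  U t -> a < b -> a <= t <= b -> exists t', [/\ U t', a < t' < b & ~ A t'].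
Proof.
move=> cA oU Ut ab /andP[t1 t2].
have /nbhs_ballP[e /= e0 eU] : nbhs t U by exact: open_nbhs_nbhs.
have [|t' [h1 h2 h3]] := @countable_avoid R A (Num.max a (t - e)) (Num.min b (t + e)) cA.
  by rewrite lt_min !gt_max ab /=; apply/and3P; split; lra.
move: h1 h2; rewrite gt_max lt_min => /andP[h1 h1'] /andP[h2 h2'].
exists t'; split => //; last by rewrite h1.
by apply: eU; rewrite /ball /= ltr_norml; apply/andP; split; lra.
Qed.

(* Q u is a cross-section of the Reeb space over the strip: it fixes a direction
   u of the sphere factor, which becomes irrelevant on the boundary curves. *)
Record reeb_family {R : realType} {G : topologicalType} (c1 c2 : R -> R) (c : G -> R)
    (I : Type) (Q : I -> R * R -> G) : Prop := ReebFamily {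
  rf_c1 : continuous c1;
  rf_c2 : continuous c2;
  rf_lt : forall x, c1 x < c2 x;
  rf_Q : forall u, continuous (Q u);
  rf_cQ : forall u t x, in_strip c1 c2 t x -> c (Q u (t, x)) = t;
  rf_surj : forall g, exists u t x, in_strip c1 c2 t x /\ g = Q u (t, x);
  rf_c1_end : forall u u' x, Q u (c1 x, x) = Q u' (c1 x, x);
  rf_c2_end : forall u u' x, Q u (c2 x, x) = Q u' (c2 x, x) }.

Section Ray.
Context {R : realType} {G : topologicalType} (c1 c2 : R -> R) (c : G -> R).
Context (I : Type) (Q : I -> R * R -> G) (S : set G).
Hypothesis RF : reeb_family c1 c2 c Q.
Implicit Types (t x : R) (u : I).

Let cont_fst u x : continuous (fun t => Q u (t, x)).
Proof.
move=> t; apply: (@continuous_comp _ _ _ (fun t => (t, x)) (Q u)); last exact: (rf_Q RF).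
by apply: (@cvg_pair _ _ _ _ (nbhs t) (nbhs x)) => /=; [exact: cvg_id|exact: cvg_cst].
Qed.

(** The edges met by the ascending segment [ga] accumulate at [s], since critical levels are
    countable. The difficulty is that such an edge might descend below [s] elsewhere. It cannot: by
    injectivity of [c] the segment would have to follow the edge all the way down, and [s] would lie
    on it. *)
Lemma reeb_minimal_at u x s : pre_digraph S c -> countable (c @` S) -> NF R S = [set s] ->
  S s -> in_strip c1 c2 (c s) x -> Q u (c s, x) = s -> c s < c2 x ->
  exists2 C, NF_components (R := R) S C & minimal_at S c C s.
Proof.
move=> pd cS NFs Ss Dx Qs; set l := c s; set l2 := c2 x => ll2.
pose ga t := Q u (t, x).
have cga : continuous ga by exact: cont_fst.
have cgaE (t : R) : l <= t <= l2 -> c (ga t) = t.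
  move=> /andP[t1 t2]; rewrite /ga (rf_cQ RF) //; case/andP: Dx => d1 _.
  by rewrite /in_strip t2 (le_trans d1).
have [cc _ [hG _ _ _ _] inj] := pd.
pose arc := ga @` [set` `]l, l2]].
have arcs : arc `<=` ~` [set s].
  move=> g [t]; rewrite /= in_itv /= => /andP[t1 t2] <- E.
  by have := cgaE t; rewrite ltW // t2 => /(_ isT); rewrite E => tE; move: t1; rewrite -tE ltxx.
have arc_t (t : R) : l < t -> t <= l2 -> arc (ga t) by move=> t1 t2; exists t => //=; rewrite in_itv /= t1.
have carc : connected arc by exact: connected_itv_image.
pose C := connected_component (~` NF R S) (ga l2).
have NFE : ~` NF R S = ~` [set s] by rewrite NFs.
have arcC : arc `<=` C.
  by apply: connected_component_max => //; [exact: arc_t|rewrite NFE].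
have CE (t : R) : l < t -> t <= l2 -> connected_component (~` NF R S) (ga t) = C.
  by move=> t1 t2; apply: same_connected_component; apply: connected_component_sym; apply: arcC; exact: arc_t.
(* Whether [ga] starts along a single edge is unknown, so all the edges it meets are taken; they lie
   in one component because the segment above [s] is connected and avoids [s]. *)
pose J := [set e | edges S e /\ exists t, [/\ l < t, t <= l2 & e (ga t)]].
have avoid U (t : R) : open U -> U (ga t) -> l <= t <= l2 -> exists t', [/\ U (ga t'), l < t' < l2 & ~ S (ga t')].
  move=> oU Ut tl.
  have oU' : open (ga @^-1` U) by apply: open_comp => // ? _; exact: cga.
  have [t' [h1 h2 h3]] := countable_avoid_near cS oU' Ut ll2 tl.
  exists t'; split => // Sg; apply: h3; exists (ga t') => //.
  by apply: cgaE; case/andP: h2 => h h'; rewrite !ltW.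
have above e : J e -> forall g, e g -> l < c g.
  move=> [ee [t0 [lt0 t02 et0]]] g eg; rewrite ltNge; apply/negP => gl.
  have [F [cF FE]] := edge_param pd ee.
  have [a a1 aE] : (F @` openD1 R) g by rewrite FE.
  have [b b1 bE] : (F @` openD1 R) (ga t0) by rewrite FE.
  have [V oO eO] := edge_relatively_open pd ee.
  set lo := Num.min a b; set hi := Num.max a b.
  have lohi : lo <= hi by rewrite ge_min le_max lexx.
  have sub : `[lo, hi]%classic `<=` openD1 R.
    move=> r; move: a1 b1; rewrite /openD1 /= !in_itv /= => /andP[a1 a2] /andP[b1 b2] /andP[r1 r2].
    by rewrite (lt_le_trans _ r1) ?lt_min ?a1 //= (le_lt_trans r2) // gt_max a2.
  have cFI : {within `[lo, hi], continuous F} by exact: continuous_subspaceW cF.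
  pose K := F @` `[lo, hi]%classic.
  have Ke : K `<=` e by rewrite -FE; apply: image_subset.
  have clK : closed K.
    by apply: compact_closed => //; apply: continuous_compact => //; exact: segment_compact.
  pose A := ga @^-1` K.
  have clA : closed A by apply: preimage_closed => // ? _; exact: cga.
  (* The compact arc [K] of [e] from [g] to [ga t0] takes every level between [c g] and [t0]. As [c]
     is injective on [e], a point of [ga] that lies on [e] at such a level lies on [K]. *)
  have AT (t : R) : e (ga t) -> l <= t <= t0 -> A t.
    move=> egt /andP[lt tt0].
    have ct : c (ga t) = t by apply: cgaE; rewrite lt (le_trans tt0).
    have ct0 : c (ga t0) = t0 by apply: cgaE; rewrite (ltW lt0).
    have ccF : {within `[lo, hi], continuous (c \o F)}.
      by move=> r; apply: (@continuous_comp (subspace `[lo, hi]%classic) G R F c); [exact: cFI|exact: cc].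
    have ge_t : Num.min ((c \o F) lo) ((c \o F) hi) <= t <= Num.max ((c \o F) lo) ((c \o F) hi).
      have glt : c g <= t by exact: le_trans lt.
      rewrite /lo /hi; case: (leP a b) => _ /=; rewrite aE bE ct0 ge_min le_max glt tt0 ?orbT //.
    have [r ri rE] := IVT lohi ccF ge_t.
    exists r => //; apply: (inj e ee); rewrite ?inE //; last by rewrite ct.
    by rewrite -FE; exists r => //; exact: sub.
  have AA : `[l, t0]%classic `&` A = `[l, t0]%classic.
    have cI : connected (`[l, t0]%classic : set R).
      by apply/connected_intervalP; exact: interval_is_interval.
    apply: cI.
    - exists t0; split; first by rewrite /= in_itv /= lexx ltW.
      by apply: AT => //; rewrite lexx ltW.
    - exists (\bigcup_(W in [set W | open W /\ `[l, t0]%classic `&` W `<=` A]) W).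
        by apply: bigcup_open => W [].
      apply/seteqP; split=> t [It]; last by move=> [W [_ WA] Wt]; split => //; exact: WA.
      move=> At; split => //.
      have : e (ga t) by exact: Ke.
      rewrite eO => -[Ot _]; exists (ga @^-1` V) => //; split.
        by apply: open_comp => // ? _; exact: cga.
      (* Near a point of [A] the segment may still cross [S], and the edge is open only off [S]. If
         some [t1] nearby were outside the closed set [A], so would a nearby level that is not
         critical; but there the segment lies on [e], hence on [K]. *)
      move=> t1 [It1 Ot1]; apply: contrapT => nAt1.
      have oV : open (ga @^-1` V `&` ~` A).
        by apply: openI; [apply: open_comp => // ? _; exact: cga|exact: closed_openC].
      move: It1; rewrite /= in_itv /= => It1.
      have [t' [[Ot' nAt'] /andP[h1 h2] h3]] := countable_avoid_near cS oV (conj Ot1 nAt1) lt0 It1.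
      apply: nAt'; apply: AT; last by rewrite !ltW.
      rewrite eO; split => // Sg; apply: h3; exists (ga t') => //.
      by apply: cgaE; rewrite ltW // (le_trans (ltW h2)).
    - by exists A.
  have : A l.
    have : `[l, t0]%classic l by rewrite /= in_itv /= lexx ltW.
    by rewrite -AA => -[].
  by move=> /Ke; rewrite /ga Qs => /(edge_sub ee).
have edge_at U (t : R) : open U -> U (ga t) -> l <= t <= l2 -> exists e g, [/\ J e, e g & U g].
  move=> oU Ut tl; have [t' [Ut' /andP[h1 h2] Sg]] := avoid U t oU Ut tl.
  have [ee eg] := edge_mem Sg.
  exists (connected_component (~` S) (ga t')), (ga t'); split => //; split => //.
  by exists t'; rewrite h1 ltW.
exists C; first by exists (ga l2) => //; rewrite NFE; apply: arcs; exact: arc_t.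
exists J; split.
- have [|e [g [Je _ _]]] := edge_at setT l openT Logic.I; last by exists e.
  by rewrite lexx ltW.
- by move=> e [].
- move=> g [e [ee [t [t1 t2 et]]] eg]; rewrite -(CE t t1 t2).
  apply: (connected_component_max et) => //; last exact: edge_connected ee.
  by rewrite NFE => h /(edge_sub ee) Sh hs; apply: Sh; rewrite hs.
- move=> U; rewrite nbhsE => -[V [oV Vs] VU].
  have [| |e [g [Je eg Vg]]] := edge_at V l oV; first by rewrite /ga Qs.
    by rewrite lexx ltW.
  by exists g; split; [exists e|exact: VU].
- move=> z; have clc : closed [set z | l <= c z].
    by apply: (@preimage_closed _ _ c [set t | l <= t]); [move=> ? _; exact: cc|exact: closed_ge].
  move=> Zz; have sub : \bigcup_(e in J) e `<=` [set z | l <= c z].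
    by move=> g [e Je eg]; exact/ltW/(above e).
  by have := closureS sub Zz; rewrite -(proj1 (closure_id _) clc).
Qed.

(** Descend at fixed abscissa and direction to the graph of [c1]. If the descent met [s], then [s]
    would be at the upper end [c2 x] of that fibre, so the descent would have started at [s]. *)
Lemma reeb_minus_connected s :
  (forall u x, in_strip c1 c2 (c s) x -> Q u (c s, x) = s -> c2 x = c s) ->
  connected (~` [set s]).
Proof.
move=> top; have [u0 _] := rf_surj RF s.
have Dc1 x : in_strip c1 c2 (c1 x) x by rewrite /in_strip lexx ltW // (rf_lt RF).
have low x : Q u0 (c1 x, x) <> s.
  move=> E; have cE : c s = c1 x by rewrite -E (rf_cQ RF).
  have := top u0 x; rewrite cE Dc1 => /(_ isT E) E2.
  by have := rf_lt RF x; rewrite E2 ltxx.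
pose low_curve x := Q u0 (c1 x, x).
have clow : continuous low_curve.
  move=> x; apply: (@continuous_comp _ _ _ (fun x => (c1 x, x)) (Q u0)); last exact: (rf_Q RF).
  by apply: (@cvg_pair _ _ _ _ (nbhs (c1 x)) (nbhs x)) => /=; [exact: (rf_c1 RF)|exact: cvg_id].
apply: (@connected_pointed _ _ (low_curve 0)); first exact: low.
move=> g; have [u [t [x [Dt ->]]]] := rf_surj RF g => ns.
case/andP: (Dt) => t1 t2.
exists (low_curve @` [set: R] `|` (fun t => Q u (t, x)) @` `[c1 x, t]%classic); split.
- apply: connectedU.
  + exists (low_curve x); split; first by exists x.
    by exists (c1 x); rewrite /= ?in_itv /= ?lexx ?t1 //; exact: (rf_c1_end RF).
  + have -> : [set: R] = [set` `]-oo, +oo[] by apply/seteqP; split=> y //=; rewrite in_itv.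
    exact: connected_itv_image.
  + exact: connected_itv_image.
- move=> h [[y _ <-]|[t' /=]]; first exact: low.
  rewrite in_itv /= => /andP[h1 h2] <- E.
  have D' : in_strip c1 c2 t' x by rewrite /in_strip h1 (le_trans h2).
  have cE : c s = t' by rewrite -E (rf_cQ RF).
  have := top u x; rewrite cE => /(_ D' E) E2.
  by apply: ns; have -> : t = t' by apply/eqP; rewrite eq_le h2 -E2 t2.
- by left; exists 0.
- by right; exists t => //=; rewrite in_itv /= t1 lexx.
Qed.

End Ray.

Section Normality.
Context {R : realType} {G : topologicalType} (S : set G) (c : G -> R).

Lemma NF_class_refl C : @NF_components R G S C -> NF_class S c C C.
Proof. by move=> cC; split => //; exact: rst_refl. Qed.

Lemma normal_NF0 : NF R S = set0 -> normal S c.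
Proof.
move=> N0 _ [C cC ->]; exists C; split; first exact: NF_class_refl.
move=> C' [_ CC']; elim: CC' {cC} => // [C1 C2 [_ _ [s]]|C1 C2 C3 _ -> _ ->//].
by rewrite N0.
Qed.

Lemma normal_connected : connected (~` NF R S) -> normal S c.
Proof.
move=> cN _ [C cC ->]; exists C; split; first exact: NF_class_refl.
have E D : @NF_components R G S D -> D = ~` NF R S.
  by move=> [g Ng ->]; exact: connected_component_id.
by move=> C' [cC' _]; rewrite (E C') // (E C).
Qed.

End Normality.

Lemma reeb_familyN {R : realType} {G : topologicalType} (c1 c2 : R -> R) (c : G -> R)
    (I : Type) (Q : I -> R * R -> G) : reeb_family c1 c2 c Q ->
  reeb_family (fun x => - c2 x) (fun x => - c1 x) (fun g => - c g)
    (fun u p => Q u (- p.1, p.2)).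
Proof.
case=> cc1 cc2 lt12 cQ QE surj E1 E2; split.
- by move=> x; apply: cvgN; exact: cc2.
- by move=> x; apply: cvgN; exact: cc1.
- by move=> x; rewrite ltrN2.
- move=> u p; apply: (@continuous_comp _ _ _ (fun p : R * R => (- p.1, p.2)) (Q u)); last exact: cQ.
  apply: (@cvg_pair _ _ _ _ (nbhs (- p.1)) (nbhs p.2)) => /=; last exact: cvg_snd.
  by apply: cvgN; exact: cvg_fst.
- by move=> u t x; rewrite in_stripN => D; rewrite QE // opprK.
- move=> g; have [u [t [x [D ->]]]] := surj g; exists u, (- t), x.
  by rewrite in_stripN /= !opprK.
- by move=> u u' x /=; rewrite opprK.
- by move=> u u' x /=; rewrite opprK.
Qed.

Section ZeroSetRay.
Context {R : realType} (m : nat) (c1 c2 : R -> R).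
Hypothesis (hm : (1 < m)%N) (c12 : zero_set_pair c1 c2).
Local Notation X := (@zero_set R m c1 c2).
Local Notation i1 := (inord 1 : 'I_m.+1).
Local Notation proj := (@zero_set_proj R m c1 c2).
Local Notation S := (@ZS R m c1 c2).
Local Notation c := (@Zc R m c1 c2).

Lemma countable_ZS : countable (c @` S).
Proof.
have [a1 a2 _] := c12.
apply: (@sub_countable _ _ _ (\bigcup_(b in [set: bool])
    (if b then c1 else c2) @` [set x | derive1 (if b then c1 else c2) x = 0])).
  apply: subset_card_le => _ [_ [p /(critical_pointsE hm c12) pp <-] <-].
  rewrite /Zc reeb_barE /zero_set_proj /first_coord.
  by case: pp => -[-> d0]; [exists true|exists false] => //; exists (set_val p ord0 i1).
by apply: bigcup_countable => [|[] _]; [exact: countableP|exact: countable_critical_values|exact: countable_critical_values].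
Qed.

(** Nothing is assumed about slices: a full line may occur, and then the directions in the sphere
    need not be identified on that level, so they are kept as an index. *)
Lemma zero_set_reeb_family : reeb_family c1 c2 c
  (fun (u : {u | @sphere_vector R m u}) (p : R * R) =>
     reeb_proj proj (emb hm c12 (proj2_sig u) p.1 p.2)).
Proof.
have [a1 a2 lt12] := c12.
have Dc1 x : in_strip c1 c2 (c1 x) x by rewrite /in_strip lexx ltW.
have Dc2 x : in_strip c1 c2 (c2 x) x by rewrite /in_strip lexx ltW.
split => //.
- exact: real_analytic_continuous.
- exact: real_analytic_continuous.
- move=> u p; apply: (@continuous_comp _ _ _ (fun p : R * R => emb hm c12 (proj2_sig u) p.1 p.2) (reeb_proj proj)).
    exact: continuous_emb.
  exact: reeb_proj_continuous.
- by move=> u t x D; rewrite /Zc reeb_barE proj_emb.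
- move=> g; have [p ->] := reeb_proj_surj g; have [u [hu pE]] := emb_surj hm c12 p.
  exists (exist _ u hu), (set_val p ord0 ord0), (set_val p ord0 i1).
  by split; [exact: in_strip_zero_set|rewrite {1}pE].
- move=> u u' x /=; congr reeb_proj; apply: emb_radius0 => //.
  by apply/eqP; rewrite -sqrf_eq0 sqr_radius // subrr mul0r.
- move=> u u' x /=; congr reeb_proj; apply: emb_radius0 => //.
  by apply/eqP; rewrite -sqrf_eq0 sqr_radius // subrr mulr0.
Qed.

(** A ray has only one kind of incidence. If the edge departs, no component has a minimum at [s], so
    no fibre can be climbed from [s], and the complement of [s] is connected. *)
Lemma ray_normal out : zero_set_pre_digraph m c1 c2 ->
  diagram_isomorphic (zero_set_GDNF m c1 c2) (ray_diagram out) -> normal S c.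
Proof.
move=> pd [f [g [[f' fK f'K] [g' gK g'K] dep ent]]].
have RF := zero_set_reeb_family; have cS := countable_ZS.
pose s := set_val (g' tt); have Ns : NF R S s by exact: set_valP.
have NFs : NF R S = [set s].
  apply/seteqP; split=> [h Nh|h ->//].
  pose e : edge (zero_set_GDNF m c1 c2) := exist (fun h => h \in NF R S) h (mem_set Nh).
  rewrite /s; have -> : g' tt = e by rewrite -[RHS]gK; case: (g e).
  by [].
have vertex_of C : @NF_components R _ S C -> exists v : vertex (zero_set_GDNF m c1 c2), set_val v C.
  move=> cC; have VC : NF_classes S c (NF_class S c C) by exists C.
  exists (exist (fun V => V \in NF_classes S c) _ (mem_set VC)).
  exact: (NF_class_refl c cC).
have comp_of (v : vertex (zero_set_GDNF m c1 c2)) C : set_val v C -> C `<=` ~` [set s].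
  move=> vC; have [C0 _ vE] : NF_classes S c (set_val v) by exact: set_valP.
  move: vC; rewrite vE => -[[h Nh ->] _]; rewrite -NFs.
  exact: connected_component_sub.
apply: normal_connected; rewrite NFs.
have [outE|outE] : out = true \/ out = false by case: (out); [left|right].
(* The edge does depart from the vertex, so [s] is the maximum of a family of edges in some
   component; this is what puts [s] into the critical set. *)
- have Ss : S s.
    have [_] := dep (g' tt) (f' tt); rewrite /= => /(_ outE)[C vC mC].
    exact: (extremal_at_mem pd (comp_of _ _ vC) mC).
  apply: (reeb_minus_connected RF) => u x D QE; apply/eqP; rewrite eq_le.
  have /andP[_ ->] := D; rewrite andbT leNgt; apply/negP => lt_s.
  have [C cC mC] := reeb_minimal_at RF pd cS NFs Ss D QE lt_s.
  have [v vC] := vertex_of _ cC.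
  have [+ _] := ent (g' tt) v; move=> /(_ (ex_intro2 _ _ C vC mC)).
  by rewrite /= outE.
- have Ss : S s.
    have [_] := ent (g' tt) (f' tt); rewrite /= => /(_ outE)[C vC mC].
    exact: (extremal_at_mem pd (comp_of _ _ vC) mC).
  (* An entering edge is reduced to the departing case by negating levels, which exchanges the two
     boundary curves. *)
  have RFN := reeb_familyN RF.
  have pdN : pre_digraph S (fun g => - c g).
    by apply: pre_digraphN; have -> : (fun g => - - c g) = c by apply/funext => h; rewrite opprK.
  have cSN : countable ((fun g => - c g) @` S).
    have -> : (fun g => - c g) @` S = -%R @` (c @` S) by rewrite -image_comp.
    by apply: card_le_trans (card_image_le _ _) _; exact: cS.
  apply: (reeb_minus_connected RFN) => u x D QE; apply/eqP; rewrite eq_le.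
  have /andP[_ ->] := D; rewrite andbT leNgt; apply/negP => lt_s.
  have [C cC] := reeb_minimal_at RFN pdN cSN NFs Ss D QE lt_s.
  rewrite minimal_atN => mC; have [v vC] := vertex_of _ cC.
  have [+ _] := dep (g' tt) v; move=> /(_ (ex_intro2 _ _ C vC mC)).
  by rewrite /= outE.
Qed.

End ZeroSetRay.

Theorem theorem2 (R : realType) (m : nat) (hm : (1 < m)%N) :
  (forall c1 c2 : R -> R,
     zero_set_pair c1 c2 ->
     SAB_at_infinity_in_top c1 c2 ->
     zero_set_pre_digraph m c1 c2 ->
     diagram_isomorphic (zero_set_GDNF m c1 c2) point_diagram \/
     (exists out : bool,
        diagram_isomorphic (zero_set_GDNF m c1 c2) (ray_diagram out)) ->
     zero_set_normal m c1 c2)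
  /\
  (forall K : diagram,
     [\/ K = segment_diagram, K = two_out_diagram | K = two_in_diagram] ->
     forall n : vertex K -> nat, (forall v, (0 < n v)%N) ->
     exists c1 c2 : R -> R,
       [/\ zero_set_pair c1 c2,
           SAB_at_infinity_in_top c1 c2,
           zero_set_pre_digraph m c1 c2
         & exists (f : vertex (zero_set_GDNF m c1 c2) -> vertex K)
                  (g : edge (zero_set_GDNF m c1 c2) -> edge K),
             is_diagram_iso f g /\
             forall v : vertex (zero_set_GDNF m c1 c2),
               class_of_vertex v #= `I_(n (f v))]).
Proof.
split; last by move=> K; exact: diagram_realization.
move=> c1 c2 c12 _ pd iso; split => //; case: iso => [[_ [g _]]|[out]]; last exact: ray_normal.
apply: normal_NF0; apply/seteqP; split => // s Ns.
by case: (g (exist (fun s => s \in NF R (@ZS R m c1 c2)) s (mem_set Ns))).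
Qed.
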